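(* Consider the combinatorial causal bandit problem with budget $K$ and horizon $T$ on a Markovian binary generalized linear model (BGLM) $G=(\boldsymbol X\cup\{Y\},E)$ with $n$ nodes, and suppose Assumptions 1, 2 and 3 stated in the context hold, with constants $L_{f_X}^{(1)},L_{f_X}^{(2)},\kappa,\zeta$. Let $D=\max_{X\in\boldsymbol X\cup\{Y\}}|\mathrm{Pa}(X)|$ and $L^{(1)}_{\max}=\max_{X\in\boldsymbol X\cup\{Y\}}L^{(1)}_{f_X}$. Then the regret of the algorithm BGLM-OFU (described in the context) satisfies $$R(T)=O\left(\frac1\kappa\, n\,L^{(1)}_{\max}\sqrt{DT}\,\log T\right),$$ where terms of order $o(\sqrt T)$ are omitted; that is, there is an absolute constant $C>0$ such that for every fixed such model, $R(T)\le C\,\frac1\kappa\, n\,L^{(1)}_{\max}\sqrt{DT}\log T+o(\sqrt T)$ as $T\to\infty$.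
   Context: **Model.** $G=(\boldsymbol X\cup\{Y\},E)$ is a finite DAG with $n$ nodes; all variables are $\{0,1\}$-valued and $Y$ has no outgoing edges. There are no hidden variables; a special node $X_1\in\boldsymbol X$ always equals $1$ and is a parent of every other node. $\mathrm{Pa}(X)$ is the parent set of $X$ (also the random vector of parent values), $\mathrm{pa}(X)$ a value of it. Below, statements about parameters of ''every $X$'' concern nodes $X\ne X_1$. BGLM: for every $X$ there are a scalar monotone non-decreasing function $f_X$, an unknown weight vector $\boldsymbol\theta^*_X\in[0,1]^{|\mathrm{Pa}(X)|}$ and a zero-mean sub-Gaussian noise $\varepsilon_X$ (mutually independent over nodes and rounds) such that, given $\boldsymbol\varepsilon=(\varepsilon_X)_X$, $P(X=1\mid \mathrm{Pa}(X)=\mathrm{pa}(X))=f_X(\boldsymbol\theta^*_X\cdot \mathrm{pa}(X))+\varepsilon_X\in[0,1]$. Equivalently, with thresholds $\gamma_X$ i.i.d. uniform on $[0,1]$, processing nodes in topological order, $X=1$ iff $f_X(\boldsymbol\theta^*_X\cdot \mathrm{Pa}(X))+\varepsilon_X\ge\gamma_X$. The intervention $do(\boldsymbol S)$, $\boldsymbol S\subseteq\boldsymbol X$, forces all nodes of $\boldsymbol S$ to be $1$. $\sigma(\boldsymbol S,\boldsymbol\theta)$ denotes $\mathbb E[Y\mid do(\boldsymbol S)]$ when the parameter vector is $\boldsymbol\theta=(\boldsymbol\theta_X)_X$ (computed via the threshold description). **Problem.** The graph is known, $\boldsymbol\theta^*$ is unknown. In each round $t=1,\dots,T$ the agent chooses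 $\boldsymbol S_t\subseteq\boldsymbol X$, $|\boldsymbol S_t|\le K$, plays $do(\boldsymbol S_t)$, and observes the values $(\boldsymbol X_t,Y_t)$ of all nodes (fresh independent randomness each round). Regret: $R(T)=\mathbb E\big[\sum_{t=1}^T(\sigma(\boldsymbol S^*,\boldsymbol\theta^* )-\sigma(\boldsymbol S_t,\boldsymbol\theta^* ))\big]$ with $\boldsymbol S^*\in\mathrm{argmax}_{\boldsymbol S\subseteq\boldsymbol X,|\boldsymbol S|=K}\sigma(\boldsymbol S,\boldsymbol\theta^* )$. **Assumption 1.** Each $f_X$ is twice differentiable, with first and second derivatives bounded (in absolute value) by $L_{f_X}^{(1)}>0$ and $L_{f_X}^{(2)}>0$. **Assumption 2.** $\kappa:=\inf_{X,\ \boldsymbol v\in[0,1]^{|\mathrm{Pa}(X)|},\ \|\boldsymbol\theta-\boldsymbol\theta^*_X\|\le1}\dot f_X(\boldsymbol v\cdot\boldsymbol\theta)>0$. **Assumption 3.** There is a constant $\zeta>0$ such that for every $X$, every $X'\in \mathrm{Pa}(X)\setminus\{X_1\}$ and every $\boldsymbol v\in\{0,1\}^{|\mathrm{Pa}(X)\setminus\{X',X_1\}|}$, with no intervention, $\Pr\{X'=b\mid \mathrm{Pa}(X)\setminus\{X',X_1\}=\boldsymbol v\}\ge\zeta$ for both $b=0$ and $b=1$ (probability over noise and variables). **Algorithm BGLM-OFU.** Notation: $\|\boldsymbol x\|_M=\sqrt{\boldsymbol x^\top M\boldsymbol x}$. Let $c>0$ be an absolute constant for which the Lecué–Mendelson inequality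 holds: if $\boldsymbol v_1,\dots,\boldsymbol v_k$ are i.i.d. copies of a random vector $\boldsymbol v\in\mathbb R^d$ with $\Pr\{|\boldsymbol v^\top\boldsymbol z|>\alpha^{1/2}\}\ge\beta$ for all unit vectors $\boldsymbol z$ ($\alpha\ge0$, $0<\beta\le1$), and $k\ge cd/\beta^2$, then $\Pr\{\lambda_{\min}(\frac1k\sum_i\boldsymbol v_i\boldsymbol v_i^\top)\le\alpha\beta/2\}\le\exp(-k\beta^2/c)$. Set $\delta=\frac1{3n\sqrt T}$, $R=\max_X\big\lceil\frac{512D(L^{(2)}_{f_X})^2}{\kappa^4}(D^2+\ln\frac1\delta)\big\rceil$, $T_0=\big\lceil\max\{\frac c{\zeta^2}\ln\frac1\delta,\frac{(8n^2-16n+2)R}{\zeta}\}\big\rceil$, $\rho=\frac3\kappa\sqrt{\log(1/\delta)}$. In rounds $1,\dots,T_0$ do no intervention. In each round $t=T_0+1,\dots,T$: for each $X$, use the data pairs $(\boldsymbol V_{i,X},X^i)$ for rounds $i\le t-1$ with $X\notin\boldsymbol S_i$, where $\boldsymbol V_{i,X}$ is the vector of parent values of $X$ and $X^i$ the value of $X$ in round $i$; let $\hat{\boldsymbol\theta}_{t-1,X}$ solve $\sum_i(X^i-f_X(\boldsymbol V_{i,X}^\top\boldsymbol\theta_X))\boldsymbol V_{i,X}=0$, let $M_{t-1,X}=\sum_i\boldsymbol V_{i,X}\boldsymbol V_{i,X}^\top$, and $\mathcal C_{t,X}=\{\boldsymbol\theta'_X\in[0,1]^{|\mathrm{Pa}(X)|}:\|\boldsymbol\theta'_X-\hat{\boldsymbol\theta}_{t-1,X}\|_{M_{t-1,X}}\le\rho\}$.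 Choose $(\boldsymbol S_t,\tilde{\boldsymbol\theta}_t)\in\mathrm{argmax}\,\sigma(\boldsymbol S,\boldsymbol\theta')$ over $\boldsymbol S\subseteq\boldsymbol X$, $|\boldsymbol S|\le K$, and $\boldsymbol\theta'$ with $\boldsymbol\theta'_X\in\mathcal C_{t,X}$ for all $X$; play $do(\boldsymbol S_t)$. *)

(* Defs.v *)
From HB Require Import structures.
From mathcomp Require Import all_boot all_order all_algebra.
From mathcomp Require Import all_classical all_reals all_analysis.

Set Implicit Arguments.
Unset Strict Implicit.
Unset Printing Implicit Defensive.

Import Order.TTheory GRing.Theory Num.Theory.
Import numFieldNormedType.Exports.

Local Open Scope classical_set_scope.
Local Open Scope ring_scope.

Section LinearAlgebra.
Variable R : realType.

Definition dotv d (u v : 'cV[R]_d) : R := (u^T *m v) 0 0.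

(* The library norm on matrices is the sup norm, hence this Euclidean one. *)
Definition norm2 d (u : 'cV[R]_d) : R := Num.sqrt (dotv u u).

Definition mxnorm d (M : 'M[R]_d) (u : 'cV[R]_d) : R :=
  Num.sqrt ((u^T *m M *m u) 0 0).

(* Only used for real symmetric matrices of positive size, whose set of
   eigenvalues is finite and nonempty. *)
Definition lambda_min d (M : 'M[R]_d) : R := inf [set a : R | eigenvalue M a].

Definition unit_cube d (u : 'cV[R]_d) : Prop := forall i, 0 <= u i 0 <= 1.

(* The ceiling as a natural number, meaningful for x > -1 only. *)
Definition ceiln (x : R) : nat := `|Num.ceil x|%N.

End LinearAlgebra.

Section Probability.
Variable R : realType.

Definition mutually_independent d (Omega : measurableType d)
    (P : probability Omega R) d' (V : measurableType d') (I : eqType)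
    (X : I -> {RV P >-> V}) : Prop :=
  forall (s : seq I) (B : I -> set V), uniq s ->
    (forall i, measurable (B i)) ->
    P (\bigcap_(i in [set` s]) X i @^-1` B i) =
    (\big[mule/1]_(i <- s) P (X i @^-1` B i))%E.

Definition identically_distributed d (Omega : measurableType d)
    (P : probability Omega R) d' (V : measurableType d') (I : Type)
    (X : I -> {RV P >-> V}) : Prop :=
  forall (i j : I) (B : set V), measurable B ->
    P (X i @^-1` B) = P (X j @^-1` B).

Definition sub_gaussian d (Omega : measurableType d)
    (P : probability Omega R) (X : {RV P >-> R}) : Prop :=
  exists s : R, forall l : R, ('M_P X l <= (expR (s ^+ 2 * l ^+ 2 / 2))%:E)%E.

(* With the convention 0 / 0 = 0. *)
Definition cond_prob d (Omega : measurableType d) (P : probability Omega R)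
    (A B : set Omega) : R := fine (P (A `&` B)) / fine (P B).

Definition col_of_tuple k (v : k.-tuple R) : 'cV[R]_k := \col_i tnth v i.

Definition lecue_mendelson (c : R) : Prop :=
  forall (d : measure_display) (Omega : measurableType d)
    (P : probability Omega R) (m k : nat)
    (v : 'I_k -> {RV P >-> m.-tuple R}) (alpha beta : R),
  (0 < m)%N ->
  mutually_independent v -> identically_distributed v ->
  0 <= alpha -> 0 < beta <= 1 ->
  (forall (i : 'I_k) (z : 'cV[R]_m), norm2 z = 1 ->
    (beta%:E <=
     P [set w | Num.sqrt alpha < `|dotv (col_of_tuple (v i w)) z|]%R)%E) ->
  c * m%:R / beta ^+ 2 <= k%:R ->
  (P [set w | lambda_min
        (k%:R^-1 *: \sum_(i < k)
           (col_of_tuple (v i w) *m (col_of_tuple (v i w))^T))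
      <= alpha * beta / 2]%R
   <= (expR (- (k%:R * beta ^+ 2 / c)))%:E)%E.

End Probability.

(* [root] is the special node X_1 and [target] is the outcome node Y. *)
Record causal_graph := CausalGraph {
  node : finType;
  edge : rel node;
  root : node;
  target : node;
  edge_acyclic : forall p : seq node, cycle edge p -> p = [::];
  edge_root : forall x, x != root -> edge root x;
  edge_target : forall x, ~~ edge target x;
  target_neq_root : target != root }.

Definition par (G : causal_graph) (x : node G) : {set node G} :=
  [set y | edge y x]%SET.

(* The coordinates of a weight vector of x are indexed by the rank of the
   parents in [enum (par x)]. *)
Definition params (R : realType) (G : causal_graph) : Type :=
  forall x : node G, 'cV[R]_#|par x|.

Record bglm (R : realType) (G : causal_graph) := Bglm {
  link : node G -> R -> R;
  weight : params R G;
  link_homo : forall x, x != root G -> {homo link x : a b / a <= b};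
  weight_cube : forall x, x != root G -> unit_cube (weight x) }.

Section Causal.
Variables (R : realType) (G : causal_graph) (f : node G -> R -> R).

Definition valuation : Type := {ffun node G -> bool}.

Definition parv (x : node G) (v : valuation) : 'cV[R]_#|par x| :=
  \col_i (v (enum_val i))%:R.

(* The structural equations under do(S), for the noise values e and the
   thresholds g. *)
Definition threshold_step (S : {set node G}) (th : params R G)
    (e g : node G -> R) (v : valuation) : valuation :=
  [ffun x => [|| x \in S, x == root G |
                 g x <= f x (dotv (th x) (parv x v)) + e x]].

(* Iterating as many times as there are nodes reaches the value computed in
   topological order: the unique solution of the structural equations, see
   [outcomeE] and [outcome_uniq]. *)
Definition outcome (S : {set node G}) (th : params R G)
    (e g : node G -> R) : valuation :=
  iter #|node G| (threshold_step S th e g) [ffun=> false].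

Lemma iter_threshold_step_path S th e g k (v v' : valuation) x :
  iter k (threshold_step S th e g) v x
    != iter k (threshold_step S th e g) v' x ->
  exists2 p, size p = k & path (fun a b => edge b a) x p.
Proof.
elim: k x => [|k IH] x; first by exists [::].
rewrite !iterS !ffunE => neq.
have [y yx neqy] : exists2 y, edge y x &
    iter k (threshold_step S th e g) v y
      != iter k (threshold_step S th e g) v' y.
  apply/exists_inP; apply: contraNT neq => /exists_inPn eqy.
  suff -> : parv x (iter k (threshold_step S th e g) v)
          = parv x (iter k (threshold_step S th e g) v') by [].
  apply/colP => i; rewrite !mxE; congr (_%:R); congr nat_of_bool.
  apply/eqP; rewrite -[_ == _]negbK; apply: eqy.
  by have := enum_valP i; rewrite inE.
have [p sp pp] := IH _ neqy.
by exists (y :: p); rewrite /= ?sp ?yx.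
Qed.

Lemma path_edge_uniq (x : node G) p :
  path (fun a b => edge b a) x p -> uniq (x :: p).
Proof.
elim: p x => [//|y p IH] x xyp; have /andP[yx yp] := xyp.
rewrite cons_uniq IH// andbT; apply/negP => xin.
case/path.splitP: xin xyp => p1 p2.
rewrite cat_path => /andP[cyc _].
have : cycle (@edge G) (rev (x :: p1)) by rewrite rev_cycle.
move=> /edge_acyclic /(congr1 size); by rewrite size_rev.
Qed.

Lemma iter_threshold_step_const S th e g (v v' : valuation) :
  iter #|node G| (threshold_step S th e g) v =
  iter #|node G| (threshold_step S th e g) v'.
Proof.
apply/ffunP => x; apply/eqP; apply/negPn/negP.
move=> /iter_threshold_step_path[p sp /path_edge_uniq/card_uniqP] /=.
by move=> cp; have := max_card (mem (x :: p)); rewrite cp sp ltnn.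
Qed.

Lemma outcomeE S th e g :
  outcome S th e g = threshold_step S th e g (outcome S th e g).
Proof.
by rewrite -iterS iterSr; apply: iter_threshold_step_const.
Qed.

Lemma outcome_uniq S th e g (v : valuation) :
  v = threshold_step S th e g v -> v = outcome S th e g.
Proof.
move=> vE; rewrite /outcome (iter_threshold_step_const _ _ _ _ _ v).
by elim: #|_| => [//|k IH]; rewrite iterS -IH.
Qed.

Definition admissible (K : nat) (S : {set node G}) : Prop :=
  target G \notin S /\ (#|S| <= K)%N.

End Causal.

Arguments parv {R G}.

Section Environment.
Variables (R : realType) (G : causal_graph) (B : bglm R G).
Variables (d : measure_display) (Omega : measurableType d).
Variables (P : probability Omega R).
(* [eps t x] and [gam t x] are the noise and the threshold of node x in round
   t >= 1; those of index 0 are one further independent copy, with which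
   quantities about a generic round (sigma, observational probabilities) are
   defined. *)
Variables (eps gam : nat -> node G -> {RV P >-> R}).

Definition bglm_noise : Prop :=
  [/\ mutually_independent
        (fun i : (nat * node G) + (nat * node G) =>
           match i with inl (t, x) => eps t x | inr (t, x) => gam t x end),
      forall x, identically_distributed (eps^~ x),
      forall t x, x != root G -> ('E_P[eps t x] = 0)%E /\ sub_gaussian (eps t x),
      forall t x (v : valuation G), x != root G -> v (root G) ->
        {ae P, forall w,
          0 <= link B x (dotv (weight B x) (parv x v)) + eps t x w <= 1} &
      forall t x (A : set R), measurable A ->
        P (gam t x @^-1` A) = uniform_prob (@ltr01 R) A].

Definition round_outcome (t : nat) (S : {set node G}) (th : params R G)
    (w : Omega) : valuation G :=
  outcome (link B) S th (fun x => eps t x w) (fun x => gam t x w).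

(* E[Y | do(S)] under the weights th, which need not be the true ones. *)
Definition sigma (S : {set node G}) (th : params R G) : R :=
  fine ('E_P[fun w => ((round_outcome 0 S th w (target G))%:R)%R])%E.

Definition kappa : R :=
  inf [set r | exists (x : node G) (v th : 'cV[R]_#|par x|),
        [/\ x != root G, unit_cube v, norm2 (th - weight B x) <= 1 &
            r = derive1 (link B x) (dotv v th)]].

Definition smooth_links (L1 L2 : node G -> R) : Prop :=
  forall x, x != root G ->
  [/\ 0 < L1 x, 0 < L2 x,
      forall z, derivable (link B x) z 1,
      forall z, derivable (derive1 (link B x)) z 1 &
      forall z, `|derive1 (link B x) z| <= L1 x /\
        `|derive1 (derive1 (link B x)) z| <= L2 x].

(* Only the values of u at the parents of x other than x' and X_1 matter. *)
Definition parents_vary (zeta : R) : Prop :=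
  0 < zeta /\
  forall (x x' : node G) (u : valuation G) (b : bool),
    x != root G -> x' \in par x -> x' != root G ->
    zeta <= cond_prob P
      [set w | round_outcome 0 finset.set0 (weight B) w x' = b]
      [set w | forall y, y \in par x -> y != x' -> y != root G ->
                 round_outcome 0 finset.set0 (weight B) w y = u y].

Definition optimal_set (K : nat) (S : {set node G}) : Prop :=
  [/\ target G \notin S, #|S| = K &
      forall S' : {set node G}, target G \notin S' -> #|S'| = K ->
        sigma S' (weight B) <= sigma S (weight B)].

(* One observed round: the intervened set and the values of all nodes. *)
Definition observation : Type := ({set node G} * valuation G)%type.

(* A policy maps the observations of the previous rounds, in order, to the
   next intervention. *)
Definition policy : Type := seq observation -> {set node G}.

Fixpoint history (pi : policy) (w : Omega) (t : nat) : seq observation :=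
  if t is t'.+1 then
    let h := history pi w t' in
    rcons h (pi h, round_outcome t (pi h) (weight B) w)
  else [::].

(* Rounds are numbered from 1: this is S_t for t >= 1. *)
Definition played (pi : policy) (w : Omega) (t : nat) : {set node G} :=
  pi (history pi w t.-1).

Definition regret (Sopt : {set node G}) (pi : policy) (T : nat) : \bar R :=
  ('E_P[fun w => (\sum_(1 <= t < T.+1)
          (sigma Sopt (weight B) - sigma (played pi w t) (weight B)))%R])%E.

Definition maxdeg : nat := \max_(x : node G) #|par x|.

Definition max_slope (L1 : node G -> R) : R :=
  \big[Num.max/0]_(x | x != root G) L1 x.

Section Algorithm.
Variables (L2 : node G -> R) (zeta c : R) (K T : nat).

Let n : R := #|node G|%:R.

Definition delta : R := (3 * n * Num.sqrt T%:R)^-1.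

Definition eigen_threshold : nat :=
  \max_(x | x != root G)
    ceiln (512 * maxdeg%:R * L2 x ^+ 2 / kappa ^+ 4
           * (maxdeg%:R ^+ 2 + ln delta^-1)).

Definition init_rounds : nat :=
  ceiln (Num.max (c / zeta ^+ 2 * ln delta^-1)
           ((8 * n ^+ 2 - 16 * n + 2) * eigen_threshold%:R / zeta)).

Definition radius : R := 3 / kappa * Num.sqrt (ln delta^-1).

Definition score (h : seq observation) (x : node G) (th : 'cV[R]_#|par x|) :
    'cV[R]_#|par x| :=
  \sum_(o <- h | x \notin o.1)
    ((o.2 x)%:R - link B x (dotv (parv x o.2) th)) *: parv x o.2.

Definition gram (h : seq observation) (x : node G) : 'M[R]_#|par x| :=
  \sum_(o <- h | x \notin o.1) parv x o.2 *m (parv x o.2)^T.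

Definition in_confidence_region (h : seq observation) (hat th : params R G) :
    Prop :=
  forall x, x != root G ->
    unit_cube (th x) /\ mxnorm (gram h x) (th x - hat x) <= radius.

(* A solution of the estimating equation may fail to exist, and the confidence
   region may be empty. In these two cases the corresponding choice is left
   arbitrary, except that the budget is always respected. When the confidence
   region is nonempty the maximum is attained, by compactness. *)
Definition bglm_ofu (pi : policy) : Prop :=
  exists hat tilde : seq observation -> params R G,
  forall h : seq observation, (size h < T)%N ->
    if (size h < init_rounds)%N then pi h = finset.set0 else
    [/\ admissible K (pi h),
        forall x, x != root G ->
          (exists th : 'cV[R]_#|par x|, score h th = 0) -> score h (hat h x) = 0 &
        (exists th, in_confidence_region h (hat h) th) ->
          in_confidence_region h (hat h) (tilde h) /\
          forall S th, admissible K S -> in_confidence_region h (hat h) th ->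
            sigma S th <= sigma (pi h) (tilde h)].

End Algorithm.

End Environment.

(* Main.v *)
(* The model is fixed while T grows, so constants depending on it cost only lower
   order terms, and counting parent configurations replaces the elliptical
   potential.  For a node x and a set A of active parents, let N_A be the number
   of past rounds in which x was free with configuration A, and Z_A the centred
   sum of the values of x in these rounds.  The noise part of the score in
   direction u is at most sqrt(chi2) times the Gram norm of u, where chi2 is the
   sum of Z_A^2 / N_A, and exponential supermartingales on a dyadic grid of
   O(log T)^(number of configurations) tilts give chi2 <= 5 ln(1/delta) with high
   probability.  Once the Gram matrix is well conditioned, which Lecue-Mendelson
   provides after the initial rounds, the estimator stays so close to the true
   weights that the links have slope at least (3/4) kappa, hence its Gram norm
   error is at most rho.  Optimism and a coupling at the first node whose value
   changes bound the regret of a round by the expected confidence widths of the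
   configurations of the free nodes; the potential, the sum of 2 sqrt(N_A), shows
   that these add up to O(sqrt(T log T)), which is eventually below the claimed
   bound with C = 1.  The rounds before that threshold, T in all, go into r. *)

Require Import Defs.
From HB Require Import structures.
From mathcomp Require Import all_boot all_order all_algebra.
From mathcomp Require Import all_classical all_reals all_analysis.
From mathcomp Require Import measurable_realfun.
From mathcomp Require Import ring lra zify.

Set Implicit Arguments.
Unset Strict Implicit.
Unset Printing Implicit Defensive.

Import Order.TTheory GRing.Theory Num.Theory.
Import numFieldNormedType.Exports.

Local Open Scope classical_set_scope.
Local Open Scope ring_scope.

(** * Convex estimating equations *)

Section Analysis.
Variable R : realType.

(** The constant 5 in the bound on [chi2] is boxed in from both sides. Write l = ln(1/delta). The
    tail exponent is 7/32 of the threshold, so 5 l yields exp(-35/32 l): the surplus 3/32 l pays for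
    the polylogarithmic number of tilts, and exp(-l) = 1/(3 n sqrt T), summed over nodes and rounds,
    costs O(sqrt T). Conversely, slopes of at least 3/4 kappa turn [chi2] <= 5 l into a squared Gram
    error of 80/9 l / kappa^2, just below the squared radius 9 l / kappa^2. C = 1 is possible
    because kappa is at most the maximal slope: all model factors of the claimed bound are at least
    1, so it is at least sqrt T ln T. The spare factor sqrt(log T) then absorbs every model
    constant, even the 2^n configurations. The obstacle is adaptivity with noise of arbitrary law.
    The events that matter compare a threshold with a shifted noise, and the policy reads all past
    values. Independence is therefore settled once, for cylinders in the (noise, threshold) pairs;
    afterwards only finite sums against [outcome_law], iterated in [hexp], remain. *)

Lemma dotvE d (u v : 'cV[R]_d) : dotv u v = \sum_i u i 0 * v i 0.
Proof. by rewrite /dotv mxE; apply: eq_bigr => i _; rewrite mxE. Qed.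

Lemma dotvC d (u v : 'cV[R]_d) : dotv u v = dotv v u.
Proof. by rewrite !dotvE; apply: eq_bigr => i _; rewrite mulrC. Qed.

Lemma dotvDr d (u v w : 'cV[R]_d) : dotv u (v + w) = dotv u v + dotv u w.
Proof. by rewrite /dotv mulmxDr mxE. Qed.

Lemma dotvZr d (u v : 'cV[R]_d) a : dotv u (a *: v) = a * dotv u v.
Proof. by rewrite /dotv -scalemxAr mxE. Qed.

Lemma dotvBr d (u v w : 'cV[R]_d) : dotv u (v - w) = dotv u v - dotv u w.
Proof. by rewrite -scaleN1r dotvDr dotvZr mulN1r. Qed.

Lemma dotvDl d (u v w : 'cV[R]_d) : dotv (v + w) u = dotv v u + dotv w u.
Proof. by rewrite dotvC dotvDr !(dotvC u). Qed.

Lemma dotvZl d (u v : 'cV[R]_d) a : dotv (a *: u) v = a * dotv u v.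
Proof. by rewrite dotvC dotvZr dotvC. Qed.

Lemma dotv_ge0 d (u : 'cV[R]_d) : 0 <= dotv u u.
Proof. by rewrite dotvE sumr_ge0// => i _; rewrite -expr2 sqr_ge0. Qed.

Lemma dotv_eq0 d (u : 'cV[R]_d) : dotv u u = 0 -> u = 0.
Proof.
rewrite dotvE => /eqP; rewrite psumr_eq0; last by move=> i _; rewrite -expr2 sqr_ge0.
move=> /allP u0; apply/colP => i; rewrite mxE; apply/eqP.
by have := u0 i (mem_index_enum i); rewrite /= -expr2 sqrf_eq0.
Qed.

Lemma dotv_suml d (I : Type) (s : seq I) (P : pred I) (F : I -> 'cV[R]_d) u :
  dotv (\sum_(i <- s | P i) F i) u = \sum_(i <- s | P i) dotv (F i) u.
Proof.
elim/big_rec2 : _ => [|i y1 y2 _ <-]; first by rewrite /dotv linear0 mul0mx mxE.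
exact: dotvDl.
Qed.

(** Test t = B / C when C > 0. When C = 0, a nonzero B would make the affine function negative: the
    chosen t gives exactly -1. *)
Lemma discr_le0 (A B C : R) : 0 <= C ->
  (forall t, 0 <= A - 2 * t * B + t ^+ 2 * C) -> B ^+ 2 <= A * C.
Proof.
move=> C_ge0 H.
have A0 : 0 <= A by have := H 0; lra.
have [C0|C0] := ltrP 0 C.
  have := H (B / C).
  have -> : A - 2 * (B / C) * B + (B / C) ^+ 2 * C = (A * C - B ^+ 2) / C.
    by field; rewrite gt_eqF.
  by rewrite pmulr_lge0 ?invr_gt0// subr_ge0.
have {C_ge0 C0}C0 : C = 0 by apply/le_anti; rewrite C0 C_ge0.
subst C; rewrite mulr0; suff -> : B = 0 by rewrite expr0n.
apply/eqP/negP => /negP B0; have := H ((A + 1) / (2 * B)).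
rewrite mulr0 addr0.
have -> : A - 2 * ((A + 1) / (2 * B)) * B = -1 by field.
by lra.
Qed.

Lemma cauchy_schwarz (I : Type) (s : seq I) (P : pred I) (a b : I -> R) :
  (\sum_(i <- s | P i) a i * b i) ^+ 2 <=
  (\sum_(i <- s | P i) a i ^+ 2) * \sum_(i <- s | P i) b i ^+ 2.
Proof.
apply: discr_le0 => [|t]; first by rewrite sumr_ge0// => i _; rewrite sqr_ge0.
suff -> : \sum_(i <- s | P i) a i ^+ 2
    - 2 * t * (\sum_(i <- s | P i) a i * b i)
    + t ^+ 2 * (\sum_(i <- s | P i) b i ^+ 2)
  = \sum_(i <- s | P i) (a i - t * b i) ^+ 2.
  by rewrite sumr_ge0// => i _; rewrite sqr_ge0.
rewrite !mulr_sumr -sumrB -big_split/=.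
by apply: eq_bigr => i _; ring.
Qed.

Lemma dotv_cauchy_schwarz d (u v : 'cV[R]_d) :
  dotv u v ^+ 2 <= dotv u u * dotv v v.
Proof.
by rewrite !dotvE (le_trans (cauchy_schwarz _ _ _ _)).
Qed.

Lemma derive_ge0_at_right (phi : R -> R) (D : R) :
  is_derive (0 : R) (1 : R) phi D -> (forall s, 0 < s < 1 -> phi 0 <= phi s) -> 0 <= D.
Proof.
move=> [dphi <-] phi_min.
have cv : h^-1 *: ((phi \o shift (0:R)) (h *: (1:R)) - phi 0) @[h --> (0:R)^'+]
    --> 'D_1 phi (0 : R).
  by apply: cvg_dnbhs_at_right; exact: dphi.
rewrite -(cvg_lim _ cv)//; apply: limr_ge; first by apply/cvg_ex; eexists; exact: cv.
near=> h.
have h0 : 0 < h by near: h; exact: nbhs_right_gt.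
have h1 : h < 1 by near: h; exact: nbhs_right_lt.
rewrite /= addr0 scaler1 mulr_ge0 ?invr_ge0 ?(ltW h0)// subr_ge0.
by apply: phi_min; rewrite h0.
Unshelve. all: by end_near. Qed.

Lemma slope_ge (f : R -> R) (m a b : R) :
  (forall z, derivable f z 1) -> a <= b ->
  (forall z, a <= z <= b -> m <= derive1 f z) -> m * (b - a) <= f b - f a.
Proof.
move=> df; rewrite le_eqVlt => /predU1P[<-|ab H]; first by rewrite !subrr mulr0.
have [||c cab ->] := @MVT _ f (derive1 f) a b ab.
- by move=> x _; rewrite derive1E; exact/derivableP.
- apply: derivable_within_continuous => x _; exact: df.
apply: ler_wpM2r; first by rewrite subr_ge0 ltW.
by apply: H; move: cab; rewrite in_itv/= => /andP[/ltW -> /ltW ->].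
Qed.

Lemma slope_sqr_ge (f : R -> R) (m a b : R) :
  (forall z, derivable f z 1) ->
  (forall z, `|z - a| <= `|b - a| -> m <= derive1 f z) ->
  m * (b - a) ^+ 2 <= (f b - f a) * (b - a).
Proof.
move=> df H; have [ab|/ltW ba] := lerP a b.
  rewrite expr2 mulrA ler_wpM2r ?subr_ge0//; apply: slope_ge => // z /andP[az zb].
  by apply: H; rewrite !ger0_norm ?subr_ge0//; lra.
have -> : (b - a) ^+ 2 = (a - b) * (a - b) by ring.
have -> : (f b - f a) * (b - a) = (f a - f b) * (a - b) by ring.
rewrite mulrA ler_wpM2r ?subr_ge0//; apply: slope_ge => // z /andP[bz za].
by apply: H; rewrite !ler0_norm ?subr_le0//; lra.
Qed.

Lemma lipschitz_of_derive (f : R -> R) (L a b : R) :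
  (forall z, derivable f z 1) -> (forall z, `|derive1 f z| <= L) ->
  `|f b - f a| <= L * `|b - a|.
Proof.
move=> df fL; wlog ab : a b / a <= b => [W|].
  case/orP: (le_total a b) => [/W//|/W h].
  by rewrite (distrC (f b)) (distrC b).
have L1 z : - L <= derive1 f z <= L by rewrite -ler_norml.
rewrite (ger0_norm (_ : 0 <= b - a)) ?subr_ge0//.
have h1 : - L * (b - a) <= f b - f a.
  by apply: slope_ge => // z _; case/andP: (L1 z).
have h2 : - L * (b - a) <= - f b - - f a.
  apply: (slope_ge (f := - f) _ ab) => z; first exact: derivableN.
  by move=> _; rewrite (derive1N (df z)) lerN2; case/andP: (L1 z).
by rewrite ler_norml; lra.
Qed.

(** Used to build the potential whose gradient is minus the score. The integral starts at [a], so
    the derivative is known only to the right of [a], which must be chosen below every argument that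
    occurs. *)
Lemma antiderivative (f : R -> R) (a : R) : continuous f ->
  exists F : R -> R, forall z, a < z -> is_derive z 1 F (f z).
Proof.
move=> cf.
exists (fun x => \int[lebesgue_measure]_(t in [set` Interval (BLeft a) (BRight x)]) f t)%R.
move=> z az; have [||||] := @continuous_FTC1 R f (BLeft a) z (z + 1).
- by rewrite ltrDl.
- apply: continuous_compact_integrable; first exact: segment_compact.
  exact: continuous_subspaceT.
- by rewrite /= lte_fin.
- exact: cf.
by move=> dF; rewrite derive1E => <-; exact/derivableP.
Qed.

End Analysis.

(** * Smallest eigenvalue and minimum of the quadratic form *)

Section Rayleigh.
Variable R : realType.

Definition quad d (M : 'M[R]_d) (u : 'cV[R]_d) : R := (u^T *m M *m u) 0 0.

Lemma quadE d (M : 'M[R]_d) u : quad M u = dotv u (M *m u).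
Proof. by rewrite /quad /dotv mulmxA. Qed.

Lemma dotv_sym d (M : 'M[R]_d) u v : M^T = M -> dotv u (M *m v) = dotv v (M *m u).
Proof.
move=> sM; rewrite dotvC /dotv trmx_mul sM -mulmxA.
by [].
Qed.

Lemma continuous_entry_sum (I : finType) d (F : I -> 'rV[R]_d -> R) :
  (forall i, continuous (F i)) -> continuous (fun v => \sum_i F i v).
Proof.
move=> cF; have -> : (fun v => \sum_i F i v) = \sum_i F i.
  by apply/funext => v; rewrite fct_sumE.
by elim/big_ind : _ => [|f g|i _]; [exact: cst_continuous|
  move=> cf cg x; apply: continuousD; [exact: cf|exact: cg]|exact: cF].
Qed.

Lemma dotv_tr_continuous d (u : 'cV[R]_d) : continuous (fun v : 'rV[R]_d => dotv u v^T).
Proof.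
under eq_fun do rewrite dotvE; apply: continuous_entry_sum => i v.
under eq_fun do rewrite mxE.
by apply: continuousM; [exact: cst_continuous|exact: coord_continuous].
Qed.

Lemma quad_tr_continuous d (M : 'M[R]_d) : continuous (fun v : 'rV[R]_d => quad M v^T).
Proof.
under eq_fun do rewrite quadE dotvE; apply: continuous_entry_sum => i v.
under eq_fun do rewrite !mxE.
apply: continuousM; first exact: coord_continuous.
move: v; apply: continuous_entry_sum => j v.
under eq_fun do rewrite mxE.
by apply: continuousM; [exact: cst_continuous|exact: coord_continuous].
Qed.

Lemma compact_ball_tr d (c : 'cV[R]_d) (r : R) :
  compact [set v : 'rV[R]_d | dotv (v^T - c) (v^T - c) <= r].
Proof.
have cdist : continuous (fun v : 'rV[R]_d => dotv (v^T - c) (v^T - c)).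
  under eq_fun do rewrite dotvE; apply: continuous_entry_sum => i v.
  under eq_fun do rewrite !mxE.
  have cv : {for v, continuous (fun x : 'rV[R]_d => x 0 i - c i 0)}.
    exact: (continuousB (@coord_continuous R 1 d 0 i v) (@cst_continuous _ _ (c i 0) v)).
  exact: (continuousM cv cv).
apply: (@subclosed_compact _ _
   [set v : 'rV[R]_d | forall i, `[c i 0 - (r + 1), c i 0 + (r + 1)]%classic (v ord0 i)]).
- by move/continuous_closedP : cdist => /(_ _ (closed_le (y := r))).
- apply: (rV_compact (A := fun i => `[c i 0 - (r + 1), c i 0 + (r + 1)]%classic)) => i.
  exact: segment_compact.
- move=> v /= vr i; rewrite in_itv/=.
  have : (v ord0 i - c i 0) ^+ 2 <= r.
    apply: le_trans vr; rewrite dotvE (bigD1 i)//= !mxE expr2 lerDl.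
    by rewrite sumr_ge0// => j _; rewrite -expr2 sqr_ge0.
  set x := v ord0 i - c i 0 => x2.
  have : `|x| <= r + 1.
    rewrite -real_normK ?num_real// in x2; have := normr_ge0 x; nra.
  by rewrite ler_norml /x; lra.
Qed.

Lemma quad_expand d (M : 'M[R]_d) u w t : M^T = M ->
  quad M (u + t *: w) = quad M u + 2 * t * dotv w (M *m u) + t ^+ 2 * quad M w.
Proof.
move=> sM; rewrite !quadE mulmxDr -scalemxAr !dotvDl !dotvDr !dotvZl !dotvZr.
by rewrite (dotv_sym u w sM); ring.
Qed.

Lemma linear_coef_eq0 (b c : R) : (forall t, 0 <= 2 * t * b + t ^+ 2 * c) -> b = 0.
Proof.
move=> H; have [c0|c0] := ltrP c 0.
  have h1 := H 1; have h2 := H (-1); nra.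
have := discr_le0 c0 (A := 0) (B := - b).
rewrite mul0r sqrrN => K.
have : b ^+ 2 <= 0 by apply: K => t; have := H t; rewrite add0r; lra.
move=> b2; apply/eqP; rewrite -sqrf_eq0; apply/eqP/le_anti.
by rewrite sqr_ge0 b2.
Qed.

(** The form attains its minimum [m] on the unit sphere, and a minimiser is an eigenvector for [m].
    So [m] belongs to the set of eigenvalues and bounds it from below, which makes the infimum in
    [lambda_min] meaningful and at most [m]. *)
Lemma lambda_min_le_quad d (M : 'M[R]_d) (u : 'cV[R]_d) : M^T = M ->
  lambda_min M * dotv u u <= quad M u.
Proof.
move=> sM; have [->|u0] := eqVneq u 0.
  by rewrite quadE {2}/dotv !mulmx0 mxE /dotv mulmx0 mxE mulr0.
have uu0 : 0 < dotv u u.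
  by rewrite lt_neqAle dotv_ge0 andbT eq_sym; apply: contra_neq u0 => /dotv_eq0.
pose S := [set v : 'rV[R]_d | dotv v^T v^T = 1].
have S0 : S !=set0.
  exists ((Num.sqrt (dotv u u))^-1 *: u)^T; rewrite /S/= trmxK dotvZl dotvZr.
  rewrite mulrA -invfM -expr2 sqr_sqrtr ?dotv_ge0// mulVf//; exact: lt0r_neq0.
have cS : compact S.
  have -> : S = [set v : 'rV[R]_d | dotv (v^T - 0) (v^T - 0) <= 1] `&`
      (fun v : 'rV[R]_d => quad 1%:M v^T) @^-1` [set 1].
    apply/seteqP; split=> v; rewrite /S/= subr0 quadE mul1mx.
      by move=> ->.
    by case.
  apply: compact_closedI; first exact: compact_ball_tr.
  by move/continuous_closedP : (@quad_tr_continuous d 1%:M); apply; exact: closed_eq.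
have [v /set_mem vS vmin] := EVT_min_rV S0 cS (continuous_subspaceT (@quad_tr_continuous d M)).
set c := v^T; have cc1 : dotv c c = 1 by [].
set m := quad M c.
have mle w : m * dotv w w <= quad M w.
  have [->|w0] := eqVneq w 0.
    by rewrite quadE {1}/dotv !mulmx0 mxE /dotv mulmx0 mxE mulr0.
  have ww0 : 0 < dotv w w.
    by rewrite lt_neqAle dotv_ge0 andbT eq_sym; apply: contra_neq w0 => /dotv_eq0.
  pose s := (Num.sqrt (dotv w w))^-1.
  have s2 : s ^+ 2 = (dotv w w)^-1 by rewrite /s exprVn sqr_sqrtr ?dotv_ge0.
  have : m <= quad M (s *: w).
    have := vmin (s *: w)^T; rewrite trmxK; apply; apply/mem_set.
    by rewrite /S/= trmxK dotvZl dotvZr mulrA -expr2 s2 mulVf// gt_eqF.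
  rewrite quadE -scalemxAr dotvZl dotvZr mulrA -expr2 s2 -quadE mulrC.
  by rewrite ler_pdivlMr.
(* First-order optimality of the minimiser c of the form on the unit sphere. *)
have ev : M *m c = m *: c.
  apply/subr0_eq/dotv_eq0; set w := M *m c - m *: c.
  apply: (@linear_coef_eq0 _ (quad M w - m * dotv w w)) => t.
  have wMc : dotv w (M *m c) = dotv w w + m * dotv c w.
    by rewrite (dotvC c) -dotvZr -dotvDr /w subrK.
  move: w wMc => w wMc.
  have := mle (c + t *: w); rewrite quad_expand// -/m !dotvDl !dotvDr !dotvZl !dotvZr cc1.
  rewrite wMc (dotvC w c); lra.
have lm : lambda_min M <= m.
  apply: ge_inf.
    exists m => a /= /eigenvalueP[w wM w0].
    have : quad M w^T = a * dotv w^T w^T.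
      by rewrite /quad trmxK wM -scalemxAl mxE /dotv trmxK.
    move=> E; have := mle w^T; rewrite E ler_pM2r// lt_neqAle dotv_ge0 andbT eq_sym.
    apply: contra_neq w0 => /dotv_eq0 /(congr1 trmx); by rewrite trmxK trmx0.
  apply/eigenvalueP; exists c^T.
    by rewrite -{1}sM -trmx_mul ev linearZ.
  apply: contra_eq_neq cc1 => /(congr1 trmx); rewrite trmxK trmx0 => ->.
  by rewrite /dotv mulmx0 mxE eq_sym oner_neq0.
by apply: le_trans (mle u); rewrite ler_pM2r.
Qed.
End Rayleigh.

(** * Existence and location of the roots of the score *)

Section Estimator.
Variable R : realType.

Lemma is_derive_affine (p q z : R) : is_derive z (1 : R) (fun s : R => p + s * q) q.
Proof.
have -> : (fun s : R => p + s * q) = cst p + q \*: id.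
  by apply/funext => s /=; rewrite -[RHS]/(p + q * s) mulrC.
by apply: is_derive_eq; rewrite add0r; exact: mulr1.
Qed.

Lemma is_derive_bigsum (I : Type) (s : seq I) (P : pred I) (h : I -> R -> R) (dh : I -> R) (z : R) :
  (forall i, P i -> is_derive z (1 : R) (h i) (dh i)) ->
  is_derive z (1 : R) (fun x => \sum_(i <- s | P i) h i x) (\sum_(i <- s | P i) dh i).
Proof.
move=> H; elim: s => [|i s IH].
  by under eq_fun do rewrite big_nil; rewrite big_nil; exact: is_derive_cst.
under eq_fun do rewrite big_cons; rewrite big_cons; case: ifPn => // Pi.
by apply: is_deriveD => //; exact: H.
Qed.

Lemma continuous_bigsum_at (U : topologicalType) (I : Type) (s : seq I) (P : pred I)
    (h : I -> U -> R) (x : U) :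
  (forall i, P i -> continuous_at x (h i)) ->
  continuous_at x (fun z => \sum_(i <- s | P i) h i z).
Proof.
move=> H; elim: s => [|i s IH].
  by under eq_fun do rewrite big_nil; exact: cst_continuous.
under eq_fun do rewrite big_cons; case: ifPn => // Pi.
exact: (continuousD (H _ Pi) IH).
Qed.

Variables (T : Type) (s : seq T) (P : pred T) (d : nat).
Variables (V : T -> 'cV[R]_d) (y : T -> R) (f : R -> R) (th0 : 'cV[R]_d).
Variables (kap L2 D lam Q e : R).
Hypothesis f_homo : {homo f : a b / a <= b}.
Hypothesis df : forall z, derivable f z 1.
Hypothesis ddf : forall z, derivable (derive1 f) z 1.
Hypothesis ddfL : forall z, `|derive1 (derive1 f) z| <= L2.
Hypotheses (kap0 : 0 < kap) (e0 : 0 < e) (Q0 : 0 <= Q) (D0 : 0 <= D).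
Hypothesis V0 : forall o, 0 <= dotv (V o) th0.
Hypothesis dfV : forall o, kap <= derive1 f (dotv (V o) th0).
Hypothesis VD : forall o, dotv (V o) (V o) <= D.
Hypothesis sampleQ : forall u : 'cV[R]_d,
  lam * dotv u u <= \sum_(o <- s | P o) dotv (V o) u ^+ 2.
Hypothesis noiseQ : forall u,
  (\sum_(o <- s | P o) (y o - f (dotv (V o) th0)) * dotv (V o) u) ^+ 2 <=
  Q * \sum_(o <- s | P o) dotv (V o) u ^+ 2.
(* e is the squared radius around th0 within which the slopes stay above 3/4 kap. *)
Hypothesis eL : 16 * (L2 ^+ 2 * D * e) <= kap ^+ 2.
Hypothesis Qlam : 16 * Q < 9 * (kap ^+ 2 * (lam * e)).

Let nrm u := \sum_(o <- s | P o) dotv (V o) u ^+ 2.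
Let Z u := \sum_(o <- s | P o) (y o - f (dotv (V o) th0)) * dotv (V o) u.
Let score th := \sum_(o <- s | P o) (y o - f (dotv (V o) th)) *: V o.

Let nrm_ge0 u : 0 <= nrm u.
Proof. by rewrite sumr_ge0// => o _; rewrite sqr_ge0. Qed.

Let L2_ge0 : 0 <= L2.
Proof. by rewrite (le_trans _ (ddfL 0)). Qed.

Let dotV_le o u : dotv u u <= e -> dotv (V o) u ^+ 2 <= D * e.
Proof.
move=> ue; apply: le_trans (dotv_cauchy_schwarz _ _) _.
by apply: ler_pM => //; exact: dotv_ge0.
Qed.

(** A displacement of squared norm at most [e] moves each projection by at most sqrt(D e); by [eL]
    this costs at most kap / 4 of slope. *)
Let local_slope o u : dotv u u <= e ->
  3 / 4 * kap * dotv (V o) u ^+ 2 <=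
  (f (dotv (V o) (th0 + u)) - f (dotv (V o) th0)) * dotv (V o) u.
Proof.
move=> ue; have := dotV_le o ue; rewrite dotvDr.
set a := dotv (V o) th0; set x := dotv (V o) u => xDe.
have := @slope_sqr_ge _ f (3 / 4 * kap) a (a + x) df.
rewrite addrAC subrr add0r; apply => z zx.
have := @lipschitz_of_derive _ (derive1 f) L2 a z ddf ddfL.
rewrite ler_norml => /andP[lb _].
have Lz : L2 * `|z - a| <= kap / 4.
  rewrite -(@ler_pXn2r _ 2)// ?nnegrE; [|by rewrite mulr_ge0|by rewrite divr_ge0// ltW].
  rewrite exprMn real_normK ?num_real//.
  apply: (@le_trans _ _ (L2 ^+ 2 * (D * e))).
    rewrite ler_wpM2l ?sqr_ge0//; apply: le_trans xDe.
    by rewrite -(real_normK (num_real x)) -(real_normK (num_real (z - a))) ler_pXn2r ?nnegrE.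
  by move: eL; rewrite expr_div_n; lra.
by have := dfV o; rewrite -/a; lra.
Qed.

Let nrm_bound u : 3 / 4 * kap * nrm u <= Z u -> 9 * (kap ^+ 2 * nrm u) <= 16 * Q.
Proof.
move=> H; have := noiseQ u; rewrite -/(nrm u) -/(Z u) => H2.
have n0 := nrm_ge0 u; have [->|nn0] := eqVneq (nrm u) 0; first by rewrite !mulr0 mulr_ge0.
have np : 0 < nrm u by rewrite lt_neqAle eq_sym nn0.
have : (3 / 4 * kap * nrm u) ^+ 2 <= Q * nrm u.
  apply: le_trans H2; rewrite ler_pXn2r ?nnegrE//; first by rewrite !mulr_ge0 ?ltW.
  by apply: le_trans H; rewrite !mulr_ge0 ?ltW.
have -> : (3 / 4 * kap * nrm u) ^+ 2 = (9 / 16 * (kap ^+ 2 * nrm u)) * nrm u by field.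
by rewrite ler_pM2r//; lra.
Qed.

(** On or outside the sphere of squared radius [e], [sampleQ] makes [nrm u] at least lam e, while
    [nrm_bound] caps it at 16 Q / (9 kap^2); [Qlam] makes the two incompatible. *)
Let interior u : 3 / 4 * kap * nrm u <= Z u -> dotv u u < e.
Proof.
move=> /nrm_bound H; rewrite ltNge; apply/negP => eu.
have kk : 0 < kap ^+ 2 by rewrite exprn_gt0.
have lam0 : 0 <= lam.
  have : 0 < kap ^+ 2 * (lam * e) by have := Q0; move: Qlam; lra.
  by rewrite pmulr_rgt0// pmulr_lgt0// => /ltW.
have : kap ^+ 2 * (lam * e) <= kap ^+ 2 * nrm u.
  by rewrite ler_pM2l//; apply: le_trans (sampleQ u); exact: ler_wpM2l.
by move: Qlam; lra.
Qed.

Let score_dot th u : dotv (score th) u =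
  Z u - \sum_(o <- s | P o) (f (dotv (V o) th) - f (dotv (V o) th0)) * dotv (V o) u.
Proof.
rewrite dotv_suml -sumrB; apply: eq_bigr => o _; rewrite dotvZl; ring.
Qed.

Let slope_sum u : dotv u u <= e -> 3 / 4 * kap * nrm u <=
  \sum_(o <- s | P o) (f (dotv (V o) (th0 + u)) - f (dotv (V o) th0)) * dotv (V o) u.
Proof.
by move=> ue; rewrite mulr_sumr; apply: ler_sum => o _; exact: local_slope.
Qed.

(* If the root lay outside the ball of squared radius e, monotonicity of f would
   bound the score at the point where the segment from th0 leaves the ball. *)
Lemma score_root_close th : score th = 0 -> 9 * (kap ^+ 2 * nrm (th - th0)) <= 16 * Q.
Proof.
move=> sc0; set u := th - th0.
have thE : th = th0 + u by rewrite addrC subrK.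
move: u thE => u thE.
have [ue|eu] := lerP (dotv u u) e.
  apply: nrm_bound; apply: le_trans (slope_sum ue) _.
  have := score_dot th u; rewrite sc0 /dotv linear0 mul0mx mxE -thE.
  by move=> /esym/subr0_eq ->.
have uu0 : 0 < dotv u u by apply: lt_trans eu.
pose r := Num.sqrt (e / dotv u u).
have r2 : r ^+ 2 = e / dotv u u by rewrite sqr_sqrtr// divr_ge0// ltW.
have r0 : 0 <= r := sqrtr_ge0 _.
have r1 : r <= 1.
  rewrite -(@ler_pXn2r _ 2)// ?nnegrE// r2 expr1n ler_pdivrMr// mul1r; exact: ltW.
have ruE : dotv (r *: u) (r *: u) = e.
  by rewrite dotvZl dotvZr mulrA -expr2 r2 divfK// gt_eqF.
have ruE' : dotv (r *: u) (r *: u) <= e by rewrite ruE.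
have : dotv (r *: u) (r *: u) < e.
  apply: interior; apply: le_trans (slope_sum ruE') _.
  have := score_dot th (r *: u); rewrite sc0 {1}/dotv linear0 mul0mx mxE.
  move=> /esym/subr0_eq ->; apply: ler_sum => o _.
  rewrite thE !dotvDr dotvZr; set a := dotv (V o) th0; set x := dotv (V o) u.
  (* As r <= 1, going from r u to u pushes each link value further in the direction of [x], so every
     term of the sum can only grow. *)
  have [x0|x0] := lerP 0 x.
    apply: ler_wpM2r; first exact: mulr_ge0.
    by rewrite lerD2r; apply: f_homo; rewrite lerD2l ler_piMl.
  apply: ler_wnM2r; first by rewrite mulr_ge0_le0// ltW.
  rewrite lerD2r; apply: f_homo; rewrite lerD2l -subr_ge0.
  have -> : r * x - x = (1 - r) * - x by ring.
  by rewrite mulr_ge0 ?subr_ge0// oppr_ge0 ltW.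
by rewrite ruE ltxx.
Qed.

(* A root is a critical point of the convex potential that has minus the score as
   gradient; its minimum over the ball of squared radius e around th0 is interior. *)
Lemma score_root_exists : exists th, score th = 0.
Proof.
have cf : continuous f.
  by move=> z; apply: differentiable_continuous; apply/derivable1_diffP; exact: df.
(* Projections of points of the ball stay above this base point: those of [th0] are nonnegative, and
   a displacement changes them by at most sqrt(D e) <= D e + 1. *)
have [F dF] := antiderivative (- (D * e + 2)) cf.
have De0 : 0 <= D * e by rewrite mulr_ge0// ltW.
have inball o c : dotv (c - th0) (c - th0) <= e -> - (D * e + 2) < dotv (V o) c.
  move=> ce; have := dotV_le o ce; rewrite dotvBr; have := V0 o; nra.
pose g (c : 'cV[R]_d) := \sum_(o <- s | P o) (F (dotv (V o) c) - y o * dotv (V o) c).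
pose A := [set v : 'rV[R]_d | dotv (v^T - th0) (v^T - th0) <= e].
have A0 : A !=set0.
  by exists th0^T; rewrite /A/= trmxK subrr /dotv mulmx0 mxE ltW.
have cg : {within A, continuous (fun v : 'rV[R]_d => g v^T)}.
  apply: continuous_in_subspaceT => v /set_mem vA.
  apply: continuous_bigsum_at => o _.
  have cV : {for v, continuous (fun v : 'rV[R]_d => dotv (V o) v^T)}.
    exact: dotv_tr_continuous.
  have cF : {for v, continuous (fun v : 'rV[R]_d => F (dotv (V o) v^T))}.
    apply: (continuous_comp cV); apply: differentiable_continuous; apply/derivable1_diffP.
    by have [] := dF _ (inball o _ vA).
  exact: (continuousB cF (continuousM (@cst_continuous _ _ (y o) v) cV)).
have [v /set_mem vA vmin] := EVT_min_rV A0 (compact_ball_tr (c := th0) (r := e)) cg.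
set c := v^T; set u := c - th0.
have cE : c = th0 + u by rewrite addrC subrK.
have ue : dotv u u <= e by [].
move: u cE ue => u cE ue.
have dg w : is_derive (0 : R) (1 : R) (fun r : R => g (c + r *: w)) (- dotv (score c) w).
  have -> : (fun r : R => g (c + r *: w)) = (fun r : R => \sum_(o <- s | P o)
     (F (dotv (V o) c + r * dotv (V o) w) - y o * (dotv (V o) c + r * dotv (V o) w))).
    by apply/funext => r; apply: eq_bigr => o _; rewrite dotvDr dotvZr.
  rewrite dotv_suml -sumrN.
  under eq_bigr do rewrite dotvZl -mulNr opprB mulrBl.
  apply: is_derive_bigsum => o _.
  set p := dotv (V o) c; set q := dotv (V o) w.
  apply: is_deriveB.
    apply: (@is_derive1_comp _ F (fun r => p + r * q)).
      by rewrite mul0r addr0; apply: dF; exact: inball.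
    exact: is_derive_affine.
  exact: is_deriveZ (is_derive_affine p q 0).
have gmin w : (forall r : R, 0 < r < 1 -> dotv (u + r *: w) (u + r *: w) <= e) ->
    dotv (score c) w <= 0.
  move=> H; rewrite -oppr_ge0; apply: (derive_ge0_at_right (dg w)) => r r01.
  rewrite scale0r addr0.
  have := vmin (c + r *: w)^T; rewrite trmxK; apply; apply/mem_set.
  rewrite /A/= trmxK cE (_ : _ - th0 = u + r *: w); first exact: H.
  by rewrite addrC -addrA addKr.
(* The direction back to [th0] stays in the ball; testing minimality along it gives the inequality
   that [interior] asks for. *)
have ult : dotv u u < e.
  apply: interior; apply: le_trans (slope_sum ue) _.
  rewrite -subr_ge0 -cE -score_dot -oppr_le0 -mulN1r -dotvZr; apply: gmin => r /andP[r0 r1].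
  have -> : u + r *: (-1 *: u) = (1 - r) *: u by rewrite scalerA mulrN1 scalerBl scale1r scaleNr.
  rewrite dotvZl dotvZr mulrA -expr2; apply: le_trans ue.
  rewrite ler_piMl ?dotv_ge0// expr_le1//; lra.
have gz w : dotv (score c) w <= 0.
  (* A step t <= 1 in direction [w] raises the squared norm by at most t (2 |u.w| + w.w), so steps
     up to [k] remain in the ball. *)
  pose k := (e - dotv u u) / (1 + 2 * `|dotv u w| + dotv w w).
  have k0 : 0 < k.
    by rewrite divr_gt0 ?subr_gt0//; have := dotv_ge0 w; have := normr_ge0 (dotv u w); lra.
  pose k1 := Num.min k 1.
  have k10 : 0 < k1 by rewrite lt_min k0 ltr01.
  have : dotv (score c) (k1 *: w) <= 0.
    apply: gmin => r /andP[r0 r1]; rewrite scalerA.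
    set t := r * k1.
    have t0 : 0 <= t by rewrite mulr_ge0 ?ltW.
    have tk1 : t <= k1 by rewrite ler_piMl// ltW.
    have tk : t <= k by rewrite (le_trans tk1)// ge_min lexx.
    have t1 : t <= 1 by rewrite (le_trans tk1)// ge_min lexx orbT.
    rewrite !dotvDl !dotvDr !dotvZl !dotvZr (dotvC w u).
    have w0 := dotv_ge0 w; have n0 := normr_ge0 (dotv u w); have nle := ler_norm (dotv u w).
    have : t * (1 + 2 * `|dotv u w| + dotv w w) <= e - dotv u u.
      by rewrite -ler_pdivlMr//; lra.
    have : t * (t * dotv w w) <= t * dotv w w by rewrite ler_piMl// mulr_ge0.
    have : t * dotv u w <= t * `|dotv u w| by rewrite ler_wpM2l.
    lra.
  by rewrite dotvZr pmulr_rle0.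
exists c; apply: dotv_eq0; apply/le_anti; rewrite dotv_ge0 andbT; exact: gz.
Qed.
End Estimator.

(** * Independence of the noise *)

Section RealProbability.
Context d (Omega : measurableType d) (R : realType) (P : probability Omega R).

Definition pr (A : set Omega) : R := fine (P A).

Lemma prE A : measurable A -> P A = (pr A)%:E.
Proof. by move=> mA; rewrite /pr fineK// fin_num_measure. Qed.

Lemma pr_ge0 A : 0 <= pr A.
Proof. exact: fine_ge0. Qed.

Lemma pr0 : pr set0 = 0.
Proof. by rewrite /pr measure0. Qed.

Lemma prT : pr setT = 1.
Proof. by rewrite /pr probability_setT. Qed.

Lemma pr_le1 A : measurable A -> pr A <= 1.
Proof. by move=> mA; rewrite -lee_fin -prE// probability_le1. Qed.

Lemma le_pr A B : measurable A -> measurable B -> A `<=` B -> pr A <= pr B.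
Proof. by move=> mA mB AB; rewrite -lee_fin -!prE// le_measure// inE. Qed.

Lemma prU A B : measurable A -> measurable B -> A `&` B = set0 ->
  pr (A `|` B) = pr A + pr B.
Proof.
move=> mA mB AB; apply: EFin_inj; rewrite EFinD -!prE//; last exact: measurableU.
by rewrite measureU.
Qed.

Lemma prC A : measurable A -> pr (~` A) = 1 - pr A.
Proof.
move=> mA; rewrite -prT -(setUv A) prU//; [by rewrite addrC addKr|exact: measurableC|].
exact: setICr.
Qed.

Lemma measurable_fin (I : finType) (f : Omega -> I) (B : pred I) :
  (forall i, measurable [set w | f w = i]) -> measurable [set w | B (f w)].
Proof.
move=> mf; rewrite (_ : [set w | _] = \bigcup_(i in [set` B]) [set w | f w = i]).
  by apply: fin_bigcup_measurable => // i _; exact: mf.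
apply/seteqP; split=> [w /= Bw|w [i /= Bi ->]//].
by exists (f w).
Qed.

Lemma pr_fin (I : finType) (f : Omega -> I) (E : set Omega) (B : pred I) :
  measurable E -> (forall i, measurable [set w | f w = i]) ->
  pr (E `&` [set w | B (f w)]) = \sum_(i | B i) pr (E `&` [set w | f w = i]).
Proof.
move=> mE mf.
have mEf i : measurable (E `&` [set w | f w = i]) by exact: measurableI.
suff H (s : seq I) : uniq s -> pr (E `&` [set w | (f w \in s) && B (f w)]) =
    \sum_(i <- s | B i) pr (E `&` [set w | f w = i]).
  rewrite -H ?index_enum_uniq//; congr pr; congr (_ `&` _).
  by apply/seteqP; split=> w /=; rewrite mem_index_enum.
elim: s => [_|i s IH /andP[si us]].
  rewrite big_nil (_ : _ `&` _ = set0) ?pr0//.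
  by rewrite -subset0 => w [].
have mB (r : seq I) : measurable [set w | (f w \in r) && B (f w)].
  exact: (@measurable_fin _ f (fun i => (i \in r) && B i)).
rewrite big_cons -IH//; case: ifPn => [Bi|nBi].
  rewrite -prU//; last 2 first.
  - exact: measurableI.
  - rewrite -subset0 => w [[_ /= fi] [_ /= /andP[]]]; rewrite fi.
    by rewrite (negbTE si).
  congr pr; rewrite -setIUr; congr (_ `&` _); apply/seteqP; split=> w /=.
    by rewrite inE => /andP[/orP[/eqP|] fw Bw]; [left|right; rewrite fw].
  by case=> [->|/andP[fs ->]]; rewrite ?mem_head// inE fs orbT.
congr pr; congr (_ `&` _); apply/seteqP; split=> w /=.
  rewrite inE => /andP[/orP[/eqP fw|->//]]; by rewrite fw (negbTE nBi).
by case/andP=> fs ->; rewrite inE fs orbT.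
Qed.

Lemma pr_partition (I : finType) (f : Omega -> I) (E : set Omega) :
  measurable E -> (forall i, measurable [set w | f w = i]) ->
  pr E = \sum_i pr (E `&` [set w | f w = i]).
Proof.
move=> mE mf; rewrite -(pr_fin predT mE mf).
by congr pr; rewrite (_ : [set w | _] = setT) ?setIT// -subTset.
Qed.

Lemma prU_le A B : measurable A -> measurable B -> pr (A `|` B) <= pr A + pr B.
Proof.
move=> mA mB; rewrite -[A `|` B](_ : A `|` (B `\` A) = _).
  rewrite prU//; [|exact: measurableD|by rewrite setDE setICA setICr setI0].
  by rewrite lerD2l; apply: le_pr => //; exact: measurableD.
by rewrite setDE setUIr setUCr setIT.
Qed.

Lemma pr_bigcup_le (I : finType) (A : pred I) (F : I -> set Omega) (E : set Omega) :
  measurable E -> (forall i, measurable (F i)) ->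
  (forall w, E w -> exists2 i, A i & F i w) -> pr E <= \sum_(i | A i) pr (F i).
Proof.
move=> mE mF EF.
suff H (s : seq I) : measurable (\big[setU/set0]_(i <- s | A i) F i) /\
    pr (\big[setU/set0]_(i <- s | A i) F i) <= \sum_(i <- s | A i) pr (F i).
  have [mU le] := H (index_enum I); apply: le_trans le; apply: le_pr => // w /EF[i Ai Fi].
  by rewrite (bigD1 i)//=; left.
elim: s => [|i s [mU IH]]; first by rewrite !big_nil pr0.
rewrite !big_cons; case: ifP => // _; split; first exact: measurableU.
by apply: le_trans (prU_le (mF i) mU) _; rewrite lerD2l.
Qed.

End RealProbability.

Section PairIndependence.
Context d (Omega : measurableType d) (R : realType) (P : probability Omega R).

Definition pairRV (X Y : {RV P >-> R}) (w : Omega) : R * R := (X w, Y w).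

Lemma measurable_pairRV X Y : measurable_fun setT (pairRV X Y).
Proof. by apply: measurable_fun_pair; exact: measurable_funPT. Qed.

Lemma measurable_pair_preimage X Y C : measurable C -> measurable (pairRV X Y @^-1` C).
Proof. by move=> mC; rewrite -[X in measurable X]setTI; exact: measurable_pairRV. Qed.

(** The event that a threshold lies below a shifted noise is not a rectangle. As functions of [C]
    both sides are finite measures; they agree on rectangles, a pi-system generating the product
    sigma-algebra, hence everywhere. *)
Lemma pr_pair_indep (X Y : {RV P >-> R}) (Z : set Omega) (C : set (R * R)) :
  measurable Z -> measurable C ->
  (forall A B, measurable A -> measurable B ->
    pr P (Z `&` (pairRV X Y @^-1` (A `*` B))) =
    pr P Z * pr P (pairRV X Y @^-1` (A `*` B))) ->
  pr P (Z `&` (pairRV X Y @^-1` C)) = pr P Z * pr P (pairRV X Y @^-1` C).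
Proof.
move=> mZ mC H.
pose push := measure_function_pushforward__canonical__measure_function_Measure.
have mXYf := @measurable_pairRV X Y.
pose m1 : {measure set (R * R) -> \bar R} := push _ _ _ _ _ (mrestr P mZ) _ mXYf.
have pZ0 : 0 <= pr P Z := pr_ge0 _ _.
pose m2 : {measure set (R * R) -> \bar R} :=
  mscale (NngNum pZ0) (push _ _ _ _ _ P _ mXYf).
pose G : set (set (R * R)) :=
  [set C | exists A, measurable A /\ exists B, measurable B /\ C = A `*` B].
have mXY C' : measurable C' -> measurable (pairRV X Y @^-1` C').
  exact: measurable_pair_preimage.
have m1E C' : m1 C' = P (Z `&` (pairRV X Y @^-1` C')) by rewrite setIC.
have m2E C' : m2 C' = ((pr P Z)%:E * P (pairRV X Y @^-1` C'))%E by [].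
have E12 : m1 C = m2 C.
  apply: (@measure_unique _ R (R * R)%type G (fun=> setT)) => //.
  - rewrite measurable_prod_measurableType //; congr (<<s _ >>).
    rewrite predeqE => Q; split => [[A mA [B mB <-]]|[A [mA [B [mB ->]]]]].
      by exists A; split => //; exists B.
    by exists A => //; exists B.
  - move=> /= _ _ [X1 [mX1 [X2 [mX2 ->]]]] [Y1 [mY1 [Y2 [mY2 ->]]]].
    rewrite -setXI; exists (X1 `&` Y1); split; first exact: measurableI.
    by exists (X2 `&` Y2); split => //; exact: measurableI.
  - move=> _; exists setT; split => //; exists setT; split => //.
    by rewrite setXTT.
  - by rewrite bigcup_const//; exists 0%N.
  - move=> _ [A [mA [B [mB ->]]]].
    have mAB := mXY _ (measurableX mA mB).
    rewrite m1E m2E (prE P mAB) (prE P (measurableI _ _ mZ mAB)).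
    by rewrite H// EFinM.
  - move=> _; rewrite m1E.
    apply: (@le_lt_trans _ _ 1%E); last exact: ltry.
    by apply: probability_le1; apply: measurableI => //; exact: mXY.
move: E12; rewrite m1E m2E (prE P (mXY _ mC)) (prE P (measurableI _ _ mZ (mXY _ mC))).
by rewrite -EFinM => -[].
Qed.
End PairIndependence.

(** * Activation of a node by a uniform threshold *)

Section UniformThreshold.
Variable R : realType.

(** Distribution function of the uniform law on [0, 1]. The clipping matters under weights other
    than the true ones, where link plus noise may leave [0, 1]. *)
Definition clip01 (z : R) : R := Num.min (Num.max z 0) 1.

Lemma clip01_itv z : 0 <= clip01 z <= 1.
Proof.
by rewrite /clip01 le_min le_max lexx orbT ler01/= ge_min lexx orbT.
Qed.

Lemma clip01_id z : 0 <= z <= 1 -> clip01 z = z.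
Proof. by move=> /andP[z0 z1]; rewrite /clip01 max_l// min_l. Qed.

Lemma clip01_lip z z' : clip01 z - clip01 z' <= `|z - z'|.
Proof.
have := ler_norm (z - z'); have := normr_ge0 (z - z').
rewrite /clip01 /Order.min /Order.max.
case: (ltrP z 0) => ?; case: (ltrP z' 0) => ?; rewrite ?ltr01;
  case: (ltrP z 1) => ?; case: (ltrP z' 1) => ?; lra.
Qed.

Lemma uniform_prob_le (z : R) :
  uniform_prob (@ltr01 R) [set y | y <= z] = (clip01 z)%:E.
Proof.
rewrite /uniform_prob integral_uniform_pdf.
have -> : [set y | y <= z] `&` `[0, 1] = [set` `[0, Num.min z 1]] :> set R.
  apply/seteqP; split=> y /=; rewrite !in_itv/= le_min.
    by case=> -> /andP[-> ->].
  by case/and3P => -> -> ->.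
rewrite (eq_integral (fun=> 1%:E)); last first.
  move=> y; rewrite inE/= in_itv/= le_min => /and3P[y0 _ y1].
  by rewrite /uniform_pdf y0 y1 subr0 invr1.
rewrite integral_cst//= mul1e lebesgue_measure_itv/= lte_fin /clip01.
rewrite /Order.min /Order.max.
have [z0|z0] := ltrP z 0.
  rewrite (_ : z < 1 = true) ?ltr01; last by apply: lt_trans ltr01.
  by rewrite ltNge (ltW z0).
have [z1|z1] := ltrP z 1; last by rewrite ltr01 sube0.
by have [z0'|z0'] := ltrP 0 z; rewrite ?sube0//; congr EFin; apply/le_anti; rewrite z0 z0'.
Qed.

Context d (Omega : measurableType d) (P : probability Omega R).
Variables (e g : {RV P >-> R}).
Hypothesis eg_indep : forall A B, measurable A -> measurable B ->
  pr P (pairRV e g @^-1` (A `*` B)) = pr P (e @^-1` A) * pr P (g @^-1` B).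
Hypothesis g_unif : forall A : set R, measurable A ->
  P (g @^-1` A) = uniform_prob (@ltr01 R) A.

Definition below (a : R) : set (R * R) := [set p | p.2 <= a + p.1].

Lemma measurable_below a : measurable (below a).
Proof.
have mb : measurable_fun setT (fun p : R * R => p.2 <= a + p.1).
  apply: measurable_fun_ler; first exact: measurable_snd.
  by apply: measurable_funD; [exact: measurable_cst|exact: measurable_fst].
by rewrite -[X in measurable X]setTI; exact: (mb measurableT [set true]).
Qed.

(** By independence the joint law of noise and threshold is the product of the marginals;
    integrating the threshold out first leaves the clipped value. *)
Lemma pr_below a : P (pairRV e g @^-1` below a) = (\int[P]_w (clip01 (a + e w))%:E)%E.
Proof.
pose push := measure_function_pushforward__canonical__measure_function_Measure.
pose m' : {measure set (R * R) -> \bar R} :=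
  push _ _ _ _ _ P _ (@measurable_pairRV _ _ _ P e g).
transitivity (m' (below a)); first by [].
have := @product_measure_unique _ _ _ _ R (distribution P e) (distribution P g) m'.
move=> /(_ _ _ (measurable_below a)) <-; last first.
  move=> A B mA mB.
  have meA : measurable (e @^-1` A) by rewrite -[X in measurable X]setTI; exact: measurable_funPT.
  have mgB : measurable (g @^-1` B) by rewrite -[X in measurable X]setTI; exact: measurable_funPT.
  rewrite /distribution /m' /push /= /pushforward.
  rewrite [LHS](prE P); last exact: measurable_pair_preimage (measurableX mA mB).
  by rewrite eg_indep// EFinM -!prE.
rewrite /product_measure1/=.
have mclip : measurable_fun setT (fun x : R => (clip01 (a + x))%:E).
  apply/measurable_EFinP; apply: measurable_minr; last exact: measurable_cst.
  apply: measurable_maxr; last exact: measurable_cst.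
  by apply: measurable_funD; [exact: measurable_cst|exact: measurable_id].
rewrite (eq_integral (fun x : R => (clip01 (a + x))%:E)); last first.
  move=> x _; rewrite -uniform_prob_le -g_unif/=.
    congr (P _); apply/seteqP; split => w; rewrite /= /xsection/= inE//.
  by rewrite -set_itvNyc; exact: measurable_itv.
rewrite ge0_integral_pushforward//= => x _.
by rewrite lee_fin; case/andP: (clip01_itv (a + x)).
Qed.

Lemma integrable_clip a : P.-integrable setT (fun w => (clip01 (a + e w))%:E).
Proof.
apply/integrableP; split.
  apply/measurable_EFinP; apply: measurable_minr; last exact: measurable_cst.
  apply: measurable_maxr; last exact: measurable_cst.
  by apply: measurable_funD; [exact: measurable_cst|exact: measurable_funPT].
apply: (@le_lt_trans _ _ (\int[P]_w (cst 1%:E w))%E); last first.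
  by rewrite integral_cst//= probability_setT mule1 ltry.
apply: ge0_le_integral => //.
- apply: measurableT_comp => //; apply/measurable_EFinP; apply: measurable_minr; last exact: measurable_cst.
  apply: measurable_maxr; last exact: measurable_cst.
  by apply: measurable_funD; [exact: measurable_cst|exact: measurable_funPT].
- move=> w _; have /andP[h0 h1] := clip01_itv (a + e w).
  by rewrite /= lee_fin ger0_norm.
Qed.

(** Inherited from [clip01_lip] under the integral. It controls the chance that two weight vectors
    disagree at a node under the same noise and threshold. *)
Lemma pr_below_lip a b :
  pr P (pairRV e g @^-1` below a) - pr P (pairRV e g @^-1` below b) <= `|a - b|.
Proof.
have mb c : measurable (pairRV e g @^-1` below c) by exact: measurable_pair_preimage (measurable_below c).
rewrite -lee_fin EFinB -!prE//.
rewrite !pr_below -integralB//; [|exact: integrable_clip..].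
apply: (@le_trans _ _ (\int[P]_w (cst `|a - b|%:E w))%E); last first.
  by rewrite integral_cst//= probability_setT mule1.
apply: le_integral => //.
- by apply: integrableB => //; exact: integrable_clip.
- exact: finite_measure_integrable_cst.
move=> w _; rewrite -EFinB lee_fin; apply: le_trans (clip01_lip _ _) _.
by rewrite opprD addrACA subrr addr0.
Qed.

(** Almost surely the clipping does nothing, so the probability is the mean of [a + e]. The noise is
    integrable because [a + e] agrees almost surely with a bounded function. *)
Lemma pr_below_id a : ('E_P[e] = 0)%E -> {ae P, forall w, 0 <= a + e w <= 1} ->
  pr P (pairRV e g @^-1` below a) = a.
Proof.
move=> Ee ae01.
have mb c : measurable (pairRV e g @^-1` below c) by exact: measurable_pair_preimage (measurable_below c).
apply: EFin_inj; rewrite -prE// pr_below.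
have mae : measurable_fun setT (fun w => (a + e w)%:E).
  by apply/measurable_EFinP; apply: measurable_funD; [exact: measurable_cst|exact: measurable_funPT].
have clipE : ae_eq P setT (fun w => (clip01 (a + e w))%:E) (fun w => (a + e w)%:E).
  by apply: filterS ae01 => w /= H _; rewrite clip01_id.
have mclip : measurable_fun setT (fun w => (clip01 (a + e w))%:E).
  by case/integrableP: (integrable_clip a).
have iae : P.-integrable setT (fun w => (a + e w)%:E).
  apply/integrableP; split=> //.
  rewrite (ge0_ae_eq_integral measurableT _ _ _ _ (g := fun w => `|(clip01 (a + e w))%:E|%E))//.
  - by case/integrableP: (integrable_clip a).
  - exact: measurableT_comp.
  - exact: measurableT_comp.
  - by apply: filterS clipE => w H _; rewrite H.
rewrite (ae_eq_integral _ _ measurableT _ _ clipE)//.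
have ie : P.-integrable setT (fun w => (e w)%:E).
  have := integrableB measurableT iae (finite_measure_integrable_cst P a measurableT).
  apply: eq_integrable => // w _.
  by rewrite /= -EFinB addrAC subrr add0r.
under eq_integral do rewrite EFinD.
rewrite integralD//; last exact: finite_measure_integrable_cst.
move: Ee; rewrite expectation_def => ->.
by rewrite integral_cst//= probability_setT mule1 adde0.
Qed.

End UniformThreshold.

Section PairFamily.
Context d (Omega : measurableType d) (R : realType) (P : probability Omega R).
Variables (I : eqType) (e g : I -> {RV P >-> R}).
Hypothesis eg_indep : mutually_independent
  (fun i : I + I => match i with inl i => e i | inr i => g i end).

Let pair i := pairRV (e i) (g i).

Definition cylinder (s : seq I) (C : I -> set (R * R)) : set Omega :=
  [set w | forall i, i \in s -> C i (pair i w)].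

Lemma cylinder_nil C : cylinder [::] C = setT.
Proof. by apply/seteqP; split. Qed.

Lemma cylinder_cons i s C : cylinder (i :: s) C = cylinder s C `&` pair i @^-1` C i.
Proof.
apply/seteqP; split=> [w H|w [H Hi] j].
  by split; [move=> j js; apply: H; rewrite inE js orbT|apply: H; rewrite mem_head].
by rewrite inE => /orP[/eqP ->|/H].
Qed.

Lemma cylinder_cat s1 s2 C : cylinder (s1 ++ s2) C = cylinder s1 C `&` cylinder s2 C.
Proof.
apply/seteqP; split=> [w H|w [H1 H2] j].
  by split=> j js; apply: H; rewrite mem_cat js ?orbT.
by rewrite mem_cat => /orP[/H1|/H2].
Qed.

Lemma eq_cylinder s C C' : {in s, C =1 C'} -> cylinder s C = cylinder s C'.
Proof.
by move=> CC'; apply/seteqP; split=> w H i si; move: (H i si); rewrite CC'.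
Qed.

Lemma measurable_cylinder s C : (forall i, measurable (C i)) -> measurable (cylinder s C).
Proof.
move=> mC; elim: s => [|i s IH]; first by rewrite cylinder_nil.
by rewrite cylinder_cons; apply: measurableI => //; exact: measurable_pair_preimage.
Qed.

Lemma pr_cylinder_rect (s : seq I) (A B : I -> set R) : uniq s ->
  (forall i, measurable (A i)) -> (forall i, measurable (B i)) ->
  pr P (cylinder s (fun i => A i `*` B i)) =
  \prod_(i <- s) (pr P (e i @^-1` A i) * pr P (g i @^-1` B i)).
Proof.
move=> us mA mB.
pose D (i : I + I) := match i with inl i => A i | inr i => B i end.
have mX (X : {RV P >-> R}) Q : measurable Q -> measurable (X @^-1` Q).
  by move=> mQ; rewrite -[X in measurable X]setTI; exact: measurable_funPT.
have us' : uniq (map inl s ++ map inr s : seq (I + I)).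
  rewrite cat_uniq !map_inj_uniq ?us//=; [|by move=> ? ? []..].
  by rewrite andbT; apply/hasPn => _ /mapP[i _ ->]; apply/mapP => -[].
have mD i : measurable (D i) by case: i.
have := eg_indep us' mD.
rewrite big_cat/= !big_map/= => E; rewrite big_split/=; apply: EFin_inj.
rewrite EFinM -!prodEFin.
rewrite (eq_bigr (fun i => P (e i @^-1` A i))) => [|i _]; last by rewrite prE//; exact: mX.
rewrite [X in (_ * X)%E](eq_bigr (fun i => P (g i @^-1` B i))) => [|i _]; last by rewrite prE//; exact: mX.
rewrite -E -prE; last by apply: measurable_cylinder => i; exact: measurableX.
congr (P _); apply/seteqP; split=> w H.
  move=> i /=; rewrite mem_cat => /orP[] /mapP[j js ->] /=; have [] := H j js; by [].
move=> i si; split.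
  by apply: (H (inl i)); rewrite /= mem_cat map_f.
by apply: (H (inr i)); rewrite /= mem_cat orbC map_f.
Qed.

Lemma pr_pair_rect i A B : measurable A -> measurable B ->
  pr P (pair i @^-1` (A `*` B)) = pr P (e i @^-1` A) * pr P (g i @^-1` B).
Proof.
move=> mA mB.
have := @pr_cylinder_rect [:: i] (fun=> A) (fun=> B) isT (fun=> mA) (fun=> mB).
by rewrite big_seq1 cylinder_cons cylinder_nil setTI.
Qed.

(** Passage from rectangles to Borel sets one index at a time: for [i] at the head of [s1],
    [pr_pair_indep] reduces [C i] to a rectangle, which joins [s2] and falls under the induction
    hypothesis. *)
Let pr_cylinder_mixed (s1 s2 : seq I) C A B : uniq (s1 ++ s2) ->
  (forall i, measurable (C i)) ->
  (forall i, measurable (A i)) -> (forall i, measurable (B i)) ->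
  pr P (cylinder s1 C `&` cylinder s2 (fun i => A i `*` B i)) =
  (\prod_(i <- s1) pr P (pair i @^-1` C i)) *
  \prod_(i <- s2) (pr P (e i @^-1` A i) * pr P (g i @^-1` B i)).
Proof.
move=> + mC; elim: s1 s2 A B => [|i s1 IH] s2 A B us mA mB.
  by rewrite cylinder_nil setTI big_nil mul1r pr_cylinder_rect.
have us' : uniq (s1 ++ s2) by case/andP: us.
have [is1 is2] : i \notin s1 /\ i \notin s2.
  by move: us => /= /andP[]; rewrite mem_cat negb_or => /andP[].
have mrect : measurable (cylinder s2 (fun i => A i `*` B i)).
  by apply: measurable_cylinder => j; exact: measurableX.
rewrite cylinder_cons -setIA [_ `&` cylinder s2 _]setIC setIA pr_pair_indep//.
- by rewrite IH// big_cons mulrC mulrA.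
- by apply: measurableI => //; exact: measurable_cylinder.
move=> A0 B0 mA0 mB0.
pose A' j := if j == i then A0 else A j.
pose B' j := if j == i then B0 else B j.
have AB' j : j \in s2 -> (A' j = A j) * (B' j = B j).
  by move=> js; rewrite /A' /B'; case: eqP => // ji; rewrite -ji js in is2.
rewrite -setIA.
rewrite [X in _ `&` X](_ : _ = cylinder (i :: s2) (fun j => A' j `*` B' j)).
  rewrite (IH (i :: s2)); last 3 first.
  - by rewrite -(perm_uniq (permEl (perm_catCA [:: i] s1 s2))).
  - by move=> j; rewrite /A'; case: ifP.
  - by move=> j; rewrite /B'; case: ifP.
  rewrite IH// pr_pair_rect// big_cons /A' /B' eqxx -/A' -/B' mulrCA mulrC.
  congr (_ * _ * _); apply: eq_big_seq => j /AB'[a b].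
  by rewrite -[in LHS]/(A' j) -[in LHS]/(B' j) a b.
rewrite cylinder_cons; congr (_ `&` _); last by rewrite /A' /B' eqxx.
by apply: eq_cylinder => j /AB'[-> ->].
Qed.

Lemma pr_cylinder (s : seq I) C : uniq s -> (forall i, measurable (C i)) ->
  pr P (cylinder s C) = \prod_(i <- s) pr P (pair i @^-1` C i).
Proof.
move=> us mC.
have := @pr_cylinder_mixed s [::] C (fun=> setT) (fun=> setT).
by rewrite cats0 cylinder_nil setIT big_nil mulr1; apply.
Qed.

Lemma pr_cylinder_indep s1 s2 C : uniq (s1 ++ s2) -> (forall i, measurable (C i)) ->
  pr P (cylinder s1 C `&` cylinder s2 C) = pr P (cylinder s1 C) * pr P (cylinder s2 C).
Proof.
move=> us mC; rewrite -cylinder_cat !pr_cylinder//; first by rewrite big_cat.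
  by move: us; rewrite cat_uniq => /and3P[].
by move: us; rewrite cat_uniq => /and3P[].
Qed.

Lemma pr_cylinder_indep2 s1 s2 C1 C2 : uniq (s1 ++ s2) ->
  (forall i, measurable (C1 i)) -> (forall i, measurable (C2 i)) ->
  pr P (cylinder s1 C1 `&` cylinder s2 C2) = pr P (cylinder s1 C1) * pr P (cylinder s2 C2).
Proof.
move=> us mC1 mC2; pose C i := if i \in s1 then C1 i else C2 i.
have <- : cylinder s1 C = cylinder s1 C1 by apply: eq_cylinder => i; rewrite /C => ->.
have <- : cylinder s2 C = cylinder s2 C2.
  apply: eq_cylinder => i i2; rewrite /C ifN//.
  by move: us; rewrite cat_uniq => /and3P[_ /hasPn/(_ _ i2)].
by apply: pr_cylinder_indep => // i; rewrite /C; case: ifP.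
Qed.

End PairFamily.

(** * Outcomes of an intervention *)

Section Dag.
Variables (R : realType) (G : causal_graph) (f : node G -> R -> R).
Implicit Types (S : {set node G}) (th : params R G) (v : valuation G) (x y z : node G).

(** Otherwise every node of [D] has a parent in [D], and climbing yields a path of distinct nodes
    longer than the graph allows. *)
Lemma minimal_node (D : pred (node G)) x : D x ->
  exists2 y, D y & forall z, edge z y -> ~~ D z.
Proof.
move=> Dx; apply: contrapT => H.
have par_in y : D y -> exists2 z, edge z y & D z.
  move=> Dy; apply: contrapT => nD; apply: H; exists y => // z zy.
  by apply/negP => Dz; apply: nD; exists z.
have long k : forall y, D y -> exists2 p, size p = k & path (fun a b => edge b a) y p.
  elim: k => [|k IH] y Dy; first by exists [::].
  have [z zy Dz] := par_in y Dy; have [p sp pp] := IH z Dz.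
  by exists (z :: p); rewrite /= ?sp ?zy.
have [p sp /path_edge_uniq/card_uniqP cp] := long #|node G| x Dx.
by have := max_card (mem (x :: p)); rewrite cp/= sp ltnn.
Qed.

Lemma outcome_nodeE S th e g x : outcome f S th e g x =
  [|| x \in S, x == Defs.root G | g x <= f x (dotv (th x) (parv x (outcome f S th e g))) + e x].
Proof. by rewrite {1}outcomeE ffunE. Qed.

Lemma eq_parv x v v' : (forall y, edge y x -> v y = v' y) -> parv x v = parv x v' :> 'cV[R]_ _.
Proof.
move=> H; apply/colP => i; rewrite !mxE H//.
by have := enum_valP i; rewrite inE.
Qed.

Lemma edge_connectF x y : edge y x -> connect (@edge G) x y = false.
Proof.
move=> yx; apply/negP => /connectP[p xp yE].
have : cycle (@edge G) (x :: p) by rewrite /= rcons_path xp -yE yx.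
by move/edge_acyclic.
Qed.

(** The nodes not reachable from [x] are closed under taking parents, so at a minimal one where the
    outcomes differ the two structural equations would have the same inputs. By acyclicity the
    parents of [x] are such nodes. *)
Lemma outcome_setU1 S th e g x y : edge y x ->
  outcome f (x |: S) th e g y = outcome f S th e g y.
Proof.
move=> yx; apply/eqP/negPn/negP => neq.
pose D z := (outcome f (x |: S) th e g z != outcome f S th e g z) && ~~ connect (@edge G) x z.
have [|z /andP[neqz nxz] zmin] := @minimal_node D y; first by rewrite /D neq edge_connectF.
case/negP: neqz; rewrite !(outcome_nodeE _ _ _ _ z) in_setU1.
have -> : (z == x) = false by apply: contraNF nxz => /eqP ->.
rewrite (@eq_parv z (outcome f (x |: S) th e g) (outcome f S th e g))// => a az.
have := zmin a az; rewrite negb_and negbK => /orP[/eqP//|].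
by rewrite negbK => xa; case/negP: nxz; apply: connect_trans xa (connect1 az).
Qed.

(* Take for x a topologically first node at which the two outcomes differ. *)
Lemma outcome_first_diff S th th' e g y :
  outcome f S th e g y != outcome f S th' e g y ->
  exists x, [/\ x \notin S, x != Defs.root G &
    let V := parv x (outcome f S th' e g) in
    (g x <= f x (dotv (th x) V) + e x) != (g x <= f x (dotv (th' x) V) + e x)].
Proof.
move=> neq.
have [x neqx xmin] := @minimal_node
  (fun z => outcome f S th e g z != outcome f S th' e g z) y neq.
exists x; move: neqx; rewrite !(outcome_nodeE _ _ _ _ x).
rewrite (@eq_parv x (outcome f S th e g) (outcome f S th' e g)); last first.
  by move=> z zx; apply/eqP; rewrite -[_ == _]negbK; exact: xmin.
by case: (x \in S) => //=; case: (x == Defs.root G).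
Qed.

(** Configurations are coded as sets of nodes so that they range over one finite type for all [x]; a
    set not included in [par x] is never attained. *)
Definition active_parents x v : {set node G} := [set y in par x | v y]%SET.

Definition parent_vector x (A : {set node G}) : 'cV[R]_#|par x| :=
  parv x [ffun y => y \in A].

Lemma parent_vectorE x v : parent_vector x (active_parents x v) = parv x v.
Proof. by apply: eq_parv => y yx; rewrite ffunE !inE yx. Qed.

End Dag.

Definition node_noise (G : causal_graph) (T : Type) (n : nat -> node G -> T)
  (i : nat * node G) : T := n i.1 i.2.

Section Outcome.
Variables (R : realType) (G : causal_graph) (B : bglm R G).
Context d (Omega : measurableType d) (P : probability Omega R).
Variables (eps gam : nat -> node G -> {RV P >-> R}).
Hypothesis noise : bglm_noise B eps gam.
Implicit Types (S : {set node G}) (th : params R G) (v : valuation G) (x y z : node G).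

Local Notation e := (node_noise eps).
Local Notation g := (node_noise gam).
Local Notation pair i := (pairRV (e i) (g i)).
Local Notation out := (round_outcome B eps gam).

Lemma eg_indep : mutually_independent
  (fun i : (nat * node G) + (nat * node G) => match i with inl i => e i | inr i => g i end).
Proof.
have [H _ _ _ _] := noise.
have -> // : (fun i : (nat * node G) + (nat * node G) =>
    match i with inl i => e i | inr i => g i end) =
  (fun i => match i with inl (t, x) => eps t x | inr (t, x) => gam t x end).
by apply/funext => -[[]|[]].
Qed.

Let eg_ind := eg_indep.

Definition node_event S th v x : set (R * R) :=
  [set p | v x = [|| x \in S, x == Defs.root G |
     p.2 <= link B x (dotv (th x) (parv x v)) + p.1]].

Lemma node_event_free S th v x : x \notin S -> x != Defs.root G ->
  node_event S th v x = if v x then below (link B x (dotv (th x) (parv x v)))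
    else ~` below (link B x (dotv (th x) (parv x v))).
Proof.
move=> /negbTE xS /negbTE xr; rewrite /node_event xS xr/=.
case: (v x); apply/seteqP; split=> p; rewrite /below/=.
- by move=> <-.
- by move=> ->.
- by move=> <-.
- by move=> /negP/negbTE ->.
Qed.

Lemma node_event_forced S th v x : (x \in S) || (x == Defs.root G) ->
  node_event S th v x = if v x then setT else set0.
Proof.
rewrite /node_event => H; apply/seteqP; split=> p /=; case: (v x) => //;
  by case/orP: H => ->; rewrite ?orbT.
Qed.

Lemma measurable_node_event S th v x : measurable (node_event S th v x).
Proof.
have [H|] := boolP ((x \in S) || (x == Defs.root G)).
  by rewrite node_event_forced//; case: ifP.
rewrite negb_or => /andP[xS xr]; rewrite node_event_free//.
by case: ifP => _; [|apply: measurableC]; exact: measurable_below.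
Qed.

Definition round (t : nat) := [seq (t, x) | x <- enum (node G)].

Lemma round_uniq t : uniq (round t).
Proof. by rewrite map_inj_uniq ?enum_uniq// => ? ? []. Qed.

(** By [outcome_uniq] the outcome is [v] exactly when [v] solves every structural equation, and for
    fixed [v] the equation of a node involves only its own noise and threshold. *)
Lemma outcome_cylinder t S th v : [set w | out t S th w = v] =
  cylinder e g (round t) (fun i => node_event S th v i.2).
Proof.
apply/seteqP; split=> [w <- _ /mapP[x _ ->]|w H] /=.
  by rewrite /node_event/= /round_outcome outcome_nodeE.
apply/esym/outcome_uniq/ffunP => x; rewrite ffunE.
exact: (H (t, x) (map_f _ (mem_enum _ _))).
Qed.

Lemma measurable_outcome t S th v : measurable [set w | out t S th w = v].
Proof.
by rewrite outcome_cylinder; apply: measurable_cylinder => i; exact: measurable_node_event.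
Qed.

Lemma pr_outcome_indep t S th v s C : uniq s -> {in s, forall i, i.1 != t} ->
  (forall i, measurable (C i)) ->
  pr P ([set w | out t S th w = v] `&` cylinder e g s C) =
  pr P [set w | out t S th w = v] * pr P (cylinder e g s C).
Proof.
move=> us st mC; rewrite outcome_cylinder pr_cylinder_indep2//; last first.
  by move=> i; exact: measurable_node_event.
rewrite cat_uniq round_uniq us andbT/=; apply/hasPn => i /st it.
by apply/mapP => -[x _ iE]; rewrite iE eqxx in it.
Qed.

Definition outcome_law S v : R := pr P [set w | out 0 S (weight B) w = v].

Lemma pr_node t x v : x != Defs.root G -> v (Defs.root G) ->
  pr P (pair (t, x) @^-1` below (link B x (dotv (weight B x) (parv x v)))) =
  link B x (dotv (weight B x) (parv x v)).
Proof.
have [_ _ E0 ae01 unif] := noise => xr vr.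
apply: pr_below_id.
- by move=> A0 B0; exact: pr_pair_rect.
- by move=> A mA; rewrite /node_noise unif.
- by have [] := E0 t x xr.
- exact: ae01.
Qed.

Lemma outcome_root t S th w : out t S th w (Defs.root G).
Proof. by rewrite /round_outcome outcome_nodeE eqxx orbT. Qed.

(** The cylinder factorises over the nodes and [pr_node] evaluates each factor by the link alone, so
    the round index disappears. Valuations with the root off are treated apart because [pr_node]
    asks for the root to be on. *)
Lemma pr_outcome_round t S v : pr P [set w | out t S (weight B) w = v] = outcome_law S v.
Proof.
have [vr|nvr] := boolP (v (Defs.root G)); last first.
  rewrite /outcome_law.
  have E t' : [set w | out t' S (weight B) w = v] = set0.
    by rewrite -subset0 => w /= wv; move: nvr; rewrite -wv outcome_root.
  by rewrite !E.
rewrite /outcome_law !outcome_cylinder !pr_cylinder ?round_uniq//; last 2 first.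
- by move=> i; exact: measurable_node_event.
- by move=> i; exact: measurable_node_event.
rewrite !big_map; apply: eq_bigr => x _ /=.
have [H|] := boolP ((x \in S) || (x == Defs.root G)).
  by rewrite node_event_forced//; case: ifP; rewrite ?preimage_setT// preimage_set0.
rewrite negb_or => /andP[xS xr]; rewrite node_event_free//.
have mb t' : measurable (pair (t', x) @^-1` below (link B x (dotv (weight B x) (parv x v)))).
  exact: measurable_pair_preimage (measurable_below _).
case: ifP => _; first by rewrite !pr_node.
by rewrite !preimage_setC !prC//; [congr (1 - _); rewrite !pr_node|exact: mb..].
Qed.

(* Forcing x does not change its ancestors, while under do(x |: S) the outcome no
   longer depends on the noise and threshold of x. *)
Lemma pr_parents_indep t S th x (Q : pred (valuation G)) C : measurable C ->
  (forall v v', (forall y, edge y x -> v y = v' y) -> Q v = Q v') ->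
  pr P ([set w | Q (out t S th w)] `&` pair (t, x) @^-1` C) =
  pr P [set w | Q (out t S th w)] * pr P (pair (t, x) @^-1` C).
Proof.
move=> mC Qpar; have mpC : measurable (pair (t, x) @^-1` C) by exact: measurable_pair_preimage.
have -> : [set w | Q (out t S th w)] = [set w | Q (out t (x |: S)%SET th w)].
  apply/seteqP; split=> w /=; rewrite (Qpar _ (out t S th w))// => y yx;
  by rewrite /round_outcome outcome_setU1.
have mo := @measurable_outcome t (x |: S)%SET th.
rewrite setIC pr_fin// -[in RHS](setTI [set w | _]) pr_fin// mulr_suml.
apply: eq_bigr => v _; rewrite setTI.
have [vx|nvx] := boolP (v x); last first.
  have -> : [set w | out t (x |: S)%SET th w = v] = set0.
    rewrite -subset0 => w /= wv; move: nvx.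
    by rewrite -wv /round_outcome outcome_nodeE setU11.
  by rewrite setI0 pr0 mul0r.
pose s := [seq (t, y) | y <- enum (predC1 x)].
have -> : [set w | out t (x |: S)%SET th w = v] =
    cylinder e g s (fun i => node_event (x |: S)%SET th v i.2).
  rewrite outcome_cylinder; apply/seteqP; split=> w H.
    by move=> i /mapP[y _ ->]; apply: H; rewrite map_f// mem_enum.
  move=> i /mapP[y _ ->]; have [->|yx] := eqVneq y x.
    by rewrite node_event_forced ?setU11//= vx.
  by apply: H; rewrite map_f// mem_enum.
have -> : pair (t, x) @^-1` C = cylinder e g [:: (t, x)] (fun=> C).
  by rewrite cylinder_cons cylinder_nil setTI.
rewrite pr_cylinder_indep2//; [exact: mulrC| |by move=> i; exact: measurable_node_event].
rewrite /= map_inj_uniq ?enum_uniq ?andbT; last by move=> ? ? [].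
by apply/mapP => -[y]; rewrite mem_enum => /= yx [xy]; rewrite inE xy eqxx in yx.
Qed.

End Outcome.

(** * Law of one round and dependence of sigma on the weights *)

Section Law.
Variables (R : realType) (G : causal_graph) (B : bglm R G).
Context d (Omega : measurableType d) (P : probability Omega R).
Variables (eps gam : nat -> node G -> {RV P >-> R}).
Hypothesis noise : bglm_noise B eps gam.
Implicit Types (S : {set node G}) (th : params R G) (v : valuation G) (x y z : node G).

Local Notation e := (node_noise eps).
Local Notation g := (node_noise gam).
Local Notation pair i := (pairRV (e i) (g i)).
Local Notation out := (round_outcome B eps gam).
Local Notation law := (outcome_law B eps gam).

Lemma measurable_outcome_pred t S th (Q : pred (valuation G)) :
  measurable [set w | Q (out t S th w)].
Proof. by apply: measurable_fin => v; exact: measurable_outcome. Qed.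

Lemma pr_outcome_pred t S (Q : pred (valuation G)) :
  pr P [set w | Q (out t S (weight B) w)] = \sum_(v | Q v) law S v.
Proof.
rewrite -(setTI [set w | _]) pr_fin//; last by move=> v; exact: measurable_outcome.
by apply: eq_bigr => v _; rewrite setTI pr_outcome_round.
Qed.

Lemma law_ge0 S v : 0 <= law S v.
Proof. exact: pr_ge0. Qed.

Lemma sum_law S : \sum_v law S v = 1.
Proof.
by rewrite -(prT P) -(pr_outcome_pred 0 S predT); congr pr; apply/seteqP; split.
Qed.

Lemma law_root S v : ~~ v (Defs.root G) -> law S v = 0.
Proof.
move=> nvr; rewrite /outcome_law (_ : [set w | _] = set0) ?pr0//.
by rewrite -subset0 => w /= wv; move: nvr; rewrite -wv outcome_root.
Qed.

Definition parents_law S x (A : {set node G}) : R :=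
  \sum_(v | active_parents x v == A) law S v.

Definition activation x (A : {set node G}) : R :=
  link B x (dotv (weight B x) (parent_vector R x A)).

Implicit Types A : {set node G}.

Lemma parents_law_ge0 S x A : 0 <= parents_law S x A.
Proof. by apply: sumr_ge0 => v _; exact: law_ge0. Qed.

Lemma root_active x v : x != Defs.root G ->
  (Defs.root G \in active_parents x v) = v (Defs.root G).
Proof. by move=> xr; rewrite !inE edge_root. Qed.

Lemma active_parents_local x v v' : (forall y, edge y x -> v y = v' y) ->
  active_parents x v = active_parents x v'.
Proof.
by move=> H; apply/setP => y; rewrite !inE; case: (boolP (edge y x)) => //= /H ->.
Qed.

Lemma activation_itv x A : x != Defs.root G -> Defs.root G \in A ->
  0 <= activation x A <= 1.
Proof.
move=> xr rA; have := pr_node noise 0 xr (v := [ffun y => y \in A]).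
rewrite ffunE /activation => /(_ rA) <-; rewrite pr_ge0 pr_le1//.
exact: measurable_pair_preimage (measurable_below _).
Qed.

(** The parents of [x] are independent of its noise and threshold ([pr_parents_indep]), and
    [pr_node] gives the activation probability. If the root is missing from [A], both sides
    vanish. *)
Lemma law_node S x A : x \notin S -> x != Defs.root G ->
  \sum_(v | (active_parents x v == A) && v x) law S v =
  activation x A * parents_law S x A.
Proof.
move=> xS xr; have [rA|nrA] := boolP (Defs.root G \in A); last first.
  have z v : active_parents x v == A -> law S v = 0.
    by move=> /eqP vA; apply: law_root; rewrite -(root_active v xr) vA.
  rewrite big1 => [|v /andP[/z]//].
  by rewrite /parents_law big1 ?mulr0// => v /z.
have pE := pr_node noise 0 xr (v := [ffun y => y \in A]).
rewrite ffunE in pE; have {}pE := pE rA.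
rewrite /activation -/(parent_vector R x A) -pE mulrC.
rewrite -(pr_outcome_pred 0) /parents_law -(pr_outcome_pred 0).
rewrite -(pr_parents_indep noise 0 S (weight B) (x := x)
  (Q := fun v => active_parents x v == A)); last 2 first.
- exact: measurable_below.
- by move=> v v' vv'; rewrite (active_parents_local vv').
congr pr; apply/seteqP; split=> w /=.
  move=> /andP[/eqP wA]; rewrite /round_outcome outcome_nodeE (negbTE xS) (negbTE xr)/=.
  by move=> H; split; [exact/eqP|rewrite -/(parent_vector R x A) -wA parent_vectorE].
case=> /eqP wA H; rewrite wA eqxx/= /round_outcome outcome_nodeE.
by move: H; rewrite -/(parent_vector R x A) -wA parent_vectorE /below/= => ->; rewrite !orbT.
Qed.

Lemma law_node_off S x A : x \notin S -> x != Defs.root G ->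
  \sum_(v | (active_parents x v == A) && ~~ v x) law S v =
  (1 - activation x A) * parents_law S x A.
Proof.
move=> xS xr; rewrite mulrBl mul1r -law_node// /parents_law [in RHS](bigID (fun v => v x))/=.
by rewrite addrAC subrr add0r.
Qed.

Lemma sigmaE S th : sigma B eps gam S th = pr P [set w | out 0 S th w (target G)].
Proof.
rewrite /sigma /pr -(expectation_indic P); last exact: (measurable_outcome_pred 0 S th (fun v => v (target G))).
congr (fine ('E_P[_])%E); apply/funext => w; rewrite indicE; congr (_%:R).
by case: (boolP (out 0 S th w _)) => H; [rewrite mem_set|rewrite memNset//=; exact/negP].
Qed.

Lemma sigma_itv S th : 0 <= sigma B eps gam S th <= 1.
Proof.
rewrite sigmaE pr_ge0 pr_le1//; exact: (measurable_outcome_pred 0 S th (fun v => v (target G))).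
Qed.

(** Coupling by common noise and thresholds. If only the run with [th] activates the target,
    [outcome_first_diff] gives a free node whose pair lies in the symmetric difference of the two
    activation regions, at the parent values of the true run. These parents are independent of the
    pair, whence the product. The cap 1 keeps the term useful for configurations not yet
    observed. *)
Lemma sigma_smooth (L1 : node G -> R) S th :
  (forall x a b, x != Defs.root G -> `|link B x a - link B x b| <= L1 x * `|a - b|) ->
  sigma B eps gam S th - sigma B eps gam S (weight B) <=
  \sum_(x | (x \notin S) && (x != Defs.root G)) \sum_A
    parents_law S x A * Num.min 1 (L1 x * `|dotv (th x - weight B x) (parent_vector R x A)|).
Proof.
move=> lipL; rewrite !sigmaE.
set E1 := [set w | _]; set E2 := [set w | out 0 S (weight B) w _].
have mE1 : measurable E1 by exact: (measurable_outcome_pred 0 S th (fun v => v (target G))).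
have mE2 : measurable E2.
  by exact: (measurable_outcome_pred 0 S (weight B) (fun v => v (target G))).
have mE : measurable (E1 `\` E2) by exact: measurableD.
apply: (@le_trans _ _ (pr P (E1 `\` E2))).
  rewrite lerBlDl; apply: le_trans (prU_le P mE2 mE).
  apply: le_pr => //; first exact: measurableU.
  by move=> w E1w; have [E2w|nE2w] := pselect (E2 w); [left|right].
pose a x A := link B x (dotv (th x) (parent_vector R x A)).
pose b x A := link B x (dotv (weight B x) (parent_vector R x A)).
pose Diff x A := (below (a x A) `\` below (b x A)) `|` (below (b x A) `\` below (a x A)).
have mDiff x A : measurable (Diff x A).
  by apply: measurableU; apply: measurableD; exact: measurable_below.
pose F (i : node G * {set node G}) :=
  [set w | active_parents i.1 (out 0 S (weight B) w) == i.2] `&` pair (0, i.1) @^-1` Diff i.1 i.2.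
have mF i : measurable (F i).
  apply: measurableI; last exact: measurable_pair_preimage.
  exact: (measurable_outcome_pred 0 S (weight B) (fun v => active_parents i.1 v == i.2)).
apply: (@le_trans _ _ (\sum_(i | (i.1 \notin S) && (i.1 != Defs.root G)) pr P (F i))).
  apply: pr_bigcup_le => // w [E1w E2w].
  have : outcome (link B) S th (eps 0 ^~ w) (gam 0 ^~ w) (target G) !=
         outcome (link B) S (weight B) (eps 0 ^~ w) (gam 0 ^~ w) (target G).
    by apply: contra_notN E2w => /eqP E; move: E1w; rewrite /E1 /E2 /= /round_outcome E.
  move=> /outcome_first_diff[x [xS xr xV]].
  exists (x, active_parents x (out 0 S (weight B) w)); first by rewrite /= xS.
  split; rewrite //= /Diff /a /b parent_vectorE.
  move: xV; rewrite /below/= /node_noise /round_outcome/=.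
  by case: (_ <= _) => //; case: (_ <= _) => // _; [left|right].
rewrite [leLHS](_ : _ = \sum_(x | (x \notin S) && (x != Defs.root G)) \sum_A pr P (F (x, A))); last first.
  by rewrite pair_big; apply: eq_big => [[x A]|[x A]]//=; rewrite andbT.
apply: ler_sum => x /andP[xS xr]; apply: ler_sum => A _.
rewrite /F/= (pr_parents_indep noise 0 S (weight B) (x := x)
  (Q := fun v => active_parents x v == A))//; last first.
  by move=> v v' vv'; rewrite (active_parents_local vv').
rewrite (pr_outcome_pred 0 S (fun v => active_parents x v == A)) ler_wpM2l//.
  exact: parents_law_ge0.
rewrite le_min; apply/andP; split.
  by apply: pr_le1; exact: measurable_pair_preimage.
rewrite dotvC dotvBr !(dotvC (parent_vector R x A)).
apply: le_trans (lipL x _ _ xr); rewrite -/(a x A) -/(b x A).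
have mb (c : R) : measurable (pair (0, x) @^-1` below c).
  exact: measurable_pair_preimage (measurable_below _).
have sub (c c' : R) : c <= c' -> below c `<=` below c'.
  by move=> cc' p; rewrite /below/= => /le_trans; apply; rewrite lerD2r.
have main (c c' : R) : c <= c' -> pr P (pair (0, x) @^-1` (below c' `\` below c)) <= `|c' - c|.
  move=> cc'.
  have <- : pr P (pair (0, x) @^-1` below c') - pr P (pair (0, x) @^-1` below c) =
      pr P (pair (0, x) @^-1` (below c' `\` below c)).
    apply/eqP; rewrite subr_eq -prU; last 3 first.
    - exact: measurable_pair_preimage (measurableD (measurable_below _) (measurable_below _)).
    - exact: mb.
    - by rewrite -subset0 => w /= [[]].
    apply/eqP; congr pr; apply/seteqP; split=> w /=; last first.
      by case=> [[]//|]; exact: sub.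
    by move=> H; have [|] := pselect (below c (pair (0, x) w)); [right|left].
  apply: pr_below_lip.
  - by move=> A0 B0; exact: pr_pair_rect (eg_indep noise) _ _ _.
  - by have [_ _ _ _ unif] := noise; move=> A0 mA0; exact: unif.
case/orP: (le_total (a x A) (b x A)) => ab.
  rewrite /Diff (_ : below (a x A) `\` below (b x A) = set0) ?set0U; last first.
    by rewrite -subset0 => p [/(sub _ _ ab)].
  by rewrite distrC; exact: main.
rewrite /Diff (_ : below (b x A) `\` below (a x A) = set0) ?setU0; last first.
  by rewrite -subset0 => p [/(sub _ _ ab)].
exact: main.
Qed.
End Law.

(** * Law of the history *)

Section History.
Variables (R : realType) (G : causal_graph) (B : bglm R G).
Context d (Omega : measurableType d) (P : probability Omega R).
Variables (eps gam : nat -> node G -> {RV P >-> R}).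
Hypothesis noise : bglm_noise B eps gam.
Implicit Types (S : {set node G}) (v : valuation G) (h : seq (observation G)).

Local Notation e := (node_noise eps).
Local Notation g := (node_noise gam).
Local Notation out := (round_outcome B eps gam).
Local Notation law := (outcome_law B eps gam).

Variable pi : policy G.

(* Expectation of F over the histories of length t under the policy. *)
Fixpoint hexp (t : nat) (F : seq (observation G) -> R) : R :=
  if t is t'.+1 then
    hexp t' (fun h => \sum_v law (pi h) v * F (rcons h (pi h, v)))
  else F [::].

(** Carrier of the law of the histories: comparisons under [hexp] are needed only here, valuations
    with the root off having probability 0. The root being on is what keeps [activation] in
    [0, 1]. *)
Inductive reachable : nat -> seq (observation G) -> Prop :=
| reachable0 : reachable 0 [::]
| reachableS t h v : reachable t h -> v (Defs.root G) ->
    reachable t.+1 (rcons h (pi h, v)).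

Lemma reachable_size t h : reachable t h -> size h = t.
Proof. by elim=> // {}t {}h v _ IH _; rewrite size_rcons IH. Qed.

Lemma le_hexp t F F' : (forall h, reachable t h -> F h <= F' h) -> hexp t F <= hexp t F'.
Proof.
elim: t F F' => [|t IH] F F' H /=; first by apply: H; exact: reachable0.
apply: IH => h rh; apply: ler_sum => v _.
have [vr|/(law_root B eps gam (pi h)) ->] := boolP (v (Defs.root G)); last by rewrite !mul0r.
by rewrite ler_wpM2l ?law_ge0//; apply: H; exact: reachableS.
Qed.

Lemma eq_hexp t F F' : (forall h, reachable t h -> F h = F' h) -> hexp t F = hexp t F'.
Proof. by move=> H; apply/le_anti; rewrite !le_hexp// => h /H ->. Qed.

Lemma hexpD t F F' : hexp t (fun h => F h + F' h) = hexp t F + hexp t F'.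
Proof.
elim: t F F' => [//|t IH] F F' /=; rewrite -IH; apply: eq_hexp => h _.
by rewrite -big_split/=; apply: eq_bigr => v _; rewrite mulrDr.
Qed.

Lemma hexpZ t (c : R) F : hexp t (fun h => c * F h) = c * hexp t F.
Proof.
elim: t F => [//|t IH] F /=; rewrite -IH; apply: eq_hexp => h _.
by rewrite mulr_sumr; apply: eq_bigr => v _; rewrite mulrCA.
Qed.

Lemma hexp0 t : hexp t (fun=> 0) = 0.
Proof.
elim: t => [//|t IH] /=; rewrite -[RHS]IH; apply: eq_hexp => h _.
by rewrite big1// => v _; rewrite mulr0.
Qed.

Lemma hexp_sum t (I : Type) (s : seq I) (Q : pred I) (F : I -> seq (observation G) -> R) :
  hexp t (fun h => \sum_(i <- s | Q i) F i h) = \sum_(i <- s | Q i) hexp t (F i).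
Proof.
elim: s => [|i s IH].
  by rewrite big_nil -[RHS](hexp0 t); apply: eq_hexp => h _; rewrite big_nil.
rewrite big_cons -IH; case: ifP => Qi; last by apply: eq_hexp => h _; rewrite big_cons Qi.
by rewrite -hexpD; apply: eq_hexp => h _; rewrite big_cons Qi.
Qed.

Lemma hexp_cst t (c : R) : hexp t (fun=> c) = c.
Proof.
elim: t => [//|t IH] /=; rewrite -[RHS]IH; apply: eq_hexp => h _.
by rewrite -mulr_suml (sum_law noise) mul1r.
Qed.

Lemma hexp_ge0 t F : (forall h, reachable t h -> 0 <= F h) -> 0 <= hexp t F.
Proof. by move=> H; rewrite -(hexp0 t); exact: le_hexp. Qed.

Local Notation hist := (history B eps gam pi).

(** The cylinder over later rounds makes the induction close: a given outcome of round t + 1 is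
    itself a cylinder and merges with [C] (this is [N]) before the induction hypothesis is applied
    to the first t rounds. *)
Lemma pr_history t (H : pred (seq (observation G))) (s : seq (nat * node G)) C :
  uniq s -> {in s, forall i, (t < i.1)%N} -> (forall i, measurable (C i)) ->
  measurable [set w | H (hist w t)] /\
  pr P ([set w | H (hist w t)] `&` cylinder e g s C) =
  hexp t (fun h => (H h)%:R) * pr P (cylinder e g s C).
Proof.
elim: t H s C => [|t IH] H s C us st mC.
  rewrite /=; have [Hn|nH] := boolP (H [::]).
    have -> : [set _ : Omega | true] = setT by apply/seteqP; split.
    by rewrite setTI mul1r.
  have -> : [set _ : Omega | false] = set0 by apply/seteqP; split.
  by rewrite set0I pr0 mul0r.
pose O w := (pi (hist w t), out t.+1 (pi (hist w t)) (weight B) w).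
pose H' (i : {set node G} * valuation G) h := (pi h == i.1) && H (rcons h i).
have mH (H0 : pred (seq (observation G))) : measurable [set w | H0 (hist w t)].
  by have [] := IH H0 [::] C isT (fun i (k : i \in [::]) => False_ind _ (notF k)) mC.
have HE : [set w | H (hist w t.+1)] =
    \bigcup_(i in [set` (predT : pred ({set node G} * valuation G))])
      ([set w | H' i (hist w t)] `&` [set w | out t.+1 i.1 (weight B) w = i.2]).
  apply/seteqP; split=> [w Hw|w [[S v] _ [/= /andP[/eqP piS Hw] wv]]]; last first.
    by rewrite piS wv.
  exists (O w) => //; split=> //=.
  by rewrite /H' eqxx.
have mHt : measurable [set w | H (hist w t.+1)].
  rewrite HE; apply: fin_bigcup_measurable => // i _.
  by apply: measurableI; [exact: mH|exact: measurable_outcome].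
split=> //.
have mO i : measurable [set w | O w = i].
  rewrite (_ : [set w | _] = [set w | pi (hist w t) == i.1] `&` [set w | out t.+1 i.1 (weight B) w = i.2]).
    by apply: measurableI; [exact: (mH (fun h => pi h == i.1))|exact: measurable_outcome].
  apply/seteqP; split=> [w <- //=|w [/= /eqP piE oE]].
  by rewrite /O piE oE; case: i {piE oE} => ? ?.
have mcyl : measurable (cylinder e g s C) by exact: measurable_cylinder.
rewrite (pr_partition P (measurableI _ _ mHt mcyl) mO).
have term i : pr P ([set w | H (hist w t.+1)] `&` cylinder e g s C `&` [set w | O w = i]) =
    hexp t (fun h => (H' i h)%:R) * law i.1 i.2 * pr P (cylinder e g s C).
  pose N (j : nat * node G) := if j.1 == t.+1 then node_event B i.1 (weight B) i.2 j.2 else C j.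
  have NC : cylinder e g s N = cylinder e g s C.
    by apply: eq_cylinder => j /st; rewrite /N; case: eqP => // ->; rewrite ltnn.
  have NO : cylinder e g (round G t.+1) N = [set w | out t.+1 i.1 (weight B) w = i.2].
    by rewrite outcome_cylinder; apply: eq_cylinder => _ /mapP[x _ ->]; rewrite /N eqxx.
  have -> : [set w | H (hist w t.+1)] `&` cylinder e g s C `&` [set w | O w = i] =
      [set w | H' i (hist w t)] `&` cylinder e g (round G t.+1 ++ s) N.
    rewrite cylinder_cat NC NO; apply/seteqP; split=> w.
      move=> [[/= Hw cw]] Oi; rewrite -Oi in Hw *.
      by split=> //; rewrite /H' eqxx; exact: Hw.
    case=> /= /andP[/eqP piE Hw] [ow cw]; rewrite /O piE ow.
    by case: i {N NC NO} piE Hw ow => S v /= piE Hw ow.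
  have [|||_ ->] := IH (H' i) (round G t.+1 ++ s) N.
  - rewrite cat_uniq round_uniq us andbT/=; apply/hasPn => j /st it.
    by apply/mapP => -[x _ jE]; rewrite jE ltnn in it.
  - move=> j; rewrite mem_cat => /orP[/mapP[x _ ->]//|/st]; exact: ltn_trans.
  - by move=> j; rewrite /N; case: ifP => // _; exact: measurable_node_event.
  rewrite -mulrA cylinder_cat NC NO; congr (_ * _).
  rewrite (pr_outcome_indep noise)//; first by rewrite (pr_outcome_round noise).
  by move=> j /st; case: eqP => // ->; rewrite ltnn.
rewrite (eq_bigr _ (fun i _ => term i)) -mulr_suml; congr (_ * _) => /=.
under eq_bigr do rewrite mulrC -hexpZ.
rewrite -hexp_sum; apply: eq_hexp => h _.
rewrite [LHS](_ : _ = \sum_S \sum_v law S v * (H' (S, v) h)%:R); last first.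
  by rewrite pair_bigA; apply: eq_bigr => -[].
rewrite (bigD1 (pi h))//=.
rewrite [X in _ + X]big1 ?addr0; last first.
  by move=> S Sp; apply: big1 => v _; rewrite /H'/= eq_sym (negbTE Sp) mulr0.
by apply: eq_bigr => v _; rewrite /H'/= eqxx.
Qed.

Lemma pr_historyE t (H : pred (seq (observation G))) :
  pr P [set w | H (hist w t)] = hexp t (fun h => (H h)%:R).
Proof.
have [] := @pr_history t H [::] (fun=> setT) isT _ (fun=> measurableT) => //.
by rewrite cylinder_nil prT setIT mulr1.
Qed.

Lemma measurable_history t (H : pred (seq (observation G))) :
  measurable [set w | H (hist w t)].
Proof. by have [] := @pr_history t H [::] (fun=> setT) isT _ (fun=> measurableT). Qed.

(** Histories form an infinite type, so integration goes through a finite quotient; the set chosen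
    by the policy is such a quotient, and the regret of a round is a function of it. *)
Lemma integrable_history_fin t (I : finType) (k : seq (observation G) -> I) (r : I -> R) :
  P.-integrable setT (fun w => (r (k (hist w t)))%:E) /\
  (\int[P]_w (r (k (hist w t)))%:E)%E = (hexp t (fun h => r (k h)))%:E.
Proof.
have mk i : measurable [set w | k (hist w t) = i].
  rewrite (_ : [set w | _] = [set w | k (hist w t) == i]).
    exact: (@measurable_history t (fun h => k h == i)).
  by apply/seteqP; split=> w /= /eqP.
have rE w : (r (k (hist w t)))%:E =
    (\sum_i (r i)%:E * (\1_[set w | k (hist w t) = i] w)%:E)%E.
  rewrite (bigD1 (k (hist w t)))//= indicE mem_set// mule1 big1 ?adde0// => i /eqP ki.
  by rewrite indicE memNset ?mule0// => /= /esym.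
have ii i : P.-integrable setT (fun w => (r i)%:E * (\1_[set w | k (hist w t) = i] w)%:E)%E.
  by apply: integrableZl => //; exact: integrable_indic.
have -> : (fun w => (r (k (hist w t)))%:E) =
    (fun w => \sum_i (r i)%:E * (\1_[set w | k (hist w t) = i] w)%:E)%E.
  by apply/funext => w; rewrite rE.
split; first exact: integrable_sum.
rewrite integral_sum//.
rewrite (eq_hexp (F' := fun h => \sum_i r i * (k h == i)%:R)); last first.
  move=> h _; rewrite (bigD1 (k h))//= eqxx mulr1 big1 ?addr0// => i /negbTE ki.
  by rewrite eq_sym ki mulr0.
rewrite hexp_sum -sumEFin; apply: eq_bigr => i _.
rewrite integralZl//; last exact: integrable_indic.
rewrite integral_indic// setIT hexpZ -pr_historyE EFinM.
congr (_ * _)%E; apply: etrans (prE P (mk i)) _.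
by congr ((pr _ _)%:E); apply/seteqP; split=> w /= /eqP.
Qed.

(** Index shift: the intervention of round t + 1 is chosen from the history of length t. *)
Lemma regretE Sopt (T : nat) : regret B eps gam Sopt pi T =
  (\sum_(t < T) hexp t (fun h =>
     sigma B eps gam Sopt (weight B) - sigma B eps gam (pi h) (weight B)))%:E.
Proof.
rewrite /regret unlock /=.
pose r S := sigma B eps gam Sopt (weight B) - sigma B eps gam S (weight B).
have fin t := integrable_history_fin t pi r.
rewrite (eq_integral (fun w => \sum_(t < T) (r (pi (hist w t)))%:E)%E); last first.
  by move=> w _; rewrite big_add1 big_mkord sumEFin.
rewrite integral_sum// => [|t]; last by have [] := fin t.
by rewrite -sumEFin; apply: eq_bigr => t _; have [_] := fin t.
Qed.

End History.

(** * Concentration of the parent noise *)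

Section RealInequalities.
Variable R : realType.

(** Multiply by exp(-x) >= 1 - x: the product of the two polynomials is 1 + x^2 (1 - 2 x) >= 1. *)
Lemma expR_le_quadratic (x : R) : x <= 1 / 2 -> expR x <= 1 + x + 2 * x ^+ 2.
Proof.
move=> x12; have h := expR_ge1Dx (- x); have e0 := expR_gt0 (- x).
have E : expR x * expR (- x) = 1 by rewrite expRN divff// gt_eqF// expR_gt0.
have p0 : 0 <= 1 + x + 2 * x ^+ 2 by nra.
rewrite -(@ler_pM2r _ (expR (- x)))// E.
apply: (@le_trans _ _ ((1 + x + 2 * x ^+ 2) * (1 - x))); last by rewrite ler_wpM2l.
have -> : (1 + x + 2 * x ^+ 2) * (1 - x) = 1 + x ^+ 2 * (1 - 2 * x) by ring.
by rewrite lerDl mulr_ge0 ?sqr_ge0//; lra.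
Qed.

(** In the quadratic bound on exp the linear terms cancel by centring; what is left is 1 + 2 q (1 -
    q) l^2, at most 1 + l^2 / 2 <= exp(l^2 / 2). *)
Lemma bernoulli_mgf_le (q l : R) : 0 <= q <= 1 -> `|l| <= 1 / 2 ->
  q * expR (l * (1 - q) - l ^+ 2 / 2) + (1 - q) * expR (l * (0 - q) - l ^+ 2 / 2) <= 1.
Proof.
move=> /andP[q0 q1] l12.
have /andP[l1 l2] : - (1 / 2) <= l <= 1 / 2 by rewrite -ler_norml.
rewrite !expRD !mulrA -mulrDl expRN ler_pdivrMr ?expR_gt0// mul1r.
apply: le_trans (expR_ge1Dx _).
have e1 : expR (l * (1 - q)) <= 1 + l * (1 - q) + 2 * (l * (1 - q)) ^+ 2.
  by apply: expR_le_quadratic; nra.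
have e2 : expR (l * (0 - q)) <= 1 + l * (0 - q) + 2 * (l * (0 - q)) ^+ 2.
  by apply: expR_le_quadratic; nra.
have := ler_wpM2l q0 e1; have := ler_wpM2l (_ : 0 <= 1 - q) e2.
rewrite subr_ge0 => /(_ q1) h2 h1.
apply: (le_trans (lerD h1 h2)).
have -> : q * (1 + l * (1 - q) + 2 * (l * (1 - q)) ^+ 2) +
   (1 - q) * (1 + l * (0 - q) + 2 * (l * (0 - q)) ^+ 2) = 1 + l ^+ 2 * (2 * q * (1 - q)) by ring.
rewrite lerD2l ler_wpM2l ?sqr_ge0//; have := sqr_ge0 (2 * q - 1).
have -> : (2 * q - 1) ^+ 2 = 1 - 2 * (2 * q * (1 - q)) by ring.
lra.
Qed.

Lemma sqrt_increment_ge (c : R) : 0 <= c ->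
  (Num.sqrt (c + 1))^-1 <= 2 * Num.sqrt (c + 1) - 2 * Num.sqrt c.
Proof.
move=> c0; set a := Num.sqrt (c + 1); set b := Num.sqrt c.
have a0 : 0 < a by rewrite sqrtr_gt0; lra.
have b0 : 0 <= b := sqrtr_ge0 _.
have a2 : a ^+ 2 = c + 1 by rewrite sqr_sqrtr//; lra.
have b2 : b ^+ 2 = c by rewrite sqr_sqrtr.
rewrite -div1r ler_pdivrMr//; have := sqr_ge0 (a - b).
have -> : (a - b) ^+ 2 = a ^+ 2 + b ^+ 2 - 2 * (a * b) by ring.
have -> : (2 * a - 2 * b) * a = 2 * a ^+ 2 - 2 * (a * b) by ring.
lra.
Qed.

Lemma dyadic_between (r : R) (J : nat) : 0 < r <= 1 -> (2 ^+ J)^-1 <= r ->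
  exists2 j : nat, (j <= J)%N & r / 2 <= (2 ^+ j)^-1 <= r.
Proof.
move=> /andP[r0 r1] rJ.
have ex : exists j, (2 ^+ j)^-1 <= r by exists J.
case: (ex_minnP ex) => j jr jmin; exists j; first exact: jmin.
rewrite jr andbT; case: j jr jmin => [|j] jr jmin.
  by rewrite expr0 invr1; lra.
have : ~~ ((2 ^+ j)^-1 <= r) by apply/negP => /jmin; rewrite ltnn.
rewrite -ltNge exprS invfM => /ltW; lra.
Qed.

(* Maximising x Z - x^2 N / 2 over all x gives Z^2 / (2 N); restricting x to the
   tilts 2^-j / 2 costs a constant factor, the slack 7 / 32 absorbing small Z / N. *)
Lemma dyadic_quadratic (J : nat) (Z N : R) : `|Z| <= N -> N <= 4 ^+ J ->
  exists l : option (bool * 'I_J.+1),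
    let x := if l is Some (b, j) then (-1) ^+ b / 2 / 2 ^+ j else 0 in
    7 / 32 * (Z ^+ 2 / N - 1) <= x * Z - x ^+ 2 / 2 * N.
Proof.
move=> ZN NJ; have N0 : 0 <= N by apply: le_trans ZN.
have [N00|Nn0] := eqVneq N 0.
  exists None => /=; rewrite N00 invr0 !mulr0 !mul0r; lra.
have Np : 0 < N by rewrite lt_neqAle eq_sym Nn0.
have [rJ|rJ] := lerP (2 ^+ J)^-1 (`|Z| / N).
  have r01 : 0 < `|Z| / N <= 1.
    rewrite ler_pdivrMr// mul1r ZN andbT; apply: lt_le_trans rJ.
    by rewrite invr_gt0 exprn_gt0.
  have [j jJ /andP[lj uj]] := dyadic_between r01 rJ.
  exists (Some (Z < 0, inord j)) => /=; rewrite inordK//.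
  set y := (2 ^+ j)^-1 in lj uj *.
  have sZ : (-1) ^+ (Z < 0)%R * Z = `|Z| by rewrite -normrEsign.
  have s2 : ((-1) ^+ (Z < 0)%R) ^+ 2 = 1 :> R by rewrite sqrr_sign.
  have -> : (-1) ^+ (Z < 0)%R / 2 * y * Z = y / 2 * ((-1) ^+ (Z < 0)%R * Z) by ring.
  have -> : ((-1) ^+ (Z < 0)%R / 2 * y) ^+ 2 = ((-1) ^+ (Z < 0)%R) ^+ 2 * (y ^+ 2 / 4) by field.
  rewrite sZ s2 mul1r -(real_normK (num_real Z)); set a := `|Z| in lj uj r01 *.
  set r := a / N in lj uj r01 *.
  have aE : a = r * N by rewrite /r divfK.
  rewrite aE.
  have -> : (r * N) ^+ 2 / N = r ^+ 2 * N by field.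
  (* The right side increases in y on [r / 2, r]; at y = r / 2 it equals r^2 / 4 - r^2 / 32, the
     origin of 7/32. *)
  have : 7 / 32 * r ^+ 2 <= y / 2 * r - y ^+ 2 / 8.
    have : 0 <= (y - r / 2) * (r - y) by rewrite mulr_ge0// subr_ge0.
    have : 0 <= r ^+ 2 by rewrite sqr_ge0.
    have : 0 <= (y - r / 2) * r by rewrite mulr_ge0// ?subr_ge0//; lra.
    nra.
  move=> /(ler_wpM2r N0); lra.
(* Below the finest scale, |Z| 2^J <= N and N <= 4^J give Z^2 <= N, and the zero tilt suffices. *)
exists None => /=; rewrite mul0r expr0n/= !mul0r subr0.
suff : Z ^+ 2 / N <= 1 by lra.
rewrite ler_pdivrMr// mul1r.
have h : `|Z| * 2 ^+ J <= N.
  by move: rJ; rewrite ltr_pdivrMr// -(@ltr_pM2r _ (2 ^+ J)) ?exprn_gt0// mulrAC mulVf ?mul1r ?expf_neq0// => /ltW.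
have j0 : 0 < 2 ^+ J :> R by rewrite exprn_gt0.
have J4 : 4 ^+ J = (2 ^+ J) ^+ 2 :> R by rewrite -exprM mulnC exprM; congr (_ ^+ _); ring.
rewrite J4 in NJ.
rewrite -(real_normK (num_real Z)).
rewrite -(@ler_pM2r _ ((2 ^+ J) ^+ 2)) ?exprn_gt0// -exprMn.
apply: (@le_trans _ _ (N ^+ 2)).
  by rewrite ler_pXn2r ?nnegrE// mulr_ge0// ltW.
by rewrite expr2 ler_wpM2l.
Qed.

End RealInequalities.

Lemma card_mul_sum (R : realType) (I : finType) (c : R) : #|I|%:R * c = \sum_(i : I) c.
Proof. by rewrite sumr_const mulr_natl. Qed.

Section Concentration.
Variables (R : realType) (G : causal_graph) (B : bglm R G).
Context d (Omega : measurableType d) (P : probability Omega R).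
Variables (eps gam : nat -> node G -> {RV P >-> R}).
Hypothesis noise : bglm_noise B eps gam.
Implicit Types (S A : {set node G}) (v : valuation G) (x : node G) (h : seq (observation G)).

Local Notation law := (outcome_law B eps gam).
Local Notation parent_law := (parents_law B eps gam).

Definition parent_count x A h : R :=
  \sum_(o <- h | x \notin o.1) (active_parents x o.2 == A)%:R.

Definition parent_noise x A h : R :=
  \sum_(o <- h | x \notin o.1)
    (active_parents x o.2 == A)%:R * ((o.2 x)%:R - activation B x A).

Lemma parent_count_ge0 x A h : 0 <= parent_count x A h.
Proof. by apply: sumr_ge0 => o _; exact: ler0n. Qed.

Lemma parent_count_rcons x A h S v : parent_count x A (rcons h (S, v)) =
  parent_count x A h + (x \notin S)%:R * (active_parents x v == A)%:R.
Proof.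
rewrite /parent_count -cats1 big_cat big_cons big_nil/=; congr (_ + _).
by case: ifP => _; rewrite ?mul1r ?mul0r ?addr0.
Qed.

Lemma parent_noise_rcons x A h S v : parent_noise x A (rcons h (S, v)) =
  parent_noise x A h + (x \notin S)%:R *
    ((active_parents x v == A)%:R * ((v x)%:R - activation B x A)).
Proof.
rewrite /parent_noise -cats1 big_cat big_cons big_nil/=; congr (_ + _).
by case: ifP => _; rewrite ?mul1r ?mul0r ?addr0.
Qed.

Lemma parent_count_size x A h : parent_count x A h <= (size h)%:R.
Proof.
elim/last_ind: h => [|h [S v] IH]; first by rewrite /parent_count big_nil.
rewrite parent_count_rcons size_rcons -natr1 lerD// -natrM lern1.
by case: (_ \notin _); case: (_ == _).
Qed.

Section Policy.
Variable pi : policy G.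
Local Notation hexp := (hexp B eps gam pi).

Lemma reachable_root t h : reachable pi t h -> all (fun o : observation G => o.2 (Defs.root G)) h.
Proof. by elim=> // {}t {}h v _ IH vr; rewrite all_rcons /= vr. Qed.

Lemma sum_law_parents S x (F : {set node G} -> R) :
  \sum_v law S v * F (active_parents x v) = \sum_A parent_law S x A * F A.
Proof.
rewrite (partition_big (active_parents x) predT)//=; apply: eq_bigr => A _.
by rewrite /parent_law mulr_suml; apply: eq_bigr => v /eqP ->.
Qed.

Lemma sum_law_cst S (c : R) : \sum_v law S v * c = c.
Proof. by rewrite -mulr_suml (sum_law noise) mul1r. Qed.

(** A round raises only the count of the configuration it realises, and [sqrt_increment_ge] compares
    the resulting growth of the potential with the width at that configuration. *)
Lemma potential_step x h S : x \notin S ->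
  \sum_A parent_law S x A / Num.sqrt (parent_count x A h + 1) <=
  \sum_v law S v * (\sum_A 2 * Num.sqrt (parent_count x A (rcons h (S, v)))) -
  \sum_A 2 * Num.sqrt (parent_count x A h).
Proof.
move=> xS; set Phi := \sum_A 2 * Num.sqrt (parent_count x A h).
rewrite -[X in _ <= _ - X](sum_law_cst S) -sumrB.
rewrite [leLHS](_ : _ = \sum_v law S v *
    (Num.sqrt (parent_count x (active_parents x v) h + 1))^-1); last first.
  exact: (esym (sum_law_parents S x (fun A => (Num.sqrt (parent_count x A h + 1))^-1))).
apply: ler_sum => v _; rewrite -mulrBr ler_wpM2l ?law_ge0//.
rewrite /Phi -sumrB (bigD1 (active_parents x v))//= big1 ?addr0; last first.
  move=> A Av; rewrite parent_count_rcons xS mul1r eq_sym (negbTE Av) addr0.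
  by rewrite subrr.
rewrite parent_count_rcons xS eqxx mul1r.
exact/sqrt_increment_ge/parent_count_ge0.
Qed.

(** The expected potential telescopes: it is unchanged in rounds that force [x], and at the end
    every count is at most T. *)
Lemma potential_bound x T :
  \sum_(t < T) hexp t (fun h => (x \notin pi h)%:R *
     \sum_A parent_law (pi h) x A / Num.sqrt (parent_count x A h + 1)) <=
  #|{set node G}|%:R * (2 * Num.sqrt T%:R).
Proof.
pose Phi h := \sum_A 2 * Num.sqrt (parent_count x A h).
apply: (@le_trans _ _ (hexp T Phi)); last first.
  rewrite -(hexp_cst noise pi T (_ * _)); apply: le_hexp => h rh.
  rewrite card_mul_sum; apply: ler_sum => A _.
  by rewrite ler_wpM2l// ler_wsqrtr// -(reachable_size rh) parent_count_size.
elim: T => [|T IH].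
  rewrite big_ord0; apply: hexp_ge0 => h _; apply: sumr_ge0 => A _.
  by rewrite mulr_ge0// sqrtr_ge0.
rewrite big_ord_recr/= (le_trans (lerD IH (lexx _)))// -hexpD.
apply: le_hexp => h rh.
have [xS|xS] := boolP (x \in pi h).
  rewrite mul0r addr0 -[leLHS](sum_law_cst (pi h)).
  apply: ler_sum => v _; rewrite ler_wpM2l ?law_ge0//.
  rewrite /Phi; apply: ler_sum => A _.
  by rewrite parent_count_rcons xS mul0r addr0.
rewrite mul1r addrC -lerBrDr; exact: potential_step.
Qed.

Definition exp_process (x : node G) (l : {set node G} -> R) h : R :=
  expR (\sum_A (l A * parent_noise x A h - l A ^+ 2 / 2 * parent_count x A h)).

(** Supermartingale step: given the parent configuration [A] only the summand of [A] changes, and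
    its new factor has mean at most 1 because [x] is then Bernoulli with parameter
    [activation B x A]. *)
Lemma exp_process_le1 x (l : {set node G} -> R) t : x != Defs.root G ->
  (forall A, `|l A| <= 1 / 2) -> hexp t (exp_process x l) <= 1.
Proof.
move=> xr l12; elim: t => [|t IH] /=.
  rewrite /exp_process big1 ?expR0// => A _.
  by rewrite /parent_noise /parent_count !big_nil !mulr0 subrr.
apply: le_trans IH; apply: le_hexp => h rh.
have [xS|xS] := boolP (x \in pi h).
  rewrite -[leRHS](sum_law_cst (pi h)).
  apply: ler_sum => v _; rewrite ler_wpM2l ?law_ge0//.
  rewrite /exp_process ler_expR; apply: ler_sum => A _.
  by rewrite parent_count_rcons parent_noise_rcons xS !mul0r !addr0.
pose K v := expR (l (active_parents x v) * ((v x)%:R - activation B x (active_parents x v))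
   - l (active_parents x v) ^+ 2 / 2).
have step v : exp_process x l (rcons h (pi h, v)) = exp_process x l h * K v.
  rewrite /exp_process /K -expRD; congr expR.
  rewrite (bigD1 (active_parents x v))//= [in RHS](bigD1 (active_parents x v))//=.
  rewrite parent_noise_rcons parent_count_rcons eqxx xS !mul1r.
  rewrite (eq_bigr (fun A => l A * parent_noise x A h - l A ^+ 2 / 2 * parent_count x A h)).
    by rewrite mulr1n; ring.
  move=> A Av; rewrite parent_noise_rcons parent_count_rcons eq_sym (negbTE Av).
  by rewrite !mul0r !mulr0 !addr0.
under eq_bigr do rewrite step mulrCA.
rewrite -mulr_sumr ler_piMr ?expR_ge0//.
rewrite (partition_big (active_parents x) predT)//= -[leRHS](sum_law noise (pi h)).
rewrite [leRHS](partition_big (active_parents x) predT)//=.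
apply: ler_sum => A _.
pose E b := expR (l A * (b%:R - activation B x A) - l A ^+ 2 / 2).
rewrite (bigID (fun v => v x))/=.
rewrite (eq_bigr (fun v => law (pi h) v * E 1%N)) => [|v /andP[/eqP vA vx]]; last first.
  by rewrite /K vA vx.
rewrite [X in _ + X](eq_bigr (fun v => law (pi h) v * E 0%N)) => [|v /andP[/eqP vA /negbTE vx]]; last first.
  by rewrite /K vA vx.
rewrite -!mulr_suml (law_node noise)// (law_node_off noise)// -/(parent_law (pi h) x A).
(* Without the root [activation] need not be a probability, but such a configuration has mass 0. *)
have [rA|nrA] := boolP (Defs.root G \in A); last first.
  have -> : parent_law (pi h) x A = 0.
    rewrite /parents_law big1// => v /eqP vA; apply: law_root.
    by rewrite -(root_active v xr) vA.
  by rewrite !mulr0 !mul0r addr0.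
have := bernoulli_mgf_le (activation_itv noise xr rA) (l12 A).
rewrite -[X in _ <= X -> _](mulr1 1) => H.
have p0 := parents_law_ge0 B eps gam (pi h) x A.
have := ler_wpM2l p0 H; rewrite /E mulr0n mulr1n mulr1; lra.
Qed.

Lemma norm_parent_noise x A t h : x != Defs.root G -> reachable pi t h ->
  `|parent_noise x A h| <= parent_count x A h.
Proof.
move=> xr /reachable_root hr; rewrite /parent_noise /parent_count.
rewrite big_seq_cond [leRHS]big_seq_cond.
apply: le_trans (ler_norm_sum _ _ _) _; apply: ler_sum => o /andP[oh _].
rewrite normrM ger0_norm ?ler0n//; case: eqP => [oA|]; last by rewrite mul0r.
have rA : Defs.root G \in A by rewrite -oA root_active// (allP hr).
have /andP[q0 q1] := activation_itv noise xr rA.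
rewrite mul1r ler_norml; case: (o.2 x) => /=; lra.
Qed.

Definition chi2 x h : R := \sum_A parent_noise x A h ^+ 2 / parent_count x A h.

(** Markov's inequality summed over the grid. When [chi2] exceeds [thr], the tilts of
    [dyadic_quadratic], one per configuration, make the exponent of one process at least 7/32 times
    [thr] minus the number of configurations. *)
Lemma chi2_tail x t (J : nat) (thr : R) : x != Defs.root G -> (t%:R <= 4 ^+ J :> R) ->
  hexp t (fun h => (thr < chi2 x h)%R%:R) <=
  #|{ffun {set node G} -> option (bool * 'I_J.+1)}|%:R *
    expR (- (7 / 32 * (thr - #|{set node G}|%:R))).
Proof.
move=> xr tJ.
pose val (o : option (bool * 'I_J.+1)) : R :=
  if o is Some (b, j) then (-1) ^+ b / 2 / 2 ^+ j else 0.
have val12 o : `|val o| <= 1 / 2.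
  case: o => [[b j]|]/=; last by rewrite normr0.
  rewrite !normrM normr_sign mul1r ger0_norm// ger0_norm ?invr_ge0 ?exprn_ge0//.
  by rewrite div1r ler_piMr// invf_le1 ?exprn_gt0// exprn_ege1 ?ler1n.
set c := expR _.
apply: (@le_trans _ _ (hexp t (fun h =>
    \sum_(l : {ffun {set node G} -> option (bool * 'I_J.+1)})
      c * exp_process x (fun A => val (l A)) h))).
  apply: le_hexp => h rh.
  have E l : 0 <= c * exp_process x (fun A => val (l A)) h.
    by rewrite mulr_ge0// expR_ge0.
  have [ltthr|_] := boolP (thr < chi2 x h); last by rewrite sumr_ge0.
  have /choice[l lP] : forall A, exists l : option (bool * 'I_J.+1),
     7 / 32 * (parent_noise x A h ^+ 2 / parent_count x A h - 1) <=
     val l * parent_noise x A h - val l ^+ 2 / 2 * parent_count x A h.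
    move=> A; apply: dyadic_quadratic; first exact: norm_parent_noise rh.
    apply: le_trans tJ; rewrite -(reachable_size rh); exact: parent_count_size.
  rewrite (bigD1 [ffun A => l A])//= -[leLHS]addr0 lerD ?sumr_ge0//.
  rewrite /c /exp_process -expRD; apply: le_trans (expR_ge1Dx _).
  rewrite mulr1n lerDl.
  have : \sum_A 7 / 32 * (parent_noise x A h ^+ 2 / parent_count x A h - 1) <=
     \sum_A (val (l A) * parent_noise x A h - val (l A) ^+ 2 / 2 * parent_count x A h).
    by apply: ler_sum => A _; exact: lP.
  rewrite -mulr_sumr sumrB -/(chi2 x h) -card_mul_sum mulr1.
  under [X in _ -> 0 <= _ + X]eq_bigr do rewrite ffunE.
  lra.
rewrite hexp_sum card_mul_sum; apply: ler_sum => l _.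
by rewrite hexpZ ler_piMr ?expR_ge0// exp_process_le1.
Qed.

End Policy.
End Concentration.

(** * Confidence regions *)

Section Confidence.
Variables (R : realType) (G : causal_graph) (B : bglm R G).
Implicit Types (S A : {set node G}) (v : valuation G) (x : node G) (h : seq (observation G)).

Lemma gram_quad h x (u : 'cV[R]_#|par x|) : (u^T *m gram R h x *m u) 0 0 =
  \sum_(o <- h | x \notin o.1) dotv (parv x o.2) u ^+ 2.
Proof.
rewrite /gram mulmx_sumr mulmx_suml summxE; apply: eq_bigr => o _.
rewrite !mulmxA -mulmxA mxE big_ord1 expr2; congr (_ * _).
by rewrite -/(dotv _ _) dotvC.
Qed.

Lemma mxnorm_gram h x (u : 'cV[R]_#|par x|) : mxnorm (gram R h x) u =
  Num.sqrt (\sum_(o <- h | x \notin o.1) dotv (parv x o.2) u ^+ 2).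
Proof. by rewrite /mxnorm gram_quad. Qed.

Lemma gram_quad_parents h x (u : 'cV[R]_#|par x|) :
  \sum_(o <- h | x \notin o.1) dotv (parv x o.2) u ^+ 2 =
  \sum_A parent_count R x A h * dotv (parent_vector R x A) u ^+ 2.
Proof.
rewrite /parent_count; under [RHS]eq_bigr do rewrite mulr_suml.
rewrite exchange_big; apply: eq_bigr => o _ /=.
rewrite (bigD1 (active_parents x o.2))//= eqxx mul1r parent_vectorE big1 ?addr0//.
by move=> A; rewrite eq_sym => /negbTE ->; rewrite mul0r.
Qed.

(** Group the rounds by configuration and apply Cauchy-Schwarz to Z_A / sqrt(N_A) against sqrt(N_A)
    times the projection of u. If N_A = 0 then Z_A = 0 too, so the division by zero is harmless. *)
Lemma noise_quad_le h x (u : 'cV[R]_#|par x|) :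
  (\sum_(o <- h | x \notin o.1)
    ((o.2 x)%:R - link B x (dotv (parv x o.2) (weight B x))) * dotv (parv x o.2) u) ^+ 2 <=
  chi2 B x h * \sum_(o <- h | x \notin o.1) dotv (parv x o.2) u ^+ 2.
Proof.
have -> : \sum_(o <- h | x \notin o.1)
    ((o.2 x)%:R - link B x (dotv (parv x o.2) (weight B x))) * dotv (parv x o.2) u =
    \sum_A parent_noise B x A h * dotv (parent_vector R x A) u.
  rewrite /parent_noise; under [RHS]eq_bigr do rewrite mulr_suml.
  rewrite exchange_big; apply: eq_bigr => o _ /=.
  rewrite (bigD1 (active_parents x o.2))//= eqxx mul1r /activation parent_vectorE big1 ?addr0.
    by rewrite (dotvC (weight B x)).
  by move=> A; rewrite eq_sym => /negbTE ->; rewrite !mul0r.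
rewrite gram_quad_parents.
have c0 A := parent_count_ge0 R x A h.
have noise0 A : parent_count R x A h = 0 -> parent_noise B x A h = 0.
  move=> /eqP; rewrite /parent_count psumr_eq0; last by move=> o _; exact: ler0n.
  move=> /allP all0; rewrite /parent_noise big_seq_cond big1// => o /andP[oh xo].
  have := all0 o oh; rewrite xo /= => /eqP ->; by rewrite mul0r.
have -> : \sum_A parent_noise B x A h * dotv (parent_vector R x A) u =
   \sum_A (parent_noise B x A h / Num.sqrt (parent_count R x A h)) *
     (Num.sqrt (parent_count R x A h) * dotv (parent_vector R x A) u).
  apply: eq_bigr => A _; have [n0|n0] := eqVneq (parent_count R x A h) 0.
    by rewrite noise0// !mul0r.
  rewrite mulrA divfK// gt_eqF// sqrtr_gt0 lt_neqAle eq_sym n0; exact: c0.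
apply: le_trans (cauchy_schwarz _ _ _ _) _.
rewrite le_eqVlt; apply/orP; left; apply/eqP; congr (_ * _); apply: eq_bigr => A _.
  by rewrite expr_div_n sqr_sqrtr.
by rewrite exprMn sqr_sqrtr.
Qed.

Lemma parv_cube x v : unit_cube (parv x v : 'cV[R]_#|par x|).
Proof. by move=> i; rewrite mxE; case: (v _); rewrite /= ?ler01 ?lexx. Qed.

Lemma leq_maxdeg x : (#|par x| <= maxdeg G)%N.
Proof. exact: (leq_bigmax x). Qed.

Lemma dotv_parv_le x v : dotv (parv x v) (parv x v) <= (maxdeg G)%:R :> R.
Proof.
apply: (@le_trans _ _ (\sum_(i < #|par x|) 1)); last first.
  by rewrite sumr_const card_ord ler_nat leq_maxdeg.
rewrite dotvE; apply: ler_sum => i _; rewrite mxE.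
by case: (v _); rewrite /= ?mulr1 ?mulr0 ?ler01.
Qed.

Lemma dotv_parv_weight_ge0 x v : x != Defs.root G -> 0 <= dotv (parv x v) (weight B x).
Proof.
move=> xr; rewrite dotvE sumr_ge0// => i _; rewrite mulr_ge0//.
  by case/andP: (parv_cube v i).
by case/andP: (weight_cube B xr i).
Qed.

Section Smooth.
Variables (L1 L2 : node G -> R).
Hypothesis smooth : smooth_links B L1 L2.

(** A real [inf] lies below the elements only for a set bounded below; the bounds on the first
    derivatives supply such a bound. *)
Lemma kappa_le x v : x != Defs.root G ->
  kappa B <= derive1 (link B x) (dotv (parv x v) (weight B x)).
Proof.
move=> xr; apply: ge_inf.
  exists (- \sum_y `|L1 y|) => r [y [a [th [yr _ _ ->]]]].
  have [_ _ _ _ /(_ (dotv a th))[h _]] := smooth yr.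
  rewrite lerNl; apply: (@le_trans _ _ (L1 y)).
    by apply: le_trans h; rewrite -normrN ler_norm.
  rewrite (bigD1 y)//= (le_trans (ler_norm _))// lerDl.
  by rewrite sumr_ge0.
exists x, (parv x v), (weight B x); split => //; first exact: parv_cube.
by rewrite subrr /norm2 /dotv mulmx0 mxE sqrtr0 ler01.
Qed.

Lemma link_lipschitz x a b : x != Defs.root G ->
  `|link B x a - link B x b| <= L1 x * `|a - b|.
Proof.
move=> xr; have [_ _ d1 _ b1] := smooth xr.
by apply: lipschitz_of_derive => // z; case: (b1 z).
Qed.

(** The root lemmas of the score with Q = 5 l. The constant 256 is half of the 512 in
    [eigen_threshold], because the initial rounds guarantee only half of that threshold
    ([excitation_level]). *)
Lemma score_confidence (l lam : R) h x : x != Defs.root G -> 0 < kappa B -> 0 < l ->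
  (0 < maxdeg G)%N ->
  256 * (maxdeg G)%:R * L2 x ^+ 2 / kappa B ^+ 4 * ((maxdeg G)%:R ^+ 2 + l) <= lam ->
  (forall u : 'cV[R]_#|par x|,
     lam * dotv u u <= \sum_(o <- h | x \notin o.1) dotv (parv x o.2) u ^+ 2) ->
  chi2 B x h <= 5 * l ->
  (exists th : 'cV[R]_#|par x|, score B h th = 0) /\
  forall th : 'cV[R]_#|par x|, score B h th = 0 ->
    mxnorm (gram R h x) (weight B x - th) <= 3 / kappa B * Num.sqrt l.
Proof.
move=> xr k0 l0 D0 lamge gramge chil.
have [_ L20 d1 d2 b12] := smooth xr.
set D : R := (maxdeg G)%:R in lamge *.
have Dp : 0 < D by rewrite ltr0n.
(* Largest squared radius allowed by the curvature condition, which becomes an equality. Then 9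
   kappa^2 lam e is at least 144 (D^2 + l), above 16 Q = 80 l. *)
pose e := kappa B ^+ 2 / (16 * L2 x ^+ 2 * D).
have e0 : 0 < e by rewrite divr_gt0 ?exprn_gt0// !mulr_gt0 ?exprn_gt0.
have Q0 : 0 <= 5 * l by rewrite mulr_ge0// ltW.
have noiseQ (u : 'cV[R]_#|par x|) : (\sum_(o <- h | x \notin o.1)
    ((o.2 x)%:R - link B x (dotv (parv x o.2) (weight B x))) * dotv (parv x o.2) u) ^+ 2 <=
  5 * l * \sum_(o <- h | x \notin o.1) dotv (parv x o.2) u ^+ 2.
  apply: le_trans (noise_quad_le _ _) _; rewrite ler_wpM2r//.
  by rewrite sumr_ge0// => o _; rewrite sqr_ge0.
have eL : 16 * (L2 x ^+ 2 * D * e) <= kappa B ^+ 2.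
  by rewrite le_eqVlt; apply/orP; left; apply/eqP; rewrite /e; field; rewrite !gt_eqF.
have Ql : 16 * (5 * l) < 9 * (kappa B ^+ 2 * (lam * e)).
  apply: (@lt_le_trans _ _ (144 * (D ^+ 2 + l))).
    have D2 : 0 <= D ^+ 2 := sqr_ge0 _; lra.
  have p0 : 0 <= 9 * (kappa B ^+ 2 * e) by rewrite mulr_ge0// mulr_ge0 ?sqr_ge0// ltW.
  have := ler_wpM2r p0 lamge.
  have -> : 256 * D * L2 x ^+ 2 / kappa B ^+ 4 * (D ^+ 2 + l) * (9 * (kappa B ^+ 2 * e)) =
     144 * (D ^+ 2 + l) by rewrite /e; field; rewrite !gt_eqF.
  lra.
have hL z : `|derive1 (derive1 (link B x)) z| <= L2 x by case: (b12 z).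
have Vpos (o : observation G) := dotv_parv_weight_ge0 o.2 xr.
have dV (o : observation G) := kappa_le o.2 xr.
have VD (o : observation G) := dotv_parv_le x o.2.
split.
  exact: (score_root_exists d1 d2 hL k0 e0 Q0 (ltW Dp) Vpos dV VD gramge noiseQ eL Ql).
move=> th sc0.
have := score_root_close (@link_homo _ _ B _ xr) d1 d2 hL k0 e0 Q0 dV VD gramge noiseQ eL Ql sc0.
rewrite mxnorm_gram; set N := \sum_(o <- h | _) _ => N1.
set N2 := \sum_(o <- h | _) _.
have -> : N2 = N.
  by apply: eq_bigr => o _; rewrite -opprB -scaleN1r dotvZr mulN1r sqrrN.
rewrite -(ler_pXn2r (_ : (0 < 2)%N)) ?nnegrE ?sqrtr_ge0//; last first.
  by rewrite mulr_ge0 ?sqrtr_ge0// divr_ge0// ltW.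
have N0 : 0 <= N by rewrite sumr_ge0// => o _; rewrite sqr_ge0.
rewrite exprMn !sqr_sqrtr//; last exact: ltW.
rewrite expr_div_n mulrAC ler_pdivlMr ?exprn_gt0// mulrC.
lra.
Qed.
End Smooth.

End Confidence.

(** * Excitation in the initial rounds *)

Section Width.
Variables (R : realType) (G : causal_graph).
Implicit Types (A : {set node G}) (x : node G) (h : seq (observation G)).

(** Both points are within r of c, so N_A z^2 <= 4 r^2 for the projection z of a - b. The cap 1
    contributes the extra 1, which turns N_A into N_A + 1 and covers unseen configurations. *)
Lemma confidence_width h x A (a b c : 'cV[R]_#|par x|) (L r : R) :
  0 <= L -> 0 <= r -> mxnorm (gram R h x) (a - c) <= r -> mxnorm (gram R h x) (b - c) <= r ->
  Num.min 1 (L * `|dotv (a - b) (parent_vector R x A)|) <=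
  (2 * L * r + 1) / Num.sqrt (parent_count R x A h + 1).
Proof.
move=> L0 r0; rewrite !mxnorm_gram.
set N := fun u : 'cV[R]_#|par x| => \sum_(o <- h | x \notin o.1) dotv (parv x o.2) u ^+ 2.
rewrite -/(N (a - c)) -/(N (b - c)) => Na Nb.
have N0 u : 0 <= N u by rewrite sumr_ge0// => o _; rewrite sqr_ge0.
have sq u : Num.sqrt (N u) <= r -> N u <= r ^+ 2.
  move=> H; rewrite -(sqr_sqrtr (N0 u)) ler_pXn2r ?nnegrE//; exact: sqrtr_ge0.
have Nab : N (a - b) <= 2 * N (a - c) + 2 * N (b - c).
  rewrite /N !mulr_sumr -big_split/=; apply: ler_sum => o _.
  rewrite !dotvBr; move: (dotv _ a) (dotv _ b) (dotv _ c) => p q s.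
  have := sqr_ge0 (p + q - 2 * s); nra.
set z := dotv (a - b) (parent_vector R x A).
set k := parent_count R x A h; have k0 : 0 <= k by exact: parent_count_ge0.
have kz : k * z ^+ 2 <= 4 * r ^+ 2.
  apply: (@le_trans _ _ (N (a - b))); last by have := sq _ Na; have := sq _ Nb; lra.
  rewrite /N gram_quad_parents (bigD1 A)//= /z (dotvC (a - b)) lerDl.
  by rewrite sumr_ge0// => A' _; rewrite mulr_ge0 ?sqr_ge0//; exact: parent_count_ge0.
set m := Num.min _ _.
have m0 : 0 <= m by rewrite le_min ler01 mulr_ge0.
have m1 : m <= 1 by rewrite ge_min lexx.
have mz : m <= L * `|z| by rewrite ge_min lexx orbT.
have s0 : 0 < Num.sqrt (k + 1) by rewrite sqrtr_gt0; lra.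
rewrite ler_pdivlMr//.
rewrite -(ler_pXn2r (_ : (0 < 2)%N)) ?nnegrE//; last 2 first.
- by rewrite mulr_ge0// ltW.
- by rewrite addr_ge0// !mulr_ge0.
rewrite exprMn sqr_sqrtr; last by lra.
have h1 : m ^+ 2 <= 1 by rewrite expr_le1.
have h2 : m ^+ 2 <= L ^+ 2 * z ^+ 2.
  rewrite -(real_normK (num_real z)) -exprMn ler_pXn2r ?nnegrE//; exact: mulr_ge0.
have h3 : m ^+ 2 * k <= L ^+ 2 * z ^+ 2 * k by rewrite ler_wpM2r.
have h4 : L ^+ 2 * (k * z ^+ 2) <= L ^+ 2 * (4 * r ^+ 2) by rewrite ler_wpM2l ?sqr_ge0.
have h5 : 0 <= L * r by rewrite mulr_ge0.
have -> : (2 * L * r + 1) ^+ 2 = L ^+ 2 * (4 * r ^+ 2) + 4 * (L * r) + 1 by ring.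
nra.
Qed.
End Width.

Section Excitation.
Variables (R : realType) (G : causal_graph) (B : bglm R G).
Context d (Omega : measurableType d) (P : probability Omega R).
Variables (eps gam : nat -> node G -> {RV P >-> R}).
Hypothesis noise : bglm_noise B eps gam.
Implicit Types (S A : {set node G}) (v : valuation G) (x y : node G).

Local Notation e := (node_noise eps).
Local Notation g := (node_noise gam).
Local Notation out := (round_outcome B eps gam).

Lemma cond_prob_le (E F : set Omega) (z : R) : measurable E -> measurable F ->
  z <= cond_prob P E F -> z * pr P F <= pr P (E `&` F).
Proof.
move=> mE mF; rewrite /cond_prob -/(pr P _) -/(pr P _) => H.
have [F0|F0] := eqVneq (pr P F) 0; first by rewrite F0 mulr0 pr_ge0.
by rewrite -ler_pdivlMr// lt_neqAle eq_sym F0 pr_ge0.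
Qed.

Lemma cond_prob_le1 (E F : set Omega) : measurable E -> measurable F -> cond_prob P E F <= 1.
Proof.
move=> mE mF; rewrite /cond_prob -/(pr P _) -/(pr P _).
have [F0|F0] := eqVneq (pr P F) 0; first by rewrite F0 invr0 mulr0 ler01.
have F1 : 0 < pr P F by rewrite lt_neqAle eq_sym F0 pr_ge0.
by rewrite ler_pdivrMr// mul1r le_pr//; exact: measurableI.
Qed.

Definition other_parents x x' v : {set node G} :=
  [set y in par x | (y != x') && (y != Defs.root G) && v y]%SET.

Lemma other_parentsP x x' A (w : Omega) :
  A \subset [set y in par x | (y != x') && (y != Defs.root G)]%SET ->
  (forall y, y \in par x -> y != x' -> y != Defs.root G ->
     out 0 finset.set0 (weight B) w y = (y \in A)) <->
  other_parents x x' (out 0 finset.set0 (weight B) w) = A.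
Proof.
move=> /fintype.subsetP sA; split=> [H|<- y yx yx' yr]; last first.
  by rewrite inE yx yx' yr.
apply/setP => y; rewrite inE.
have [/andP[yx /andP[yx' yr]]|ny] := boolP ((y \in par x) && ((y != x') && (y != Defs.root G))).
  by rewrite yx yx' yr/= H.
rewrite andbA (negbTE ny)/=; apply/esym/negbTE; apply: contra ny => /sA.
by rewrite inE.
Qed.

(** Condition on the parents of [x] other than [x'] and the root: whichever value [b] prescribes for
    [x'] has conditional probability at least zeta, and averaging preserves the bound. *)
Lemma pr_excited (zeta : R) x x' (b : {set node G} -> bool) (Q : pred (valuation G)) :
  parents_vary B eps gam zeta -> x != Defs.root G -> x' \in par x -> x' != Defs.root G ->
  (forall v, v x' = b (other_parents x x' v) -> v (Defs.root G) -> Q v) ->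
  zeta <= pr P [set w | Q (out 0 finset.set0 (weight B) w)].
Proof.
move=> [z0 vary] xr x'x x'r Qb.
pose O w := other_parents x x' (out 0 finset.set0 (weight B) w).
have mout (q : pred (valuation G)) : measurable [set w | q (out 0 finset.set0 (weight B) w)].
  exact: measurable_outcome_pred.
have mO A : measurable [set w | O w = A].
  rewrite (_ : [set w | _] = [set w | other_parents x x' (out 0 finset.set0 (weight B) w) == A]).
    exact: (mout (fun v => other_parents x x' v == A)).
  by apply/seteqP; split=> w /eqP.
rewrite (pr_partition P (mout Q) mO).
have -> : zeta = \sum_A zeta * pr P [set w | O w = A].
  rewrite -mulr_sumr; have := pr_partition P measurableT mO; rewrite prT => H.
  by under eq_bigr do rewrite -(setTI [set w | _]); rewrite -H mulr1.
apply: ler_sum => A _.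
have [sA|nsA] := boolP (A \subset [set y in par x | (y != x') && (y != Defs.root G)]%SET); last first.
  have -> : [set w | O w = A] = set0.
    rewrite -subset0 => w /= wA; case/negP: nsA; rewrite -wA; apply/fintype.subsetP => y.
    by rewrite !inE => /andP[-> /andP[-> _]].
  by rewrite pr0 mulr0 pr_ge0.
have := vary x x' [ffun y => y \in A] (b A) xr x'x x'r.
set E := [set w | _ = b A]; set F := [set w | forall y, _].
have FE : F = [set w | O w = A].
  apply/seteqP; split=> w.
    by move=> H; apply/(other_parentsP w sA) => y a1 a2 a3; rewrite H// ffunE.
  by move=> /(other_parentsP w sA) H y a1 a2 a3; rewrite H// ffunE.
have mE : measurable E.
  rewrite (_ : E = [set w | out 0 finset.set0 (weight B) w x' == b A]).
    exact: (mout (fun v => v x' == b A)).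
  by apply/seteqP; split=> w /eqP.
have mF : measurable F by rewrite FE.
move=> /(cond_prob_le mE mF); rewrite FE; move/le_trans; apply.
apply: le_pr; [exact: measurableI|exact: measurableI|].
move=> w [Ew Ow]; split=> //=; apply: Qb; last exact: outcome_root.
by rewrite -/(O w) Ow.
Qed.

(* If some coordinate of z other than the root's is large, flipping that parent
   moves the projection by more than twice the threshold, so for any values of
   the other parents one of its two values is good; otherwise the root coordinate
   dominates and the projection is always large. *)
Lemma pr_projection_ge (zeta : R) x (z : 'cV[R]_#|par x|) :
  parents_vary B eps gam zeta -> zeta <= 1 -> x != Defs.root G -> norm2 z = 1 ->
  zeta <= pr P [set w | Num.sqrt (2 * (4 * #|node G|%:R ^+ 2 - 8 * #|node G|%:R + 1))^-1
     < `|dotv (parv x (out 0 finset.set0 (weight B) w)) z|].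
Proof.
move=> vary z1 xr nz; set n : R := #|node G|%:R.
set al := (2 * _)^-1; set a := Num.sqrt al.
have rp : Defs.root G \in par x by rewrite inE edge_root.
have m0 : (0 < #|par x|)%N by apply/card_gt0P; exists (Defs.root G).
have mn : (#|par x| < #|node G|)%N.
  rewrite -cardsT; apply: proper_card; rewrite properT; apply/eqP => pT.
  have : x \in par x by rewrite pT inE.
  rewrite inE => xx; have : cycle (@edge G) [:: x] by rewrite /= xx.
  by move/edge_acyclic.
set m : R := #|par x|%:R.
have m1 : 1 <= m by rewrite ler1n.
have mn1 : m + 1 <= n by rewrite natr1 ler_nat.
have al0 : 0 < al by rewrite invr_gt0 mulr_gt0//; nra.
(* A node is not its own parent, so m <= n - 1 and 4 m^2 - 3 <= 4 n^2 - 8 n + 1 = 1 / (2 al). The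
   quantity 4 m^2 - 3 is (2 m - 1)^2 + 4 (m - 1), as needed for [zra]. *)
have alm : al * (4 * m ^+ 2 - 3) < 1.
  rewrite /al mulrC ltr_pdivrMr ?mul1r; nra.
have a0 : 0 <= a := sqrtr_ge0 _.
have a2 : a ^+ 2 = al by rewrite sqr_sqrtr// ltW.
have zz : \sum_i z i 0 ^+ 2 = 1.
  have : dotv z z = 1.
    by rewrite -(sqr_sqrtr (dotv_ge0 z)) -/(norm2 z) nz expr1n.
  by rewrite dotvE => <-; apply: eq_bigr => i _; rewrite expr2.
have [[i [ir zi]]|small] := pselect (exists i, enum_val i != Defs.root G /\ 4 * al < z i 0 ^+ 2).
  set x' := enum_val i in ir; have x'x : x' \in par x by exact: enum_valP.
  pose oth (A : {set node G}) := \sum_(j < #|par x| | j != i)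
     ((enum_val j \in A) || (enum_val j == Defs.root G))%:R * z j 0.
  apply: (@pr_excited zeta x x' (fun A => `|oth A| <= a)
     (fun v => a < `|dotv (parv x v) z|)) => // v vx' vr.
  have E : dotv (parv x v) z = oth (other_parents x x' v) + (v x')%:R * z i 0.
    rewrite dotvE (bigD1 i)//= mxE -/x' addrC; congr (_ + _).
    apply: eq_bigr => j ji; rewrite mxE; congr (_%:R * _); congr nat_of_bool.
    rewrite inE enum_valP/= /x' (inj_eq enum_val_inj) ji/=.
    by case: (eqVneq (enum_val j) (Defs.root G)) => [->|_]/=; rewrite ?vr ?orbF.
  rewrite E vx'; move: (oth _) => s.
  have zi2 : 2 * a < `|z i 0|.
    rewrite -(ltr_pXn2r (_ : (0 < 2)%N)) ?nnegrE ?mulr_ge0//.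
    by rewrite real_normK ?num_real// exprMn a2; lra.
  have [sa|sa] := lerP `|s| a; last by rewrite mul0r addr0.
  rewrite mul1r.
  have := ler_normB (s + z i 0) s; rewrite addrAC subrr add0r; lra.
rewrite (_ : [set w | _] = setT) ?prT//; apply/seteqP; split => // w _ /=.
set v := out _ _ _ w; have vr : v (Defs.root G) by exact: outcome_root.
pose r := enum_rank_in rp (Defs.root G).
have rE : enum_val r = Defs.root G by rewrite enum_rankK_in.
have notr j : j != r -> enum_val j != Defs.root G.
  by apply: contra => /eqP jr; apply/eqP/enum_val_inj; rewrite jr rE.
have zj j : j != r -> `|z j 0| <= 2 * a.
  move=> jr; rewrite -(ler_pXn2r (_ : (0 < 2)%N)) ?nnegrE ?mulr_ge0//.
  rewrite real_normK ?num_real// exprMn a2 leNgt; apply/negP => H.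
  by apply: small; exists j; rewrite notr//; split=> //; lra.
have cardr (c : R) : \sum_(j < #|par x| | j != r) c = (m - 1) * c.
  have : \sum_(j < #|par x|) c = m * c by rewrite sumr_const card_ord mulr_natl.
  rewrite (bigD1 r)//=; lra.
have zr : 1 - 4 * al * (m - 1) <= z r 0 ^+ 2.
  have zz' : z r 0 ^+ 2 + \sum_(j < #|par x| | j != r) z j 0 ^+ 2 = 1.
    by rewrite -[RHS]zz [RHS](bigD1 r).
  have : \sum_(j < #|par x| | j != r) z j 0 ^+ 2 <= \sum_(j < #|par x| | j != r) (4 * al).
    apply: ler_sum => j jr; rewrite -(real_normK (num_real (z j 0))) -a2.
    have -> : 4 * a ^+ 2 = (2 * a) ^+ 2 by ring.
    by rewrite ler_pXn2r ?nnegrE ?mulr_ge0// zj.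
  rewrite cardr; lra.
(* The other m - 1 coordinates can cancel at most 2 a each, so more than a is left. *)
have zra : (2 * m - 1) * a < `|z r 0|.
  rewrite -(ltr_pXn2r (_ : (0 < 2)%N)) ?nnegrE ?mulr_ge0//; last by lra.
  rewrite real_normK ?num_real// exprMn a2; apply: lt_le_trans zr.
  nra.
have := ler_normB (dotv (parv x v) z) (\sum_(j < #|par x| | j != r) (v (enum_val j))%:R * z j 0).
have -> : dotv (parv x v) z - \sum_(j < #|par x| | j != r) (v (enum_val j))%:R * z j 0 = z r 0.
  rewrite dotvE (bigD1 r)//= mxE rE vr mul1r.
  under eq_bigr do rewrite mxE.
  by rewrite addrK.
have : `|\sum_(j < #|par x| | j != r) (v (enum_val j))%:R * z j 0| <= (m - 1) * (2 * a).
  apply: le_trans (ler_norm_sum _ _ _) _; rewrite -cardr; apply: ler_sum => j jr.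
  rewrite normrM; case: (v _); rewrite ?normr1 ?mul1r ?normr0 ?mul0r ?mulr_ge0//.
  exact: zj.
have := ltr0n R 2; lra.
Qed.
End Excitation.

(** * The Lecue-Mendelson inequality for the observed parents *)

Section LecueMendelson.
Variables (R : realType) (G : causal_graph) (B : bglm R G).
Context d (Omega : measurableType d) (P : probability Omega R).
Variables (eps gam : nat -> node G -> {RV P >-> R}).
Hypothesis noise : bglm_noise B eps gam.
Implicit Types (S A : {set node G}) (v : valuation G) (x y : node G).

Local Notation e := (node_noise eps).
Local Notation g := (node_noise gam).
Local Notation out := (round_outcome B eps gam).

(** As in [pr_history], the induction carries a cylinder over rounds outside [s], into which the
    outcome of the head round is merged. *)
Lemma pr_outcomes_indep S (s : seq nat) (Q : nat -> pred (valuation G)) : uniq s ->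
  pr P [set w | forall t, t \in s -> Q t (out t S (weight B) w)] =
  \prod_(t <- s) pr P [set w | Q t (out t S (weight B) w)].
Proof.
move=> us.
have mQ t : measurable [set w | Q t (out t S (weight B) w)] by exact: measurable_outcome_pred.
have allE t s' : [set w | forall j, j \in t :: s' -> Q j (out j S (weight B) w)] =
    [set w | forall j, j \in s' -> Q j (out j S (weight B) w)] `&`
    [set w | Q t (out t S (weight B) w)].
  apply/seteqP; split=> [w H|w [H Ht] j].
    by split=> [j js|]; apply: H; rewrite inE ?eqxx ?js ?orbT.
  by rewrite inE => /orP[/eqP ->|/H].
suff H (r : seq (nat * node G)) C : uniq r -> {in r, forall i, i.1 \notin s} ->
    (forall i, measurable (C i)) ->
    measurable [set w | forall t, t \in s -> Q t (out t S (weight B) w)] /\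
    pr P ([set w | forall t, t \in s -> Q t (out t S (weight B) w)] `&` cylinder e g r C) =
    (\prod_(t <- s) pr P [set w | Q t (out t S (weight B) w)]) * pr P (cylinder e g r C).
  have [] // := H [::] (fun=> setT) => _.
  by rewrite cylinder_nil setIT prT mulr1.
elim: s us r C => [_|t s IH /andP[ts us]] r C ur rs mC.
  rewrite big_nil mul1r.
  have -> : [set w | forall t, t \in [::] -> Q t (out t S (weight B) w)] = setT.
    by apply/seteqP; split.
  by rewrite setTI.
have [ms _] := IH us [::] (fun=> setT) isT (fun i (k : i \in [::]) => False_ind _ (notF k)) (fun=> measurableT).
have rs' : {in r, forall i, i.1 \notin s}.
  by move=> i /rs; rewrite inE negb_or => /andP[].
have mcyl : measurable (cylinder e g r C) by exact: measurable_cylinder.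
rewrite allE; split; first exact: measurableI.
rewrite -setIA [_ `&` cylinder _ _ _ _]setIC setIA big_cons.
have mo := measurable_outcome (P := P) B eps gam t S (weight B).
rewrite (pr_fin P (Q t) (measurableI _ _ ms mcyl) mo).
have -> : pr P [set w | Q t (out t S (weight B) w)] =
    \sum_(v | Q t v) pr P [set w | out t S (weight B) w = v].
  by rewrite -(setTI [set w | Q t _]) pr_fin//; apply: eq_bigr => v _; rewrite setTI.
rewrite !mulr_suml; apply: eq_bigr => v _.
pose N (j : nat * node G) := if j.1 == t then node_event B S (weight B) v j.2 else C j.
have NC : cylinder e g r N = cylinder e g r C.
  apply: eq_cylinder => j /rs; rewrite /N; case: eqP => // ->.
  by rewrite mem_head.
have NO : cylinder e g (round G t) N = [set w | out t S (weight B) w = v].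
  by rewrite outcome_cylinder; apply: eq_cylinder => _ /mapP[x _ ->]; rewrite /N eqxx.
rewrite -setIA -NC -NO -cylinder_cat.
have mN i : measurable (N i) by rewrite /N; case: ifP => // _; exact: measurable_node_event.
have ucat : uniq (r ++ round G t).
  rewrite cat_uniq ur round_uniq andbT/=; apply/hasPn => _ /mapP[x _ ->].
  by apply/negP => /rs /=; rewrite mem_head.
have [||| _ ->] // := IH us (r ++ round G t) N.
  move=> j; rewrite mem_cat => /orP[/rs'//|/mapP[x _ ->]//].
rewrite cylinder_cat pr_cylinder_indep//; last exact: eg_indep noise.
by rewrite mulrCA mulrA [RHS]mulrC mulrA mulrAC mulrC.
Qed.

Definition parent_tuple x v : #|par x|.-tuple R := [tuple (v (enum_val j))%:R | j < #|par x|].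

Lemma col_parent_tuple x v : col_of_tuple (parent_tuple x v) = parv x v.
Proof. by apply/colP => i; rewrite !mxE tnth_mktuple. Qed.

Definition observed_parents x t (w : Omega) : #|par x|.-tuple R :=
  parent_tuple x (out t finset.set0 (weight B) w).

Lemma measurable_observed_parents x t : measurable_fun setT (observed_parents x t).
Proof.
move=> _ Y mY; rewrite setTI.
rewrite (_ : _ @^-1` Y = [set w | `[< Y (parent_tuple x (out t finset.set0 (weight B) w)) >]]).
  exact: (measurable_outcome_pred (P := P) B eps gam t finset.set0 (weight B) (fun v => `[< Y (parent_tuple x v) >])).
by apply/seteqP; split=> w /asboolP.
Qed.

HB.instance Definition _ x t :=
  isMeasurableFun.Build _ _ _ _ (observed_parents x t) (@measurable_observed_parents x t).

(** The alpha of the Lecue-Mendelson inequality, with beta = zeta by [pr_projection_ge]. Its inverse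
    is the factor 8 n^2 - 16 n + 2 of [init_rounds]. *)
Definition excitation : R := (2 * (4 * #|node G|%:R ^+ 2 - 8 * #|node G|%:R + 1))^-1.

Lemma lecue_mendelson_parents (c zeta : R) x (k : nat) :
  lecue_mendelson c -> parents_vary B eps gam zeta -> zeta <= 1 -> x != Defs.root G ->
  c * #|par x|%:R / zeta ^+ 2 <= k%:R ->
  (P [set w | lambda_min (k%:R^-1 *: \sum_(i < k)
      (parv x (out i.+1 finset.set0 (weight B) w) *m
      (parv x (out i.+1 finset.set0 (weight B) w))^T)) <= excitation * zeta / 2]%R
    <= (expR (- (k%:R * zeta ^+ 2 / c)))%:E)%E.
Proof.
move=> LM vary z1 xr kge; set al := excitation.
have z0 : 0 < zeta by case: vary.
have m0 : (0 < #|par x|)%N.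
  by apply/card_gt0P; exists (Defs.root G); rewrite inE edge_root.
pose V (i : 'I_k) : {RV P >-> #|par x|.-tuple R} := observed_parents x i.+1.
have mV (i : 'I_k) (Y : set (#|par x|.-tuple R)) : measurable Y ->
    [set w | `[< Y (parent_tuple x (out i.+1 finset.set0 (weight B) w)) >]] = V i @^-1` Y.
  by move=> mY; apply/seteqP; split=> w /asboolP.
have n2 : 2 <= #|node G|%:R :> R.
  rewrite ler_nat -[2%N](_ : #|[set Defs.root G; x]%SET| = 2%N) ?max_card//.
  by rewrite cards2 eq_sym xr.
have al0 : 0 <= al by rewrite /al /excitation invr_ge0 mulr_ge0//; nra.
have := LM _ Omega P _ k V al zeta m0 _ _ al0 _ _ kge.
under eq_set do under eq_bigr do rewrite !col_parent_tuple.
apply.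
- move=> s Y us mY.
  (* Position i of the sample is round i + 1; [insub] of the predecessor recovers the position from
     the round. *)
  pose Q (t : nat) v := if insub t.-1 is Some i then `[< Y i (parent_tuple x v) >] else true.
  have QE (i : 'I_k) : Q i.+1 = fun v => `[< Y i (parent_tuple x v) >].
    by rewrite /Q /= valK.
  have us' : uniq [seq (i : 'I_k).+1 | i <- s].
    by rewrite map_inj_uniq// => i j [/val_inj].
  have := @pr_outcomes_indep finset.set0 _ Q us'.
  rewrite big_map => H.
  have mQ i : measurable (V i @^-1` Y i) by rewrite -[X in measurable X]setTI; exact: measurable_observed_parents.
  have E : \bigcap_(i in [set` s]) V i @^-1` Y i =
      [set w | forall t, t \in [seq (i : 'I_k).+1 | i <- s] -> Q t (out t finset.set0 (weight B) w)].
    apply/seteqP; split=> [w Hw _ /mapP[i js ->]|w Hw i /= js].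
      by rewrite QE; apply/asboolP; exact: (Hw i).
    by have := Hw _ (map_f (fun i : 'I_k => i.+1) js); rewrite QE => /asboolP.
  have mE : measurable (\bigcap_(i in [set` s]) V i @^-1` Y i).
    by apply: fin_bigcap_measurable.
  rewrite (prE P mE) E H -prodEFin; apply: eq_bigr => i _.
  by rewrite (prE P (mQ i)) -mV// QE.
- move=> i j Y mY.
  have mQ i' : measurable (V i' @^-1` Y) by rewrite -[X in measurable X]setTI; exact: measurable_observed_parents.
  rewrite !(prE P (mQ _)) -!mV//.
  by rewrite !(pr_outcome_pred noise _ finset.set0 (fun v => `[< Y (parent_tuple x v) >])).
- by rewrite z0.
- move=> i z nz.
  pose Qz v := Num.sqrt al < `|dotv (parv x v) z|.
  have mQz : measurable [set w | Qz (out i.+1 finset.set0 (weight B) w)] by exact: measurable_outcome_pred.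
  have -> : [set w | Num.sqrt al < `|dotv (col_of_tuple (V i w)) z|] =
      [set w | Qz (out i.+1 finset.set0 (weight B) w)].
    by apply/seteqP; split=> w /=; rewrite /V /observed_parents/= col_parent_tuple.
  rewrite (prE P mQz) lee_fin (pr_outcome_pred noise) -(pr_outcome_pred noise 0).
  exact: pr_projection_ge.
Qed.

End LecueMendelson.

Section Ceiling.
Variable R : realType.

Lemma le_ceiln (x : R) : x <= (ceiln x)%:R.
Proof.
by rewrite /ceiln natr_absz (le_trans (ceil_ge x))// ler_int ler_norm.
Qed.

Lemma ceiln_le (x : R) : 0 <= x -> (ceiln x)%:R <= x + 1.
Proof.
move=> x0; rewrite /ceiln natr_absz ger0_norm; last by rewrite ceil_ge0; lra.
have : (Num.ceil x - 1)%:~R < x by rewrite -ceil_gt_int ltrBlDr ltrDl.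
rewrite intrB; lra.
Qed.
End Ceiling.

Section Exploration.
Variables (R : realType) (G : causal_graph) (B : bglm R G).
Context d (Omega : measurableType d) (P : probability Omega R).
Variables (eps gam : nat -> node G -> {RV P >-> R}).
Variables (zeta c l : R) (k : nat) (pi : policy G).
Hypothesis noise : bglm_noise B eps gam.
Hypothesis vary : parents_vary B eps gam zeta.
Hypothesis explore : forall h, (size h < k)%N -> pi h = finset.set0.
Implicit Types (x y : node G) (h : seq (observation G)).

Local Notation out := (round_outcome B eps gam).
Local Notation hist := (history B eps gam pi).
Local Notation hexp := (hexp B eps gam pi).

Lemma size_history w t : size (hist w t) = t.
Proof. by elim: t => //= t IH; rewrite size_rcons IH. Qed.

Lemma take_history w s t : (s <= t)%N -> take s (hist w t) = hist w s.
Proof.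
elim: t => [|t IH]; first by rewrite leqn0 => /eqP ->.
rewrite leq_eqVlt => /predU1P[->|]; first by rewrite take_oversize// size_history.
rewrite ltnS => st; rewrite /= -cats1 take_cat size_history.
have [lt|ge] := ltnP s t; first exact: IH (ltnW lt).
have -> : s = t by apply/eqP; rewrite eqn_leq st ge.
by rewrite subnn take0 cats0.
Qed.

Lemma initial_history w j : (j <= k)%N ->
  hist w j = [seq (finset.set0, out i.+1 finset.set0 (weight B) w) | i <- iota 0 j].
Proof.
elim: j => [//|j IH] jk; have hj := IH (ltnW jk).
have piE : pi (hist w j) = finset.set0 by apply: explore; rewrite size_history.
by rewrite -addn1 iotaD map_cat add0n /= -hj cats1 addn1 /= piE.
Qed.

(** Looks only at the first [k] observations: the event is settled after round [k], and later
    observations can only increase the quadratic form. *)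
Definition poorly_excited x h : bool :=
  ~~ `[< forall u : 'cV[R]_#|par x|,
     k%:R * (excitation R G * zeta / 2) * dotv u u <=
     \sum_(o <- take k h | x \notin o.1) dotv (parv x o.2) u ^+ 2 >].

(** The length k >= c l / zeta^2 does two jobs: it turns the Lecue-Mendelson bound into exp(-l) and,
    as D <= l, it meets the sample size requirement c |par x| / zeta^2. *)
Lemma poorly_excited_le x t : lecue_mendelson c -> 0 < c -> zeta <= 1 ->
  (maxdeg G)%:R <= l -> 0 < l -> c / zeta ^+ 2 * l <= k%:R ->
  x != Defs.root G -> (k <= t)%N ->
  hexp t (fun h => (poorly_excited x h)%:R) <= expR (- l).
Proof.
move=> LM c0 z1 Dl l0 kl xr kt.
have z0 : 0 < zeta by case: vary.
have z2 : 0 < zeta ^+ 2 by rewrite exprn_gt0.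
have kp : 0 < k%:R :> R by apply: lt_le_trans kl; rewrite !mulr_gt0// invr_gt0.
have kge : c * #|par x|%:R / zeta ^+ 2 <= k%:R.
  apply: le_trans kl; rewrite mulrAC ler_wpM2l//; first by rewrite divr_ge0// ltW.
  by apply: (@le_trans _ _ (maxdeg G)%:R) => //; rewrite ler_nat leq_maxdeg.
have := lecue_mendelson_parents noise LM vary z1 xr kge.
set E := [set w | _] => PE.
have gramE w : gram R (hist w k) x = \sum_(i < k)
    (parv x (out i.+1 finset.set0 (weight B) w) *m (parv x (out i.+1 finset.set0 (weight B) w))^T).
  rewrite initial_history// /gram big_map; under eq_bigl do rewrite /= inE.
  by rewrite -(big_mkord xpredT (fun i => parv x (out i.+1 finset.set0 (weight B) w) *m
    (parv x (out i.+1 finset.set0 (weight B) w))^T)) /index_iota subn0.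
have EE : E = [set w | lambda_min (k%:R^-1 *: gram R (hist w k) x) <= excitation R G * zeta / 2].
  by rewrite /E; apply/seteqP; split=> w /=; rewrite gramE.
have mE : measurable E.
  rewrite EE; exact: (measurable_history noise pi k
    (fun h => lambda_min (k%:R^-1 *: gram R h x) <= excitation R G * zeta / 2)).
have prEle : pr P E <= expR (- l).
  rewrite -lee_fin -(prE P mE); apply: le_trans PE _; rewrite lee_fin ler_expR lerN2.
  rewrite (ler_pdivlMr _ _ c0); have := ler_wpM2r (ltW z2) kl.
  rewrite mulrAC (divfK (lt0r_neq0 z2)) mulrC; exact.
apply: le_trans prEle; rewrite -(pr_historyE noise).
apply: le_pr mE _; first exact: (measurable_history noise pi t (poorly_excited x)).
rewrite EE => w /=; rewrite /poorly_excited (take_history _ kt); apply: contraNT.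
rewrite -ltNge => lm; apply/asboolP => u.
have sM : (k%:R^-1 *: gram R (hist w k) x)^T = k%:R^-1 *: gram R (hist w k) x.
  rewrite linearZ/= /gram linear_sum/=; congr (_ *: _); apply: eq_bigr => o _.
  by rewrite trmx_mul trmxK.
have := lambda_min_le_quad u sM; rewrite /quad -scalemxAr -scalemxAl mxE gram_quad => H.
rewrite -mulrA -(ler_pdivlMl _ _ kp); apply: le_trans H.
exact: ler_wpM2r (dotv_ge0 u) _ _ (ltW lm).
Qed.

End Exploration.

(** * Regret decomposition *)

Section RegretDecomposition.
Variables (R : realType) (G : causal_graph) (B : bglm R G).
Context d (Omega : measurableType d) (P : probability Omega R).
Variables (eps gam : nat -> node G -> {RV P >-> R}).
Variables (zeta c l : R) (k T J : nat) (Sopt : {set node G}) (pi : policy G).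
Variables (width : node G -> R).
Hypothesis noise : bglm_noise B eps gam.
Implicit Types (S A : {set node G}) (v : valuation G) (x y : node G) (h : seq (observation G)).

Local Notation hexp := (hexp B eps gam pi).
Local Notation sig S := (sigma B eps gam S (weight B)).
Local Notation bad := (poorly_excited zeta k).
Local Notation card_grid := #|{ffun {set node G} -> option (bool * 'I_J.+1)}|.

Definition round_width x h : R := (x \notin pi h)%:R *
  \sum_A parents_law B eps gam (pi h) x A / Num.sqrt (parent_count R x A h + 1).

Hypothesis width_ge0 : forall x, x != Defs.root G -> 0 <= width x.
Hypothesis confident : forall t h, reachable pi t h -> (k <= t < T)%N ->
  (forall x, x != Defs.root G -> ~~ bad x h) ->
  (forall x, x != Defs.root G -> chi2 B x h <= 5 * l) ->
  sig Sopt - sig (pi h) <= \sum_(x | x != Defs.root G) width x * round_width x h.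
Hypothesis bad_le : forall x t, x != Defs.root G -> (k <= t)%N ->
  hexp t (fun h => (bad x h)%:R) <= expR (- l).
Hypothesis TJ : T%:R <= 4 ^+ J :> R.

Lemma round_width_ge0 x h : 0 <= round_width x h.
Proof.
rewrite mulr_ge0// sumr_ge0// => A _.
by rewrite mulr_ge0 ?parents_law_ge0// invr_ge0 sqrtr_ge0.
Qed.

Lemma gap_le1 S : sig Sopt - sig S <= 1.
Proof.
have /andP[_ h1] := sigma_itv B eps gam Sopt (weight B).
have /andP[h0 _] := sigma_itv B eps gam S (weight B).
lra.
Qed.

Let summand t x h : R :=
  (k <= t)%:R * (bad x h)%:R + (5 * l < chi2 B x h)%R%:R + width x * round_width x h.

Let summand_ge0 t x h : x != Defs.root G -> 0 <= summand t x h.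
Proof.
move=> xr; apply: addr_ge0; last by apply: mulr_ge0; [exact: width_ge0|exact: round_width_ge0].
by apply: addr_ge0; [apply: mulr_ge0|]; exact: ler0n.
Qed.

(** A gap is at most 1, so an initial round or a failure at some node is charged in full to its
    indicator; otherwise [confident] applies. *)
Lemma gap_le_summand t h : reachable pi t h -> (t < T)%N ->
  sig Sopt - sig (pi h) <= (t < k)%:R + \sum_(x | x != Defs.root G) summand t x h.
Proof.
move=> rh tT.
have sum0 : 0 <= \sum_(x | x != Defs.root G) summand t x h.
  by apply: sumr_ge0 => x; exact: summand_ge0.
have [tk|kt] := ltnP t k.
  by apply: le_trans (gap_le1 _) _; rewrite lerDl.
rewrite add0r.
have ge1 x : x != Defs.root G -> bad x h || (5 * l < chi2 B x h) ->
    1 <= \sum_(x | x != Defs.root G) summand t x h.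
  move=> xr bx; rewrite (bigD1 x)//=.
  have rest : 0 <= \sum_(i | (i != Defs.root G) && (i != x)) summand t i h.
    by apply: sumr_ge0 => y /andP[yr _]; exact: summand_ge0.
  suff : 1 <= summand t x h by lra.
  have w0 : 0 <= width x * round_width x h.
    by apply: mulr_ge0; [exact: width_ge0|exact: round_width_ge0].
  rewrite /summand kt; move: bx.
  by case: (bad x h); case: (5 * l < chi2 B x h) => //= _; lra.
have [[x [xr bx]]|allgood] :=
    pselect (exists x, x != Defs.root G /\ bad x h || (5 * l < chi2 B x h)).
  by apply: le_trans (ge1 x xr bx); exact: gap_le1.
have good x : x != Defs.root G -> ~~ bad x h /\ chi2 B x h <= 5 * l.
  move=> xr; have : ~~ (bad x h || (5 * l < chi2 B x h)).
    by apply/negP => H; apply: allgood; exists x.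
  by rewrite negb_or -leNgt => /andP.
apply: le_trans (confident rh _ _ _) _.
- by rewrite kt.
- by move=> x /good[].
- by move=> x /good[].
apply: ler_sum => x xr; rewrite /summand lerDr.
by apply: addr_ge0; [apply: mulr_ge0|]; exact: ler0n.
Qed.

Lemma hexp_gap_le t : (t < T)%N ->
  hexp t (fun h => sig Sopt - sig (pi h)) <=
  (t < k)%:R + \sum_(x | x != Defs.root G)
    (expR (- l) + card_grid%:R * expR (- (7 / 32 * (5 * l - #|{set node G}|%:R))) +
     width x * hexp t (round_width x)).
Proof.
move=> tT.
apply: (@le_trans _ _ (hexp t (fun h =>
    (t < k)%:R + \sum_(x | x != Defs.root G) summand t x h))).
  by apply: le_hexp => h rh; exact: gap_le_summand.
rewrite hexpD (hexp_cst noise) lerD2l hexp_sum; apply: ler_sum => x xr.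
rewrite hexpD hexpD !hexpZ lerD2r; apply: lerD.
  have [kt|tk] := leqP k t; last by rewrite mul0r expR_ge0.
  by rewrite mul1r; exact: bad_le.
apply: (chi2_tail noise) => //.
by apply: le_trans TJ; rewrite ler_nat ltnW.
Qed.

Lemma sum_lt_le : \sum_(t < T) (t < k)%:R <= k%:R :> R.
Proof.
rewrite -natr_sum ler_nat.
have -> : (\sum_(t < T) (t < k) = minn T k)%N.
  elim: T => [|n IH]; first by rewrite big_ord0 min0n.
  by rewrite big_ord_recr/= IH; case: (ltnP n k) => H; lia.
exact: geq_minr.
Qed.

Lemma regret_le : (regret B eps gam Sopt pi T <=
  (k%:R + \sum_(x | x != Defs.root G)
    (T%:R * expR (- l) +
     T%:R * (card_grid%:R * expR (- (7 / 32 * (5 * l - #|{set node G}|%:R)))) +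
     width x * (#|{set node G}|%:R * (2 * Num.sqrt T%:R))))%:E)%E.
Proof.
rewrite (regretE noise) lee_fin.
apply: (@le_trans _ _ (\sum_(t < T) ((t < k)%:R + \sum_(x | x != Defs.root G)
    (expR (- l) + card_grid%:R * expR (- (7 / 32 * (5 * l - #|{set node G}|%:R))) +
     width x * hexp t (round_width x))))).
  by apply: ler_sum => t _; exact: hexp_gap_le.
rewrite big_split/=; apply: lerD; first exact: sum_lt_le.
rewrite exchange_big/=; apply: ler_sum => x xr.
have cst (a : R) : \sum_(t < T) a = T%:R * a by rewrite sumr_const card_ord mulr_natl.
rewrite !big_split/= !cst; apply: lerD => //.
rewrite -mulr_sumr ler_wpM2l ?width_ge0//.
exact: (potential_bound noise).
Qed.

End RegretDecomposition.

(** * Asymptotics *)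

Section Asymptotics.
Variable R : realType.

Lemma expR_ge_pow (x : R) (k : nat) : 0 <= x -> (x / k.+1%:R) ^+ k.+1 <= expR x.
Proof.
move=> x0; have k0 : 0 < k.+1%:R :> R by rewrite ltr0n.
have -> : expR x = expR (x / k.+1%:R) ^+ k.+1.
  by rewrite -expRM_natl; congr expR; field; rewrite gt_eqF.
rewrite lerXn2r ?nnegrE ?expR_ge0 ?divr_ge0//.
by apply: le_trans (expR_ge1Dx _); rewrite lerDr.
Qed.

(** With n3 = 3 n and exp l = 3 n sqrt T, the second conclusion keeps the initial rounds below sqrt
    T, the third pays for the grid of tilts out of the surplus 3/32 l, and the last puts all
    remaining constants below l. *)
Lemma eventually_dominated (C E a1 a2 n3 : R) (M : nat) :
  0 <= C -> 0 <= E -> 0 <= a1 -> 0 <= a2 -> 0 <= n3 ->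
  exists l0 : R, forall l, l0 <= l ->
    [/\ 1 <= l, C * (1 + l) * n3 <= expR l,
        (4 * l + 7) ^+ M * E * expR (- (3 / 32 * l)) <= 3 &
        3 + a1 * Num.sqrt l + a2 <= l].
Proof.
move=> C0 E0 a10 a20 n30.
pose b : R := 3 / 32 / M.+1%:R.
have b0 : 0 < b by rewrite !divr_gt0// ltr0n.
have bM : 0 < 3 * b ^+ M.+1 by rewrite mulr_gt0// exprn_gt0.
pose q := 5 ^+ M * E / (3 * b ^+ M.+1).
have q0 : 0 <= q by rewrite divr_ge0 ?mulr_ge0 ?exprn_ge0// ltW.
have Cn : 0 <= C * n3 by exact: mulr_ge0.
(* 7 gives 4 l + 7 <= 5 l, 8 C n3 serves the second conclusion through exp l >= l^2 / 4, [q] the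
   third; the last uses 4 a1^2 for one half of l and 7 + 2 a2 for the other. *)
exists (7 + 8 * (C * n3) + q + 4 * a1 ^+ 2 + 2 * a2) => l ll.
have a12 : 0 <= a1 ^+ 2 by exact: sqr_ge0.
have l7 : 7 <= l by lra.
have l0 : 0 <= l by lra.
split.
- by lra.
- have := @expR_ge_pow l 1 l0; have -> : (l / 2%:R) ^+ 2 = l * (l / 4) by field.
  apply: le_trans; have : 8 * (C * n3) <= l by lra.
  move=> H; have := ler_wpM2l l0 H; nra.
- rewrite expRN ler_pdivrMr ?expR_gt0//.
  have l32 : 0 <= 3 / 32 * l by rewrite mulr_ge0.
  have := @expR_ge_pow (3 / 32 * l) M l32.
  have -> : 3 / 32 * l / M.+1%:R = b * l by rewrite /b mulrAC.
  move=> H; apply: (@le_trans _ _ (3 * (b * l) ^+ M.+1)); last by rewrite ler_pM2l.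
  apply: (@le_trans _ _ ((5 * l) ^+ M * E)).
    by rewrite ler_wpM2r//; apply: lerXn2r; rewrite ?nnegrE; lra.
  rewrite [(5 * l) ^+ M]exprMn [(b * l) ^+ M.+1]exprMn [l ^+ M.+1]exprS.
  have ql : q <= l by lra.
  have lM : 0 <= l ^+ M by rewrite exprn_ge0.
  move: ql; rewrite /q ler_pdivrMr// => /(ler_wpM2l lM).
  move: (b ^+ M.+1) (5 ^+ M) (l ^+ M) => u v w; lra.
- have s0 : 0 <= Num.sqrt l := sqrtr_ge0 _.
  have s2 : Num.sqrt l ^+ 2 = l by rewrite sqr_sqrtr.
  have h1 : 4 * a1 ^+ 2 <= Num.sqrt l ^+ 2 by lra.
  have h2 : 2 * a1 <= Num.sqrt l.
    rewrite -(ler_pXn2r (_ : (0 < 2)%N)) ?nnegrE ?mulr_ge0//.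
    by rewrite exprMn; apply: le_trans h1; rewrite le_eqVlt; apply/orP; left; apply/eqP; ring.
  have h3 := ler_wpM2r s0 h2.
  have : 3 + a2 <= l / 2 by lra.
  rewrite -expr2 s2 in h3; lra.
Qed.

Lemma expR1_le4 : expR 1 <= 4 :> R.
Proof.
have -> : expR 1 = expR (1 / 2) ^+ 2 :> R.
  by rewrite -expRM_natl; congr expR; field.
have h : expR (1 / 2) <= 2 :> R.
  apply: le_trans (expR_le_quadratic (lexx _)) _; lra.
have := expR_ge0 (1 / 2 : R); nra.
Qed.

Section Horizon.
Variables (n : R) (T : nat).
Hypotheses (n1 : 1 <= n) (T0 : (0 < T)%N).

Let s : R := Num.sqrt T%:R.
Let l := ln (3 * n * s).

Let n_gt0 : 0 < n.
Proof. exact: lt_le_trans n1. Qed.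

Let s_gt0 : 0 < s.
Proof. by rewrite sqrtr_gt0 ltr0n. Qed.

Lemma expR_log_horizon : expR l = 3 * n * s.
Proof.
rewrite lnK// posrE; apply: mulr_gt0 s_gt0.
by apply: mulr_gt0 => //; apply: lt_le_trans n1.
Qed.

Lemma log_horizonE : l = ln (3 * n) + ln T%:R / 2.
Proof.
have n3 : 0 < 3 * n by apply: mulr_gt0 => //; apply: lt_le_trans n1.
rewrite /l lnM ?posrE//; congr (_ + _).
have -> : (T%:R : R) = s * s by rewrite -expr2 sqr_sqrtr.
rewrite lnM ?posrE//; lra.
Qed.

(** sqrt T <= exp l <= 4^(ceil l), then square: a grid of depth logarithmic in T is fine enough for
    [dyadic_quadratic]. *)
Lemma horizon_le_pow : 0 <= l -> T%:R <= 4 ^+ (2 * ceiln l) :> R.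
Proof.
move=> l0; have -> : (T%:R : R) = s ^+ 2 by rewrite sqr_sqrtr.
rewrite mulnC exprM lerXn2r ?nnegrE ?exprn_ge0 ?(ltW s_gt0)//.
apply: (@le_trans _ _ (expR l)); first by rewrite expR_log_horizon ler_peMl ?(ltW s_gt0)//; have := n1; lra.
apply: (@le_trans _ _ (expR (ceiln l)%:R)); first by rewrite ler_expR le_ceiln.
rewrite -[_%:R]mulr1 expRM_natl lerXn2r ?nnegrE ?expR_ge0//.
exact: expR1_le4.
Qed.

Lemma horizon_exp_log : T%:R * expR (- l) = s / (3 * n).
Proof.
have n0 := n_gt0; have s0 := s_gt0; have nn1 := n1.
have Ts : T%:R = s ^+ 2 by rewrite sqr_sqrtr.
rewrite expRN expR_log_horizon Ts; move: (s) s0 => r r0.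
by field; rewrite !gt_eqF.
Qed.

(** In units of sqrt T: at most 1 from the initial rounds, at most 2 from the two kinds of failure
    over all nodes, and a1 sqrt l + a2 from the widths, in all at most l <= ln T. *)
Lemma horizon_total_le (I : finType) (Q : pred I) (k : nat) (C a1 a2 lam M : R)
    (W : I -> R) :
  #|Q|%:R <= n -> 0 <= lam ->
  k%:R <= C * (1 + l) ->
  C * (1 + l) * (3 * n) <= expR l ->
  lam * expR (7 / 32 * M) * expR (- (3 / 32 * l)) <= 3 ->
  3 + a1 * Num.sqrt l + a2 <= l -> l <= ln T%:R ->
  \sum_(x | Q x) W x <= (a1 * Num.sqrt l + a2) * s ->
  k%:R + \sum_(x | Q x) (T%:R * expR (- l) +
     T%:R * (lam * expR (- (7 / 32 * (5 * l - M)))) + W x) <= s * ln T%:R.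
Proof.
move=> Qn lam0 kC h1 h2 h3 lT hW.
have n0 := n_gt0; have s0 := s_gt0; have nn1 := n1.
have n30 : 0 < 3 * n by apply: mulr_gt0.
have ks : k%:R <= s.
  have : k%:R * (3 * n) <= 3 * n * s.
    by rewrite -expR_log_horizon; apply: le_trans h1; rewrite ler_wpM2r// ltW.
  by rewrite mulrC ler_pM2l.
have e1 : T%:R * (lam * expR (- (7 / 32 * (5 * l - M)))) <= s / n.
  have -> : - (7 / 32 * (5 * l - M)) = - l + (7 / 32 * M + - (3 / 32 * l)) by field.
  rewrite expRD expRD.
  have -> : T%:R * (lam * (expR (- l) * (expR (7 / 32 * M) * expR (- (3 / 32 * l))))) =
    (T%:R * expR (- l)) * (lam * expR (7 / 32 * M) * expR (- (3 / 32 * l))) by ring.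
  rewrite horizon_exp_log.
  have p0 : 0 <= s / (3 * n) by rewrite divr_ge0// ltW.
  have := ler_wpM2l p0 h2; have -> : s / (3 * n) * 3 = s / n by field; rewrite gt_eqF.
  by [].
have e2 : T%:R * expR (- l) <= s / n.
  rewrite horizon_exp_log ler_pM2l// lef_pV2 ?posrE//; lra.
rewrite big_split/=.
have e3 : \sum_(x | Q x) (T%:R * expR (- l) +
     T%:R * (lam * expR (- (7 / 32 * (5 * l - M))))) <= 2 * s.
  apply: (@le_trans _ _ (\sum_(x | Q x) (2 * (s / n)))).
    by apply: ler_sum => x _; lra.
  rewrite sumr_const -[leLHS]mulr_natl mulrCA ler_pM2l// mulrCA ler_piMr ?(ltW s_gt0)//.
  by rewrite ler_pdivrMr// mul1r.
apply: (@le_trans _ _ (s * (3 + a1 * Num.sqrt l + a2))); first by lra.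
by rewrite ler_pM2l//; apply: le_trans lT.
Qed.
End Horizon.
End Asymptotics.

(** * Optimism and the final bound *)

Section Optimism.
Variables (R : realType) (G : causal_graph) (B : bglm R G).
Context d (Omega : measurableType d) (P : probability Omega R).
Variables (eps gam : nat -> node G -> {RV P >-> R}).
Variables (L1 L2 : node G -> R) (zeta l r : R) (k K : nat) (Sopt : {set node G}).
Hypothesis noise : bglm_noise B eps gam.
Hypothesis smooth : smooth_links B L1 L2.
Hypothesis kappa_gt0 : 0 < kappa B.
Hypothesis optimal : optimal_set B eps gam K Sopt.
Implicit Types (S A : {set node G}) (x y : node G) (h : seq (observation G)).

Local Notation sig S := (sigma B eps gam S (weight B)).

Lemma card_node_gt1 : (1 < #|node G|)%N.
Proof.
rewrite -[2%N](_ : #|[set Defs.root G; target G]%SET| = 2%N) ?max_card//.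
by rewrite cards2 eq_sym target_neq_root.
Qed.

Lemma maxdeg_gt0 : (0 < maxdeg G)%N.
Proof.
apply: (@leq_trans #|par (target G)|); last exact: leq_maxdeg.
by apply/card_gt0P; exists (Defs.root G); rewrite inE edge_root// target_neq_root.
Qed.

(** With q = 4 n^2 - 8 n + 1, the 2 q E / zeta rounds at level zeta / (4 q) each accumulate E / 2,
    hence the factor 2 in the hypothesis on [Lev]. *)
Lemma excitation_level (Lev E n N : R) : 0 < zeta -> 2 <= n ->
  2 * Lev <= E -> (8 * n ^+ 2 - 16 * n + 2) * E / zeta <= N ->
  Lev <= N * ((2 * (4 * n ^+ 2 - 8 * n + 1))^-1 * zeta / 2).
Proof.
move=> z0 n2 LE Ek.
set q := 4 * n ^+ 2 - 8 * n + 1.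
have q0 : 0 < q by rewrite /q; nra.
have -> : (2 * q)^-1 * zeta / 2 = zeta / (4 * q) by field; rewrite gt_eqF.
have p0 : 0 <= zeta / (4 * q) by rewrite divr_ge0 ?mulr_ge0// ltW.
have := ler_wpM2r p0 Ek.
have -> : (8 * n ^+ 2 - 16 * n + 2) * E / zeta * (zeta / (4 * q)) = E / 2.
  have -> : 8 * n ^+ 2 - 16 * n + 2 = 2 * q by rewrite /q; ring.
  by field; rewrite !gt_eqF.
lra.
Qed.

(** On the good event [score_confidence] yields a root of the score and puts the true weights in the
    region, which settles both existence provisos of [bglm_ofu]. Since [Sopt] is admissible, the
    maximum is at least the optimal value; what is left compares two weights of the region on the
    single set [S], by [sigma_smooth] and [confidence_width]. *)
Lemma optimistic_gap h S (hat tilde : params R G) : 0 < l -> r = 3 / kappa B * Num.sqrt l ->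
  (forall x, x != Defs.root G ->
    256 * (maxdeg G)%:R * L2 x ^+ 2 / kappa B ^+ 4 * ((maxdeg G)%:R ^+ 2 + l) <=
    k%:R * (excitation R G * zeta / 2)) ->
  (forall x, x != Defs.root G -> ~~ poorly_excited zeta k x h) ->
  (forall x, x != Defs.root G -> chi2 B x h <= 5 * l) ->
  (forall x, x != Defs.root G ->
    (exists th : 'cV[R]_#|par x|, score B h th = 0) -> score B h (hat x) = 0) ->
  let region := fun th : params R G => forall x, x != Defs.root G ->
    unit_cube (th x) /\ mxnorm (gram R h x) (th x - hat x) <= r in
  ((exists th, region th) -> region tilde /\
    forall S' th, admissible K S' -> region th ->
      sigma B eps gam S' th <= sigma B eps gam S tilde) ->
  sig Sopt - sig S <=
  \sum_(x | x != Defs.root G) (2 * L1 x * r + 1) *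
    ((x \notin S)%:R * \sum_A parents_law B eps gam S x A /
       Num.sqrt (parent_count R x A h + 1)).
Proof.
move=> l0 rE lev good chil hatP region optP.
have conf x : x != Defs.root G ->
    (exists th : 'cV[R]_#|par x|, score B h th = 0) /\
    forall th : 'cV[R]_#|par x|, score B h th = 0 ->
      mxnorm (gram R h x) (weight B x - th) <= r.
  move=> xr; have /negPn/asboolP exc := good x xr; rewrite rE.
  apply: (score_confidence smooth xr kappa_gt0 l0 maxdeg_gt0 (lev x xr)); last exact: chil.
  move=> u; apply: le_trans (exc u) _.
  rewrite -[in leRHS](cat_take_drop k h) big_cat/= lerDl.
  by rewrite sumr_ge0// => o _; rewrite sqr_ge0.
have reg : region (weight B).
  move=> x xr; split; first exact: weight_cube.
  by have [ex cl] := conf x xr; apply: cl; exact: hatP.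
have [regt opt] := optP (ex_intro _ _ reg).
have [tS cS _] := optimal.
have r0 : 0 <= r by rewrite rE mulr_ge0 ?sqrtr_ge0// divr_ge0// ltW.
have gaple : sig Sopt - sig S <= sigma B eps gam S tilde - sig S.
  by rewrite lerD2r; apply: opt => //; split=> //; rewrite cS.
apply: le_trans gaple _.
apply: le_trans (sigma_smooth noise S tilde (fun x a b => @link_lipschitz _ _ _ _ _ smooth x a b)) _.
rewrite big_mkcondl/=; apply: ler_sum => x xr.
have [L10 _ _ _ _] := smooth xr.
case: ifP => xS; last by rewrite mul0r mulr0.
rewrite mul1r mulr_sumr; apply: ler_sum => A _.
rewrite mulrCA; apply: ler_wpM2l; first exact: parents_law_ge0.
apply: (@confidence_width _ _ h x A _ _ (hat x)) => //; first exact: ltW.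
  by case: (regt x xr).
by case: (reg x xr).
Qed.

(* Covers zeta > 1, which the assumption allows only when no node has a parent
   other than the root. *)
Lemma gap_le0_of_root_target S : par (target G) = [set Defs.root G]%SET ->
  sig Sopt - sig S <= 0.
Proof.
move=> parY; rewrite subr_le0 !sigmaE.
have [tS _ _] := optimal.
apply: le_pr.
- exact: (measurable_outcome_pred (P := P) B eps gam 0 Sopt (weight B) (fun v => v (target G))).
- exact: (measurable_outcome_pred (P := P) B eps gam 0 S (weight B) (fun v => v (target G))).
move=> w /=; rewrite {1}/round_outcome outcome_nodeE (negbTE tS) (negbTE (target_neq_root G))/=.
rewrite /round_outcome outcome_nodeE (negbTE (target_neq_root G))/= => H.
apply/orP; right; move: H; congr (_ <= link B _ (dotv _ _) + _).
apply: eq_parv => y yY; have : y \in par (target G) by rewrite inE.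
by rewrite parY inE => /eqP ->; rewrite !(outcome_nodeE _ _ _ _ _ (Defs.root G)) eqxx !orbT.
Qed.

Lemma parents_vary_le1 x x' : parents_vary B eps gam zeta ->
  x != Defs.root G -> x' \in par x -> x' != Defs.root G -> zeta <= 1.
Proof.
move=> [_ vary] xr x'x x'r.
apply: le_trans (vary x x' [ffun=> false] false xr x'x x'r) _.
apply: cond_prob_le1.
  rewrite (_ : [set w | _] = [set w | round_outcome B eps gam 0 finset.set0 (weight B) w x' == false]).
    exact: (measurable_outcome_pred (P := P) B eps gam 0 finset.set0 (weight B) (fun v => v x' == false)).
  by apply/seteqP; split=> w /eqP.
rewrite (_ : [set w | _] = [set w | [forall y, (y \in par x) ==> (y != x') ==> (y != Defs.root G) ==>
  (round_outcome B eps gam 0 finset.set0 (weight B) w y == [ffun=> false] y)]]).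
  exact: (measurable_outcome_pred (P := P) B eps gam 0 finset.set0 (weight B)
    (fun v => [forall y, (y \in par x) ==> (y != x') ==> (y != Defs.root G) ==> (v y == [ffun=> false] y)])).
apply/seteqP; split=> w /=.
  move=> H; apply/forallP => y; apply/implyP => a1; apply/implyP => a2; apply/implyP => a3.
  by apply/eqP; exact: H.
by move=> /forallP H y a1 a2 a3; have := H y; rewrite a1 a2 a3 => /eqP.
Qed.

End Optimism.

Section Main.
Variables (R : realType) (G : causal_graph) (B : bglm R G).
Context d (Omega : measurableType d) (P : probability Omega R).
Variables (eps gam : nat -> node G -> {RV P >-> R}).
Variables (L1 L2 : node G -> R) (zeta : R) (K : nat) (Sopt : {set node G}).
Hypothesis noise : bglm_noise B eps gam.
Hypothesis smooth : smooth_links B L1 L2.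
Hypothesis kappa_gt0 : 0 < kappa B.
Hypothesis optimal : optimal_set B eps gam K Sopt.

Local Notation n := (#|node G|%:R : R).
Local Notation D := ((maxdeg G)%:R : R).
Local Notation main T := ((kappa B)^-1 * n * max_slope L1 * Num.sqrt (D * T%:R) * ln T%:R).

Lemma regret_le_of_gap pi T (b : R) :
  (forall S, sigma B eps gam Sopt (weight B) - sigma B eps gam S (weight B) <= b) ->
  (regret B eps gam Sopt pi T <= (T%:R * b)%:E)%E.
Proof.
move=> gb; rewrite (regretE noise) lee_fin.
have -> : T%:R * b = \sum_(t < T) b by rewrite sumr_const card_ord mulr_natl.
apply: ler_sum => t _; rewrite -(hexp_cst noise pi t b).
by apply: le_hexp => h _; exact: gb.
Qed.

(** At the target, [kappa] is at most a derivative that [L1] bounds. *)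
Lemma slope_ratio_ge1 : 1 <= (kappa B)^-1 * max_slope L1.
Proof.
have tr := target_neq_root G; have [L10 _ _ _ b12] := smooth tr.
rewrite mulrC ler_pdivlMr// mul1r.
apply: (@le_trans _ _ (L1 (target G))).
  apply: le_trans (kappa_le smooth [ffun=> true] tr) _.
  by apply: le_trans (ler_norm _) _; have [] := b12 (dotv (parv (target G) [ffun=> true]) (weight B (target G))).
rewrite /max_slope; exact: (le_bigmax_cond 0 L1 tr).
Qed.

Lemma main_ge T : (0 < T)%N -> Num.sqrt T%:R * ln T%:R <= main T.
Proof.
move=> T0; have T1 : 1 <= T%:R :> R by rewrite ler1n.
apply: ler_wpM2r; first exact: ln_ge0.
have D1 : 1 <= D by rewrite ler1n maxdeg_gt0.
have n1 : 1 <= n by rewrite ler1n ltnW// card_node_gt1.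
have TD : Num.sqrt T%:R <= Num.sqrt (D * T%:R) :> R.
  by apply: ler_wsqrtr; rewrite ler_peMl.
apply: le_trans TD _; rewrite ler_peMl ?sqrtr_ge0//.
by rewrite mulrAC; apply: mulr_ege1 => //; exact: slope_ratio_ge1.
Qed.

Lemma main_ge0 T : 0 <= main T.
Proof.
case: T => [|T]; first by rewrite mulr0 sqrtr0 mulr0 mul0r.
apply: le_trans (main_ge (ltn0Sn T)); rewrite mulr_ge0 ?sqrtr_ge0// ln_ge0//.
by rewrite ler1n.
Qed.

Lemma threshold_coef_ge0 x : 0 <= 512 * D * L2 x ^+ 2 / kappa B ^+ 4.
Proof.
apply: divr_ge0; last by apply: exprn_ge0; exact: ltW.
exact: mulr_ge0 (mulr_ge0 (ler0n _ 512) (ler0n _ _)) (sqr_ge0 _).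
Qed.

Lemma eigen_threshold_le T : 0 <= ln (delta R G T)^-1 ->
  (eigen_threshold B L2 T)%:R <=
  (\sum_(x | x != Defs.root G) (512 * D * L2 x ^+ 2 / kappa B ^+ 4 * (D ^+ 2 + 1) + 1)) *
  (1 + ln (delta R G T)^-1).
Proof.
rewrite /eigen_threshold; set l := ln _ => l0.
apply: (@le_trans _ _ (\sum_(x | x != Defs.root G)
    ceiln (512 * D * L2 x ^+ 2 / kappa B ^+ 4 * (D ^+ 2 + l)))%N%:R).
  rewrite ler_nat; apply/bigmax_leqP => x xr.
  by rewrite (bigD1 x)//= leq_addr.
rewrite natr_sum mulr_suml; apply: ler_sum => x xr.
have D2 : 0 <= D ^+ 2 by exact: sqr_ge0.
have := threshold_coef_ge0 x; move: (512 * D * L2 x ^+ 2 / kappa B ^+ 4) => a a0.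
have al : 0 <= a * (D ^+ 2 + l) by rewrite mulr_ge0// addr_ge0.
apply: le_trans (ceiln_le al) _.
have : 0 <= a * (D ^+ 2 * l) by rewrite !mulr_ge0.
have : 0 <= a by [].
nra.
Qed.

(** Maxima and ceilings are bounded crudely by sums: it only matters that [C] is fixed before T, so
    that the initial phase is logarithmic in the horizon. *)
Lemma init_rounds_le (c : R) : 0 < c -> 0 < zeta -> exists2 C : R, 0 <= C &
  forall T, 0 <= ln (delta R G T)^-1 ->
    (init_rounds B L2 zeta c T)%:R <= C * (1 + ln (delta R G T)^-1).
Proof.
move=> c0 z0.
have n2 : 2 <= n by rewrite ler_nat card_node_gt1.
set q := 8 * n ^+ 2 - 16 * n + 2.
have q0 : 0 <= q by rewrite /q; nra.
pose C1 := \sum_(x | x != Defs.root G) (512 * D * L2 x ^+ 2 / kappa B ^+ 4 * (D ^+ 2 + 1) + 1).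
have C10 : 0 <= C1.
  apply: sumr_ge0 => x _; apply: addr_ge0; last exact: ler01.
  apply: mulr_ge0.
    exact: threshold_coef_ge0.
  by apply: addr_ge0 => //; exact: sqr_ge0.
have a0 : 0 <= c / zeta ^+ 2 by rewrite divr_ge0 ?exprn_ge0// ltW.
have b0 : 0 <= q * C1 / zeta by rewrite divr_ge0 ?mulr_ge0// ltW.
exists (c / zeta ^+ 2 + q * C1 / zeta + 1); first by rewrite !addr_ge0.
move=> T; have := @eigen_threshold_le T; rewrite /init_rounds -/C1 -/q.
set l := ln _; set E := (eigen_threshold _ _ _)%:R => H l0.
have {H}E1 := H l0.
have E0 : 0 <= E by exact: ler0n.
have x0 : 0 <= c / zeta ^+ 2 * l by rewrite mulr_ge0.
have y0 : 0 <= q * E / zeta by rewrite divr_ge0 ?mulr_ge0// ltW.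
have yle : q * E / zeta <= q * C1 / zeta * (1 + l).
  rewrite mulrAC -mulrA [leRHS]mulrAC -[leRHS]mulrA.
  have := ler_wpM2l (_ : 0 <= q / zeta) E1; rewrite divr_ge0 ?(ltW z0)// => /(_ isT).
  lra.
apply: le_trans (ceiln_le _) _; first by rewrite le_max x0.
have : Num.max (c / zeta ^+ 2 * l) (q * E / zeta) <= c / zeta ^+ 2 * l + q * E / zeta.
  by rewrite ge_max lerDl lerDr x0 y0.
have : 0 <= q * C1 / zeta * (1 + l) by rewrite mulr_ge0// addr_ge0.
nra.
Qed.
End Main.

Section Main2.
Variables (R : realType) (G : causal_graph) (B : bglm R G).
Context d (Omega : measurableType d) (P : probability Omega R).
Variables (eps gam : nat -> node G -> {RV P >-> R}).
Variables (L1 L2 : node G -> R) (zeta : R) (K : nat) (Sopt : {set node G}).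
Hypothesis noise : bglm_noise B eps gam.
Hypothesis smooth : smooth_links B L1 L2.
Hypothesis kappa_gt0 : 0 < kappa B.
Hypothesis optimal : optimal_set B eps gam K Sopt.

Local Notation n := (#|node G|%:R : R).
Local Notation D := ((maxdeg G)%:R : R).
Local Notation M := #|{set node G}|.
Local Notation width l := (fun x => 2 * L1 x * (3 / kappa B * Num.sqrt l) + 1).

Lemma ofu_regret_le (c : R) (pi : policy G) (T : nat) :
  let l := ln (delta R G T)^-1 in
  parents_vary B eps gam zeta -> zeta <= 1 ->
  lecue_mendelson c -> 0 < c -> D <= l -> T%:R <= 4 ^+ (2 * ceiln l) :> R ->
  bglm_ofu B eps gam L2 zeta c K T pi ->
  (regret B eps gam Sopt pi T <= ((init_rounds B L2 zeta c T)%:R +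
    \sum_(x | x != Defs.root G) (T%:R * expR (- l) +
      T%:R * (#|{ffun {set node G} -> option (bool * 'I_(2 * ceiln l).+1)}|%:R *
        expR (- (7 / 32 * (5 * l - M%:R)))) +
      width l x * (M%:R * (2 * Num.sqrt T%:R))))%:E)%E.
Proof.
move=> l vary z1 LM c0 Dl TJ [hat [tilde ofuP]].
have z0 : 0 < zeta by case: vary.
have l0 : 0 < l by apply: lt_le_trans Dl; rewrite ltr0n maxdeg_gt0.
set k := init_rounds B L2 zeta c T.
have kl : c / zeta ^+ 2 * l <= k%:R.
  by apply: le_trans (le_ceiln _); rewrite le_max lexx.
have lev x : x != Defs.root G ->
    256 * D * L2 x ^+ 2 / kappa B ^+ 4 * (D ^+ 2 + l) <= k%:R * (excitation R G * zeta / 2).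
  move=> xr; apply: (@excitation_level _ _ _ (eigen_threshold B L2 T)%:R) => //.
  - by rewrite ler_nat card_node_gt1.
  - have -> : 2 * (256 * D * L2 x ^+ 2 / kappa B ^+ 4 * (D ^+ 2 + l)) =
        512 * D * L2 x ^+ 2 / kappa B ^+ 4 * (D ^+ 2 + l) by ring.
    apply: le_trans (le_ceiln _) _; rewrite ler_nat /eigen_threshold.
    exact: (@leq_bigmax_cond _ (fun x => x != Defs.root G)
      (fun x => ceiln (512 * D * L2 x ^+ 2 / kappa B ^+ 4 * (D ^+ 2 + l)))).
  - by apply: le_trans (le_ceiln _); rewrite le_max lexx orbT.
have width0 x : x != Defs.root G -> 0 <= width l x.
  move=> xr; have [L10 _ _ _ _] := smooth xr.
  apply: addr_ge0 => //; apply: mulr_ge0; first by apply: mulr_ge0 => //; exact: ltW.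
  by apply: mulr_ge0; [apply: divr_ge0 => //; exact: ltW|exact: sqrtr_ge0].
(* If the horizon ends within the initial phase, the trivial bound T <= k is enough. Otherwise all k
   initial rounds precede T, the range in which [bglm_ofu] constrains the policy. *)
have [Tk|kT] := leqP T k.
  apply: le_trans (regret_le_of_gap noise pi T (gap_le1 B eps gam Sopt)) _.
  rewrite lee_fin mulr1; apply: (@le_trans _ _ k%:R); first by rewrite ler_nat.
  rewrite lerDl; apply: sumr_ge0 => x xr; apply: addr_ge0; last first.
    apply: mulr_ge0; first exact: width0.
    by apply: mulr_ge0 => //; apply: mulr_ge0 => //; exact: sqrtr_ge0.
  apply: addr_ge0; first by apply: mulr_ge0 => //; exact: expR_ge0.
  by apply: mulr_ge0 => //; apply: mulr_ge0 => //; exact: expR_ge0.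
have explore h : (size h < k)%N -> pi h = finset.set0.
  by move=> hk; have := ofuP h (ltn_trans hk kT); rewrite hk.
apply: (regret_le (zeta := zeta) noise width0 _ _ TJ).
  move=> t h rh /andP[kt tT] good chil.
  have := ofuP h; rewrite (reachable_size rh) tT ltnNge kt /= => /(_ isT)[_ hatP optP].
  rewrite /round_width.
  exact: (optimistic_gap noise smooth kappa_gt0 optimal l0 erefl lev good chil hatP optP).
move=> x t xr kt.
exact: (poorly_excited_le noise vary explore LM c0 z1 Dl l0 kl xr kt).
Qed.

(** [T1] is chosen before the policy, which itself depends on T; this allows a single remainder for
    all policies. *)
Lemma regret_eventually (c : R) :
  parents_vary B eps gam zeta -> zeta <= 1 -> lecue_mendelson c -> 0 < c ->
  exists T1 : nat, forall (T : nat) (pi : policy G), (T1 <= T)%N ->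
    bglm_ofu B eps gam L2 zeta c K T pi ->
    (regret B eps gam Sopt pi T <= ((kappa B)^-1 * n * max_slope L1 *
       Num.sqrt (D * T%:R) * ln T%:R)%:E)%E.
Proof.
move=> vary z1 LM c0; have z0 : 0 < zeta by case: vary.
have [C C0 TC] := init_rounds_le L2 kappa_gt0 c0 z0.
(* The sum over the nodes of the width times 2 M is a1 sqrt l + a2. *)
pose a1 := \sum_(x | x != Defs.root G) (12 * (L1 x / kappa B) * M%:R).
pose a2 : R := \sum_(x : node G | x != Defs.root G) (2 * M%:R).
have n1 : 1 <= n by rewrite ler1n ltnW// card_node_gt1.
have a10 : 0 <= a1.
  apply: sumr_ge0 => x xr; have [L10 _ _ _ _] := smooth xr.
  by apply: mulr_ge0 => //; apply: mulr_ge0 => //; apply: divr_ge0; exact: ltW.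
have a20 : 0 <= a2 by apply: sumr_ge0 => x _; exact: mulr_ge0.
have [l0 dom] := @eventually_dominated R C (expR (7 / 32 * M%:R)) a1 a2 (3 * n) M
  C0 (expR_ge0 _) a10 a20 (mulr_ge0 (ler0n _ 3) (ler0n _ _)).
have ln3n : 0 <= ln (3 * n) by apply: ln_ge0; lra.
(* As l = ln(3 n) + ln T / 2, the bound ln T >= Y yields l >= l0, l >= D and, with ln(3 n) absorbed
   in half of ln T, l <= ln T. *)
pose Y : R := 2 * `|l0| + 2 * ln (3 * n) + 2 * D + 1.
exists (ceiln (expR Y)) => T pi T1T ofu.
have D0 : 0 <= D by exact: ler0n.
have al0 := normr_ge0 l0.
have TY : expR Y <= T%:R by apply: le_trans (le_ceiln _) _; rewrite ler_nat.
have T0 : (0 < T)%N by rewrite -(ltr0n R); apply: lt_le_trans TY; exact: expR_gt0.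
have lnT : Y <= ln T%:R by rewrite -(expRK Y) ler_ln ?posrE ?expR_gt0// ltr0n.
set l := ln (delta R G T)^-1.
have lE : l = ln (3 * n * Num.sqrt T%:R) by rewrite /l /delta invrK.
have lT : l = ln (3 * n) + ln T%:R / 2 by rewrite lE log_horizonE.
have lle : l <= ln T%:R by move: lnT; rewrite lT /Y; lra.
have l0l : l0 <= l by have := ler_norm l0; move: lnT; rewrite lT /Y; lra.
have Dl : D <= l by move: lnT; rewrite lT /Y; lra.
have lp : 0 <= l by exact: le_trans Dl.
(* Choices per configuration: the zero tilt, or a sign and one of 2 ceil(l) + 1 scales, that is 4
   ceil(l) + 3 <= 4 l + 7. *)
have lamE : #|{ffun {set node G} -> option (bool * 'I_(2 * ceiln l).+1)}|%:R <=
    (4 * l + 7) ^+ M.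
  rewrite card_ffun card_option card_prod card_bool card_ord natrX.
  apply: lerXn2r; rewrite ?nnegrE; [exact: ler0n|lra|].
  have -> : (2 * (2 * ceiln l).+1).+1%:R = 4 * (ceiln l)%:R + 3 :> R.
    by rewrite -natr1 natrM -[(2 * _).+1%:R]natr1 natrM; ring.
  have := ceiln_le lp; lra.
have [l1 h1 h2 h3] := dom l l0l.
have TJ : T%:R <= 4 ^+ (2 * ceiln l) :> R by rewrite lE horizon_le_pow// -lE.
apply: le_trans (ofu_regret_le vary z1 LM c0 Dl TJ ofu) _.
rewrite lee_fin; clear LM ofu; apply: le_trans (main_ge smooth kappa_gt0 T0).
rewrite -/l.
have card_le : #|[pred x | x != Defs.root G]|%:R <= n by rewrite ler_nat max_card.
have kC := TC T lp; rewrite -/l in kC.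
move: lamE; set lam := #|{ffun _ -> _}|%:R => lamE.
have h2' : lam * expR (7 / 32 * M%:R) * expR (- (3 / 32 * l)) <= 3.
  apply: le_trans h2; apply: ler_wpM2r; first exact: expR_ge0.
  by apply: ler_wpM2r lamE; exact: expR_ge0.
rewrite lE in kC h1 h2' h3 lle *.
apply: (horizon_total_le n1 T0 card_le _ kC h1 h2' h3 lle); first exact: ler0n.
rewrite -lE; move: (Num.sqrt l) (Num.sqrt T%:R) => u s.
rewrite /a1 /a2 mulr_suml -big_split/= mulr_suml le_eqVlt; apply/orP; left.
by apply/eqP/eq_bigr => x _; field; rewrite gt_eqF.
Qed.
End Main2.

Theorem theorem1 (R : realType) :
  exists C : R, 0 < C /\
  forall (c : R), 0 < c -> lecue_mendelson c ->
  forall (G : causal_graph) (B : bglm R G)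
    (d : measure_display) (Omega : measurableType d) (P : probability Omega R)
    (eps gam : nat -> node G -> {RV P >-> R})
    (L1 L2 : node G -> R) (zeta : R) (K : nat) (Sopt : {set node G}),
  bglm_noise B eps gam ->
  smooth_links B L1 L2 ->
  0 < kappa B ->
  parents_vary B eps gam zeta ->
  optimal_set B eps gam K Sopt ->
  exists r : nat -> R,
    (r T / Num.sqrt T%:R @[T --> \oo] --> (0 : R)) /\
    forall (T : nat) (pi : policy G),
    bglm_ofu B eps gam L2 zeta c K T pi ->
    (regret B eps gam Sopt pi T <=
     (C * ((kappa B)^-1 * #|node G|%:R * max_slope L1
           * Num.sqrt ((maxdeg G)%:R * T%:R) * ln T%:R) + r T)%:E)%E.
Proof.
exists 1; split; first exact: ltr01.
move=> c c0 LM G B d Omega P eps gam L1 L2 zeta K Sopt noise smooth k0 vary opt.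
suff [T1 HT1] : exists T1 : nat, forall (T : nat) (pi : policy G), (T1 <= T)%N ->
    bglm_ofu B eps gam L2 zeta c K T pi ->
    (regret B eps gam Sopt pi T <= ((kappa B)^-1 * #|node G|%:R * max_slope L1 *
       Num.sqrt ((maxdeg G)%:R * T%:R) * ln T%:R)%:E)%E.
  exists (fun T => if (T < T1)%N then T%:R else 0); split.
    apply: cvg_near_cst; exists T1 => // T /= T1T.
    by rewrite ltnNge T1T mul0r.
  move=> T pi ofu; rewrite mul1r; case: ltnP => [TT1|T1T].
    apply: le_trans (regret_le_of_gap noise pi T (gap_le1 B eps gam Sopt)) _.
    by rewrite lee_fin mulr1 lerDr; exact: main_ge0 smooth k0 T.
  by rewrite addr0; exact: HT1.
(* Lecue-Mendelson is applied with beta = zeta, hence needs zeta <= 1. A larger zeta leaves the root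
   as the only parent of the target, and then every gap is at most 0. *)
have [z1|z1] := lerP zeta 1.
  exact: (regret_eventually noise smooth k0 opt vary z1 LM c0).
exists 0%N => T pi _ _.
have parY : par (target G) = [set Defs.root G]%SET.
  apply/setP => y; rewrite finset.in_set finset.in_set1; apply/idP/eqP => [yY|->]; last first.
    by rewrite edge_root// target_neq_root.
  apply/eqP; apply: contraTT z1 => yr; rewrite -leNgt.
  have y_par : y \in par (target G) by rewrite finset.in_set.
  exact: (parents_vary_le1 vary (target_neq_root G) y_par yr).
apply: le_trans (regret_le_of_gap noise pi T (fun S => gap_le0_of_root_target opt S parY)) _.
by rewrite lee_fin mulr0; exact: main_ge0 smooth k0 T.
Qed.
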